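(* For the quantum group $\mathfrak{D}$ at $\mathbb{S}_3$ attached to the 12-dimensional Fomin–Kirillov algebra, the quotient $\mathsf{VQN}/\mathsf{S}(\sigma,-)$ is a simple highest-weight module of weight $(e,\rho)$. Therefore $$\mathsf{L}(e,\rho)\simeq M(e,\rho)\oplus M(\sigma,+)\oplus M(\tau,0)$$ as $\mathfrak{D}(\mathbb{S}_3)$-modules.
   Context: $\Bbbk$ is an algebraically closed field of characteristic zero, $\zeta\in\Bbbk$ a fixed primitive cube root of $1$; $\sigma=(12)$, $\tau=(123)$ in $\mathbb{S}_3$, permutations composed right to left, so $\sigma\tau=(23)$, $\sigma\tau^2=(13)$. $V=\Bbbk\{x_{(12)},x_{(23)},x_{(13)}\}$ is the Yetter–Drinfeld module over $\Bbbk\mathbb{S}_3$ with $g\cdot x_{(ij)}=\mathrm{sgn}(g)x_{g(ij)g^{-1}}$ and coaction $x_{(ij)}\mapsto(ij)\otimes x_{(ij)}$. Its Nichols algebra $\mathfrak{B}(V)$ is the 12-dimensional Fomin–Kirillov algebra (top degree 4). $\mathfrak{D}$ is the Drinfeld double of the bosonization $\mathfrak{B}(V)\#\Bbbk\mathbb{S}_3$. Explicitly, $\mathfrak{D}$ is the algebra generated by $x_{(ij)}$, $y_{(ij)}$ (transpositions $(ij)$) and $g,\delta_g$ ($g\in\mathbb{S}_3$), where the $g$ multiply as in $\mathbb{S}_3$, the $\delta_g$ are orthogonal idempotents with sum $1$, and, for distinct $i,j,k$ and $g,h\in\mathbb{S}_3$: $x_{(ij)}^2=0$, $x_{(ij)}x_{(ik)}+x_{(jk)}x_{(ij)}+x_{(ik)}x_{(jk)}=0$;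 the same relations for the $y$'s; $\delta_hg=g\delta_{g^{-1}hg}$; $gx_{(ij)}=\mathrm{sgn}(g)x_{g(ij)g^{-1}}g$; $\delta_hx_{(ij)}=x_{(ij)}\delta_{(ij)h}$; $\delta_gy_{(ij)}=y_{(ij)}\delta_{(ij)g}$; $y_{(ij)}g=\mathrm{sgn}(g)\,g\,y_{g^{-1}(ij)g}$; $y_{(ij)}x_{(ij)}+x_{(ij)}y_{(ij)}=1+(ij)(\delta_{(ij)}-\delta_e)$; $y_{(ik)}x_{(ij)}+x_{(ij)}y_{(jk)}=(ij)(\delta_{(ik)}-\delta_{(ik)(ij)})$. The $g,\delta_g$ generate the Drinfeld double $\mathfrak{D}(\mathbb{S}_3)$ of $\Bbbk\mathbb{S}_3$; $\overline V=\Bbbk\{y_{(ij)}\}$ generates $\mathfrak{B}(\overline V)$; multiplication $\mathfrak{B}(V)\otimes\mathfrak{D}(\mathbb{S}_3)\otimes\mathfrak{B}(\overline V)\to\mathfrak{D}$ is a linear isomorphism. Simple $\mathfrak{D}(\mathbb{S}_3)$-modules relevant here (''degree $h$'' means $\delta_h$ acts as identity and other $\delta$'s by $0$): $M(e,\rho)$, the 2-dimensional irreducible $\mathbb{S}_3$-module in degree $e$; $M(\sigma,\pm)$ with basis $|12\rangle,|23\rangle,|13\rangle$, $|ij\rangle$ of degree $(ij)$, $g|ij\rangle=|g(ij)g^{-1}\rangle$ for $+$ and $g|ij\rangle=\mathrm{sgn}(g)|g(ij)g^{-1}\rangle$ for $-$; $M(\tau,0)$ with basis $|\tau\rangle,|\tau^{-1}\rangle$,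 $|\tau^{\pm1}\rangle$ of degree $\tau^{\pm1}$, $\tau^t|\tau^{\pm1}\rangle=|\tau^{\pm1}\rangle$, $\sigma\tau^t|\tau^{\pm1}\rangle=|\tau^{\mp1}\rangle$. A $\mathfrak{D}(\mathbb{S}_3)$-module is of weight $(g,\varrho)$ if it is isomorphic to $M(g,\varrho)$. Let $\mathfrak{D}^{\ge0}$ be the subalgebra generated by $\mathfrak{D}(\mathbb{S}_3)$ and $\overline V$; a simple $\mathfrak{D}(\mathbb{S}_3)$-module $M(g,\varrho)$ is a $\mathfrak{D}^{\ge0}$-module with $\overline V$ acting by $0$. The Verma module is $\mathsf{M}(g,\varrho)=\mathfrak{D}\otimes_{\mathfrak{D}^{\ge0}}M(g,\varrho)=\mathfrak{B}(V)\otimes M(g,\varrho)$; write $x|h\rangle$ for $x\otimes|h\rangle$. It has a unique maximal $\mathfrak{D}$-submodule; $\mathsf{L}(g,\varrho)$ is its head and $\mathsf{S}(g,\varrho)$ its socle. A $\mathfrak{D}$-module is a highest-weight module of weight $(g,\varrho)$ if it is generated by a $\mathfrak{D}(\mathbb{S}_3)$-submodule $M$ of weight $(g,\varrho)$ with $\overline VM=0$. In $\mathsf{M}(\sigma,-)$, let $\mathsf{V},\mathsf{Q},\mathsf{N}_0$ be the $\mathfrak{D}(\mathbb{S}_3)$-submodules generated respectively by $\mathsf v=\zeta^{-1}x_{(23)}|23\rangle+\zeta x_{(13)}|13\rangle+x_{(12)}|12\rangle$; $\mathsf q=x_{(12)}x_{(23)}|23\rangle-x_{(12)}x_{(13)}|13\rangle$;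 $\mathsf n_0=x_{(13)}x_{(12)}x_{(23)}|23\rangle+x_{(12)}x_{(13)}x_{(23)}|12\rangle-x_{(12)}x_{(13)}x_{(12)}|13\rangle$. Set $\mathsf{VQN}=\mathsf{S}(\sigma,-)\oplus\mathsf V\oplus\mathsf Q\oplus\mathsf N_0$, a $\mathfrak{D}$-submodule of $\mathsf{M}(\sigma,-)$. *)

(* Defs.v *)
From HB Require Import structures.
From mathcomp Require Import all_boot all_order all_fingroup all_algebra.
From mathcomp Require Import boolp.

Set Implicit Arguments.
Unset Strict Implicit.
Unset Printing Implicit Defensive.

Import GRing.Theory.
Local Open Scope ring_scope.
Local Open Scope quotient_scope.
Local Notation qrepr := generic_quotient.repr.

Inductive pterm (k I : Type) : Type :=
| Cst of k
| Gen of I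
| Add of pterm k I & pterm k I
| Opp of pterm k I
| Mul of pterm k I & pterm k I.
Arguments Cst {k I} c.
Arguments Gen {k I} i.

Declare Scope pterm_scope.
Delimit Scope pterm_scope with PT.
Bind Scope pterm_scope with pterm.
Notation "a + b" := (Add a b) : pterm_scope.
Notation "- a" := (Opp a) : pterm_scope.
Notation "a - b" := (Add a (Opp b)) : pterm_scope.
Notation "a * b" := (Mul a b) : pterm_scope.

Fixpoint tmap (k I J : Type) (f : I -> J) (a : pterm k I) : pterm k J :=
  match a with
  | Cst c => Cst c
  | Gen i => Gen (f i)
  | Add a b => tmap f a + tmap f b
  | Opp a => - tmap f a
  | Mul a b => tmap f a * tmap f b
  end%PT.

(* The least congruence on terms that contains [rel] and makes the quotient
   a unital associative [k]-algebra. *)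
Inductive cong (k : fieldType) (I : Type) (rel : pterm k I -> pterm k I -> Prop) :
    pterm k I -> pterm k I -> Prop :=
| cong_rel a b : rel a b -> cong rel a b
| cong_refl a : cong rel a a
| cong_sym a b : cong rel a b -> cong rel b a
| cong_trans b a c : cong rel a b -> cong rel b c -> cong rel a c
| cong_add a a' b b' :
    cong rel a a' -> cong rel b b' -> cong rel (a + b)%PT (a' + b')%PT
| cong_opp a a' : cong rel a a' -> cong rel (- a)%PT (- a')%PT
| cong_mul a a' b b' :
    cong rel a a' -> cong rel b b' -> cong rel (a * b)%PT (a' * b')%PT
| cong_addA a b c : cong rel (a + (b + c))%PT (a + b + c)%PT
| cong_addC a b : cong rel (a + b)%PT (b + a)%PT
| cong_add0 a : cong rel (Cst 0 + a)%PT a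
| cong_addN a : cong rel (- a + a)%PT (Cst 0)
| cong_mulA a b c : cong rel (a * (b * c))%PT (a * b * c)%PT
| cong_mul1l a : cong rel (Cst 1 * a)%PT a
| cong_mul1r a : cong rel (a * Cst 1)%PT a
| cong_mulDl a b c : cong rel ((a + b) * c)%PT (a * c + b * c)%PT
| cong_mulDr a b c : cong rel (a * (b + c))%PT (a * b + a * c)%PT
| cong_cstD c d : cong rel (Cst (c + d)) (Cst c + Cst d)%PT
| cong_cstM c d : cong rel (Cst (c * d)) (Cst c * Cst d)%PT
| cong_cstC c a : cong rel (Cst c * a)%PT (a * Cst c)%PT.

HB.instance Definition _ (k I : Type) := gen_eqMixin (pterm k I).
HB.instance Definition _ (k I : Type) := gen_choiceMixin (pterm k I).

Section Presented.
Variables (k : fieldType) (I : Type) (rel : pterm k I -> pterm k I -> Prop).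

Definition congb (a b : pterm k I) : bool := `[< cong rel a b >].

Lemma congb_equiv : equiv_class_of congb.
Proof.
split=> [a|a b|b a c]; first exact/asboolP/cong_refl.
  by apply/asboolP/asboolP => /cong_sym.
by move=> /asboolP ab /asboolP bc; apply/asboolP/(cong_trans ab bc).
Qed.

Canonical congb_equiv_rel := EquivRelPack congb_equiv.

Definition presented : Type := {eq_quot congb}.
HB.instance Definition _ := Choice.on presented.
HB.instance Definition _ := EqQuotient.on presented.

Definition pcls (a : pterm k I) : presented := \pi_presented a.

Lemma pclsP a b : pcls a = pcls b <-> cong rel a b.
Proof.
split=> [|ab]; first by move=> /eqmodP /asboolP.
by apply/eqmodP/asboolP.
Qed.

Lemma presW (P : presented -> Prop) : (forall a, P (pcls a)) -> forall x, P x.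
Proof. by move=> h; elim/quotW. Qed.

Lemma repr_cong a : cong rel (qrepr (pcls a)) a.
Proof. by apply/pclsP; rewrite /pcls reprK. Qed.

Definition padd (x y : presented) := pcls (qrepr x + qrepr y)%PT.
Definition popp (x : presented) := pcls (- qrepr x)%PT.
Definition pmul (x y : presented) := pcls (qrepr x * qrepr y)%PT.
Definition pscale (c : k) (x : presented) := pcls (Cst c * qrepr x)%PT.

Lemma paddE a b : padd (pcls a) (pcls b) = pcls (a + b)%PT.
Proof. by apply/pclsP/cong_add; exact: repr_cong. Qed.
Lemma poppE a : popp (pcls a) = pcls (- a)%PT.
Proof. by apply/pclsP/cong_opp; exact: repr_cong. Qed.
Lemma pmulE a b : pmul (pcls a) (pcls b) = pcls (a * b)%PT.
Proof. by apply/pclsP/cong_mul; exact: repr_cong. Qed.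
Lemma pscaleE c a : pscale c (pcls a) = pcls (Cst c * a)%PT.
Proof. by apply/pclsP/cong_mul; [exact: cong_refl|exact: repr_cong]. Qed.

Let pE := (paddE, poppE, pmulE, pscaleE).

Fact paddA : associative padd.
Proof. by do 3!elim/presW=> ?; rewrite !pE; apply/pclsP/cong_addA. Qed.
Fact paddC : commutative padd.
Proof. by do 2!elim/presW=> ?; rewrite !pE; apply/pclsP/cong_addC. Qed.
Fact padd0 : left_id (pcls (Cst 0)) padd.
Proof. by elim/presW=> ?; rewrite !pE; apply/pclsP/cong_add0. Qed.
Fact paddN : left_inverse (pcls (Cst 0)) popp padd.
Proof. by elim/presW=> ?; rewrite !pE; apply/pclsP/cong_addN. Qed.
Fact pmulA : associative pmul.
Proof. by do 3!elim/presW=> ?; rewrite !pE; apply/pclsP/cong_mulA. Qed.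
Fact pmul1l : left_id (pcls (Cst 1)) pmul.
Proof. by elim/presW=> ?; rewrite !pE; apply/pclsP/cong_mul1l. Qed.
Fact pmul1r : right_id (pcls (Cst 1)) pmul.
Proof. by elim/presW=> ?; rewrite !pE; apply/pclsP/cong_mul1r. Qed.
Fact pmulDl : left_distributive pmul padd.
Proof. by do 3!elim/presW=> ?; rewrite !pE; apply/pclsP/cong_mulDl. Qed.
Fact pmulDr : right_distributive pmul padd.
Proof. by do 3!elim/presW=> ?; rewrite !pE; apply/pclsP/cong_mulDr. Qed.

HB.instance Definition _ := GRing.isPzRing.Build presented
  paddA paddC padd0 paddN pmulA pmul1l pmul1r pmulDl pmulDr.

Fact pscaleA c d (x : presented) : pscale c (pscale d x) = pscale (c * d) x.
Proof.
elim/presW: x => a; rewrite !pscaleE; apply/pclsP.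
apply: cong_trans (cong_mulA rel _ _ _) _.
by apply: cong_mul (cong_refl _ _); apply/cong_sym/cong_cstM.
Qed.
Fact pscale1 : left_id 1 pscale.
Proof. by elim/presW=> ?; rewrite !pE; apply/pclsP/cong_mul1l. Qed.
Fact pscaleDr : right_distributive pscale +%R.
Proof.
move=> c; do 2!elim/presW=> ?.
by rewrite /GRing.add /= !pE; apply/pclsP/cong_mulDr.
Qed.
Fact pscaleDl (x : presented) : {morph pscale^~ x : c d / c + d}.
Proof.
elim/presW: x => a c d; rewrite [RHS]/GRing.add /= !pE; apply/pclsP.
apply: cong_trans (cong_mulDl rel _ _ _).
exact: cong_mul (cong_cstD _ _ _) (cong_refl _ _).
Qed.

HB.instance Definition _ := GRing.Zmodule_isLmodule.Build k presented
  pscaleA pscale1 pscaleDr pscaleDl.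

Definition pgen (i : I) : presented := pcls (Gen i).

Lemma pclsD a b : pcls (a + b)%PT = pcls a + pcls b.
Proof. by rewrite [RHS]paddE. Qed.
Lemma pclsN a : pcls (- a)%PT = - pcls a.
Proof. by rewrite [RHS]poppE. Qed.
Lemma pclsM a b : pcls (a * b)%PT = pcls a * pcls b.
Proof. by rewrite [RHS]pmulE. Qed.
Lemma pcls_cst c : pcls (Cst c) = c *: (1 : presented).
Proof. by rewrite [RHS]pscaleE; apply/pclsP/cong_sym/cong_mul1r. Qed.

Lemma pscalerAl c (x y : presented) : c *: (x * y) = (c *: x) * y.
Proof.
elim/presW: x => a; elim/presW: y => b.
by rewrite -pclsM [LHS]pscaleE [c *: _]pscaleE -pclsM;
   apply/pclsP/cong_mulA.
Qed.

Lemma pscalerAr c (x y : presented) : c *: (x * y) = x * (c *: y).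
Proof.
elim/presW: x => a; elim/presW: y => b.
rewrite -pclsM [LHS]pscaleE [c *: _]pscaleE -pclsM; apply/pclsP.
apply: cong_trans (cong_mulA rel _ _ _) _; apply/cong_sym.
apply: cong_trans (cong_mulA rel _ _ _) _.
by apply: cong_mul (cong_refl _ _); apply/cong_sym/cong_cstC.
Qed.

End Presented.

Section Lift.
Variables (k : fieldType) (I J : Type).
Variables (rel : pterm k I -> pterm k I -> Prop).
Variables (rel' : pterm k J -> pterm k J -> Prop).
Local Notation A := (presented rel').

Fixpoint teval (f : I -> A) (a : pterm k I) : A :=
  match a with
  | Cst c => c *: (1 : A)
  | Gen i => f i
  | Add a b => teval f a + teval f b
  | Opp a => - teval f a
  | Mul a b => teval f a * teval f b
  end.

Variables (f : I -> A) (fP : forall a b, rel a b -> teval f a = teval f b).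

Lemma teval_cong a b : cong rel a b -> teval f a = teval f b.
Proof.
elim=> //=.
- by move=> ? ? ? _ -> _ ->.
- by move=> ? ? ? ? _ -> _ ->.
- by move=> ? ? _ ->.
- by move=> ? ? ? ? _ -> _ ->.
- by move=> *; rewrite addrA.
- by move=> *; rewrite addrC.
- by move=> *; rewrite scale0r add0r.
- by move=> *; rewrite addNr scale0r.
- by move=> *; rewrite mulrA.
- by move=> *; rewrite scale1r mul1r.
- by move=> *; rewrite scale1r mulr1.
- by move=> *; rewrite mulrDl.
- by move=> *; rewrite mulrDr.
- by move=> *; rewrite scalerDl.
- by move=> *; rewrite -pscalerAl mul1r scalerA.
- by move=> *; rewrite -pscalerAl -pscalerAr mul1r mulr1.
Qed.

Definition plift of (forall a b, rel a b -> teval f a = teval f b) :=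
  fun x : presented rel => teval f (qrepr x).

Lemma pliftE a : plift fP (pcls rel a) = teval f a.
Proof. exact/teval_cong/repr_cong. Qed.

Fact plift_zmod : zmod_morphism (plift fP).
Proof.
by elim/presW=> a; elim/presW=> b; rewrite -pclsN -pclsD !pliftE.
Qed.
Fact plift_monoid : monoid_morphism (plift fP).
Proof.
split; first by rewrite [plift fP _]pliftE /= scale1r.
by elim/presW=> a; elim/presW=> b; rewrite -pclsM !pliftE.
Qed.
Fact plift_scalable : scalable (plift fP).
Proof.
move=> c; elim/presW=> a.
by rewrite [c *: _]pscaleE !pliftE /= -pscalerAl mul1r.
Qed.

HB.instance Definition _ :=
  GRing.isZmodMorphism.Build (presented rel) A (plift fP) plift_zmod.
HB.instance Definition _ :=
  GRing.isMonoidMorphism.Build (presented rel) A (plift fP) plift_monoid.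
HB.instance Definition _ :=
  GRing.isScalable.Build k (presented rel) A *:%R (plift fP) plift_scalable.

End Lift.

Section TmapLift.
Variables (k : fieldType) (I J : Type) (h : I -> J).
Variables (rel' : pterm k J -> pterm k J -> Prop).

Lemma teval_tmap a :
  teval (fun i => pgen rel' (h i)) a = pcls rel' (tmap h a).
Proof.
elim: a => [c|i|a IHa b IHb|a IHa|a IHa b IHb] //=.
- by rewrite pcls_cst.
- by rewrite IHa IHb pclsD.
- by rewrite IHa pclsN.
- by rewrite IHa IHb pclsM.
Qed.

Lemma pmapP (rel : pterm k I -> pterm k I -> Prop) :
  (forall a b, rel a b -> rel' (tmap h a) (tmap h b)) ->
  forall a b, rel a b ->
    teval (fun i => pgen rel' (h i)) a = teval (fun i => pgen rel' (h i)) b.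
Proof.
by move=> H a b /H ab; rewrite !teval_tmap; apply/pclsP/cong_rel.
Qed.

End TmapLift.

Section Rep.
Variables (k : fieldType) (I : Type) (rel : pterm k I -> pterm k I -> Prop).

Fixpoint tact (U : lmodType k) (op : I -> U -> U) (a : pterm k I) (u : U) : U :=
  match a with
  | Cst c => c *: u
  | Gen i => op i u
  | Add a b => tact op a u + tact op b u
  | Opp a => - tact op a u
  | Mul a b => tact op a (tact op b u)
  end.

Record rep := Rep {
  rep_space : lmodType k;
  rep_op : I -> rep_space -> rep_space;
  rep_lin : forall i, linear (rep_op i);
  rep_rel : forall a b, rel a b -> tact rep_op a =1 tact rep_op b }.

Variable V : rep.
Local Notation act := (tact (@rep_op V)).

Lemma tact_lin a : linear (act a).
Proof.
elim: a => [c|i|a IHa b IHb|a IHa|a IHa b IHb] d u v /=.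
- by rewrite scalerDr !scalerA mulrC.
- exact: rep_lin.
- by rewrite IHa IHb scalerDr addrACA.
- by rewrite IHa opprD scalerN.
- by rewrite IHb IHa.
Qed.

Lemma tactD a u v : act a (u + v) = act a u + act a v.
Proof. by have := tact_lin a 1 u v; rewrite !scale1r. Qed.

Lemma tactZ a c u : act a (c *: u) = c *: act a u.
Proof.
have a0 : act a 0 = 0.
  by apply: (addIr (act a 0)); rewrite -tactD !add0r.
by have := tact_lin a c u 0; rewrite a0 !addr0.
Qed.

Lemma tact_cong a b : cong rel a b -> act a =1 act b.
Proof.
elim=> //=.
- exact: rep_rel.
- by move=> ? ? ? H u; rewrite H.
- by move=> ? ? ? ? H ? H' u; rewrite H H'.
- by move=> ? ? ? ? ? H ? H' u; rewrite H H'.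
- by move=> ? ? ? H u; rewrite H.
- by move=> ? ? ? ? ? H ? H' u; rewrite H' H.
- by move=> *; move=> u; rewrite addrA.
- by move=> *; move=> u; rewrite addrC.
- by move=> *; move=> u; rewrite scale0r add0r.
- by move=> *; move=> u; rewrite addNr scale0r.
- by move=> *; move=> u; rewrite scale1r.
- by move=> *; move=> u; rewrite scale1r.
- by move=> *; move=> u; rewrite tactD.
- by move=> *; move=> u; rewrite scalerDl.
- by move=> *; move=> u; rewrite scalerA.
- by move=> *; move=> u; rewrite tactZ.
Qed.

Definition rep_mod : Type := rep_space V.
HB.instance Definition _ := GRing.Zmodule.copy rep_mod (rep_space V).

Definition rep_scale (x : presented rel) (u : rep_mod) : rep_mod :=
  act (qrepr x) u.

Lemma rep_scaleE a u : rep_scale (pcls rel a) u = act a u.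
Proof. exact/tact_cong/repr_cong. Qed.

Fact rep_scaleA x y u : rep_scale x (rep_scale y u) = rep_scale (x * y) u.
Proof.
by elim/presW: x => a; elim/presW: y => b; rewrite -pclsM !rep_scaleE.
Qed.
Fact rep_scale1 : left_id 1 rep_scale.
Proof. by move=> u; rewrite [LHS]rep_scaleE /= scale1r. Qed.
Fact rep_scaleDr : right_distributive rep_scale +%R.
Proof. by elim/presW=> a u v; rewrite !rep_scaleE; exact: tactD. Qed.
Fact rep_scaleDl u : {morph rep_scale^~ u : x y / x + y}.
Proof.
by elim/presW=> a; elim/presW=> b; rewrite -pclsD !rep_scaleE.
Qed.

HB.instance Definition _ :=
  GRing.Zmodule_isLmodule.Build (presented rel) rep_mod
    rep_scaleA rep_scale1 rep_scaleDr rep_scaleDl.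

End Rep.

Section Submodules.
Variables (R : pzRingType) (U : lmodType R).

Definition is_submod (P : U -> Prop) : Prop :=
  P 0 /\ forall a u v, P u -> P v -> P (a *: u + v).

Section Pack.
Variables (P : U -> Prop) (PP : is_submod P).

Definition submod_pred of is_submod P : {pred U} := [pred u | `[< P u >]].
Local Notation S := (submod_pred PP).

Fact submod_pred_add : GRing.addr_closed S.
Proof.
have [P0 PL] := PP; split; first exact/asboolP.
move=> u v /asboolP Pu /asboolP Pv; apply/asboolP.
by rewrite -[u]scale1r; exact: PL.
Qed.
Fact submod_pred_scale : GRing.scaler_closed S.
Proof.
have [P0 PL] := PP => a u /asboolP Pu; apply/asboolP.
by rewrite -[_ *: _]addr0; exact: PL.
Qed.

HB.instance Definition _ := GRing.isAddClosed.Build U S submod_pred_add.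
HB.instance Definition _ := GRing.isScaleClosed.Build R U S submod_pred_scale.

Definition Submod : submodClosed U := S.

Lemma SubmodP u : reflect (P u) (u \in Submod).
Proof. exact: asboolP. Qed.

End Pack.

Fact submod_opp (N : submodClosed U) : oppr_closed N.
Proof. by move=> u Nu; rewrite -scaleN1r; exact: rpredZ. Qed.

Definition zpred (N : submodClosed U) : {pred U} := fun u => u \in N.

HB.instance Definition _ N := GRing.isAddClosed.Build U (zpred N) (rpred0D N).
HB.instance Definition _ N := GRing.isOppClosed.Build U (zpred N) (@submod_opp N).

Definition sub_mod (N : submodClosed U) : Type := {u : U | u \in N}.
HB.instance Definition _ N := SubChoice.on (sub_mod N).
HB.instance Definition _ N := [SubChoice_isSubLmodule of sub_mod N by <:].

Section Quotient.
Variable N : submodClosed U.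

Definition quot_mod : Type := Quotient.quot (zpred N).
HB.instance Definition _ := GRing.Zmodule.on quot_mod.
HB.instance Definition _ := EqQuotient.on quot_mod.

Definition quot_pi (u : U) : quot_mod := \pi_quot_mod u.

Lemma quot_piP u v : quot_pi u = quot_pi v <-> u - v \in N.
Proof. by split=> [/eqmodP|?]; last apply/eqmodP. Qed.

Lemma quotW_mod (P : quot_mod -> Prop) : (forall u, P (quot_pi u)) -> forall x, P x.
Proof. by move=> h; elim/quotW. Qed.

Lemma quot_piD u v : quot_pi (u + v) = quot_pi u + quot_pi v.
Proof. exact: Quotient.pi_add. Qed.

Definition quot_scale (a : R) (x : quot_mod) : quot_mod := quot_pi (a *: qrepr x).

Lemma quot_scaleE a u : quot_scale a (quot_pi u) = quot_pi (a *: u).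
Proof.
apply/quot_piP; rewrite -scalerBr; apply: rpredZ.
by apply/quot_piP; rewrite /quot_pi reprK.
Qed.

Fact quot_scaleA a b x : quot_scale a (quot_scale b x) = quot_scale (a * b) x.
Proof. by elim/quotW_mod: x => u; rewrite !quot_scaleE scalerA. Qed.
Fact quot_scale1 : left_id 1 quot_scale.
Proof. by elim/quotW_mod=> u; rewrite quot_scaleE scale1r. Qed.
Fact quot_scaleDr : right_distributive quot_scale +%R.
Proof.
move=> a; elim/quotW_mod=> u; elim/quotW_mod=> v.
by rewrite -quot_piD !quot_scaleE -quot_piD scalerDr.
Qed.
Fact quot_scaleDl x : {morph quot_scale^~ x : a b / a + b}.
Proof.
by elim/quotW_mod: x => u a b; rewrite !quot_scaleE -quot_piD scalerDl.
Qed.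

HB.instance Definition _ := GRing.Zmodule_isLmodule.Build R quot_mod
  quot_scaleA quot_scale1 quot_scaleDr quot_scaleDl.

End Quotient.

Fact gen_submod_subproof (A : U -> Prop) :
  is_submod (fun u => forall N : submodClosed U,
    (forall w, A w -> w \in N) -> u \in N).
Proof.
split=> [N _|a u v Pu Pv N AN]; first exact: rpred0.
by rewrite rpredD ?rpredZ ?Pu ?Pv.
Qed.

Definition gen_submod (A : U -> Prop) : submodClosed U :=
  Submod (gen_submod_subproof A).

Fact add_submod_subproof (N1 N2 : submodClosed U) :
  is_submod (fun u => exists u1 u2, [/\ u1 \in N1, u2 \in N2 & u = u1 + u2]).
Proof.
split; first by exists 0, 0; rewrite !rpred0 addr0.
move=> a _ _ [u1 [u2 [Nu1 Nu2 ->]]] [v1 [v2 [Nv1 Nv2 ->]]].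
exists (a *: u1 + v1), (a *: u2 + v2).
by rewrite scalerDr addrACA !rpredD ?rpredZ.
Qed.

Definition add_submod N1 N2 : submodClosed U :=
  Submod (add_submod_subproof N1 N2).

Definition maximal_submod (N : submodClosed U) : Prop :=
  (exists u, u \notin N) /\
  forall N' : submodClosed U, {subset N <= N'} ->
    N' =i N \/ (forall u, u \in N').

Fact radical_subproof :
  is_submod (fun u => forall N, maximal_submod N -> u \in N).
Proof.
split=> [N _|a u v Pu Pv N Nmax]; first exact: rpred0.
by rewrite rpredD ?rpredZ ?Pu ?Pv.
Qed.

Definition radical_mod : submodClosed U := Submod radical_subproof.
Definition head_mod : Type := quot_mod radical_mod.
HB.instance Definition _ := GRing.Lmodule.on head_mod.

Definition simple_mod : Prop :=
  (exists u : U, u != 0) /\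
  forall N : submodClosed U, (forall u, u \in N -> u = 0) \/ (forall u, u \in N).

End Submodules.

Fact restr_submod_subproof (R : pzRingType) (U : lmodType R)
    (N W : submodClosed U) :
  is_submod (fun w : sub_mod W => val w \in N).
Proof.
split=> [|a u v Nu Nv]; first by rewrite raddf0 rpred0.
by rewrite linearP rpredD ?rpredZ.
Qed.

Definition restr_submod (R : pzRingType) (U : lmodType R)
    (N W : submodClosed U) : submodClosed (sub_mod W) :=
  Submod (restr_submod_subproof N W).

(* [W / N], for submodules [N] and [W] of [U] with [N] contained in [W]. *)
Definition subquot_mod (R : pzRingType) (U : lmodType R)
  (W N : submodClosed U) : lmodType R := quot_mod (restr_submod N W).

Definition socle_mod (R : pzRingType) (U : lmodType R) : submodClosed U :=
  gen_submod (fun u => exists N : submodClosed U, simple_mod (sub_mod N) /\ u \in N).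

Definition iso_mod (R : pzRingType) (U V : lmodType R) : Prop :=
  exists f : {linear U -> V}, bijective f.

Section ChangeOfRings.
Variables (B A : pzRingType) (f : {rmorphism B -> A}).

Definition res_mod of {rmorphism B -> A} := fun (U : lmodType A) => U : Type.

Section Restriction.
Variable U : lmodType A.
HB.instance Definition _ := GRing.Zmodule.copy (res_mod f U) U.

Definition res_scale (b : B) (u : res_mod f U) : res_mod f U := f b *: (u : U).

Fact res_scaleA a b u : res_scale a (res_scale b u) = res_scale (a * b) u.
Proof. by rewrite /res_scale scalerA rmorphM. Qed.
Fact res_scale1 : left_id 1 res_scale.
Proof. by move=> u; rewrite /res_scale rmorph1 scale1r. Qed.
Fact res_scaleDr : right_distributive res_scale +%R.
Proof. by move=> a u v; exact: scalerDr. Qed.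
Fact res_scaleDl u : {morph res_scale^~ u : a b / a + b}.
Proof. by move=> a b; rewrite /res_scale rmorphD scalerDl. Qed.

HB.instance Definition _ := GRing.Zmodule_isLmodule.Build B (res_mod f U)
  res_scaleA res_scale1 res_scaleDr res_scaleDl.

Fact res_submod_subproof (N : submodClosed U) :
  is_submod (fun u : res_mod f U => (u : U) \in N).
Proof.
split=> [|a u v Nu Nv]; first exact: rpred0.
by apply: rpredD => //; exact: rpredZ.
Qed.

Definition res_submod (N : submodClosed U) : submodClosed (res_mod f U) :=
  Submod (res_submod_subproof N).

End Restriction.

(* Extension of scalars along [f], written [A (x)_B M]: the additive group generated by symbols
   [a (x) m], subject to biadditivity and [a f(b) (x) m = a (x) b m]. *)
Variable M : lmodType B.

Inductive tterm : Type :=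
| Tens of A & M
| TZero
| TAdd of tterm & tterm
| TOpp of tterm.

Inductive tcong : tterm -> tterm -> Prop :=
| tcong_refl s : tcong s s
| tcong_sym s t : tcong s t -> tcong t s
| tcong_trans t s u : tcong s t -> tcong t u -> tcong s u
| tcong_add s s' t t' : tcong s s' -> tcong t t' -> tcong (TAdd s t) (TAdd s' t')
| tcong_opp s s' : tcong s s' -> tcong (TOpp s) (TOpp s')
| tcong_addA s t u : tcong (TAdd s (TAdd t u)) (TAdd (TAdd s t) u)
| tcong_addC s t : tcong (TAdd s t) (TAdd t s)
| tcong_add0 s : tcong (TAdd TZero s) s
| tcong_addN s : tcong (TAdd (TOpp s) s) TZero
| tcong_Dl a a' m : tcong (Tens (a + a') m) (TAdd (Tens a m) (Tens a' m))
| tcong_Dr a m m' : tcong (Tens a (m + m')) (TAdd (Tens a m) (Tens a m'))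
| tcong_bal a b m : tcong (Tens (a * f b) m) (Tens a (b *: m)).

HB.instance Definition _ := gen_eqMixin tterm.
HB.instance Definition _ := gen_choiceMixin tterm.

Definition tcongb (s t : tterm) : bool := `[< tcong s t >].

Lemma tcongb_equiv : equiv_class_of tcongb.
Proof.
split=> [s|s t|t s u]; first exact/asboolP/tcong_refl.
  by apply/asboolP/asboolP => /tcong_sym.
by move=> /asboolP st /asboolP tu; apply/asboolP/(tcong_trans st tu).
Qed.

Canonical tcongb_equiv_rel := EquivRelPack tcongb_equiv.

Definition ext_mod : Type := {eq_quot tcongb}.
HB.instance Definition _ := Choice.on ext_mod.
HB.instance Definition _ := EqQuotient.on ext_mod.

Definition tcls (s : tterm) : ext_mod := \pi_ext_mod s.

Lemma tclsP s t : tcls s = tcls t <-> tcong s t.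
Proof.
split=> [|st]; first by move=> /eqmodP /asboolP.
by apply/eqmodP/asboolP.
Qed.

Lemma extW (P : ext_mod -> Prop) : (forall s, P (tcls s)) -> forall x, P x.
Proof. by move=> h; elim/quotW. Qed.

Lemma repr_tcong s : tcong (qrepr (tcls s)) s.
Proof. by apply/tclsP; rewrite /tcls reprK. Qed.

Fixpoint tscale (a : A) (s : tterm) : tterm :=
  match s with
  | Tens a' m => Tens (a * a') m
  | TZero => TZero
  | TAdd s t => TAdd (tscale a s) (tscale a t)
  | TOpp s => TOpp (tscale a s)
  end.

Lemma tscale_cong a s t : tcong s t -> tcong (tscale a s) (tscale a t).
Proof.
elim=> /=; eauto using tcong.
- by move=> *; rewrite mulrDr; exact: tcong_Dl.
- by move=> *; rewrite mulrA; exact: tcong_bal.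
Qed.

Definition eadd (x y : ext_mod) := tcls (TAdd (qrepr x) (qrepr y)).
Definition eopp (x : ext_mod) := tcls (TOpp (qrepr x)).
Definition escale (a : A) (x : ext_mod) := tcls (tscale a (qrepr x)).

Lemma eaddE s t : eadd (tcls s) (tcls t) = tcls (TAdd s t).
Proof. by apply/tclsP/tcong_add; exact: repr_tcong. Qed.
Lemma eoppE s : eopp (tcls s) = tcls (TOpp s).
Proof. by apply/tclsP/tcong_opp; exact: repr_tcong. Qed.
Lemma escaleE a s : escale a (tcls s) = tcls (tscale a s).
Proof. by apply/tclsP/tscale_cong; exact: repr_tcong. Qed.

Let eE := (eaddE, eoppE, escaleE).

Fact eaddA : associative eadd.
Proof. by do 3!elim/extW=> ?; rewrite !eE; apply/tclsP/tcong_addA. Qed.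
Fact eaddC : commutative eadd.
Proof. by do 2!elim/extW=> ?; rewrite !eE; apply/tclsP/tcong_addC. Qed.
Fact eadd0 : left_id (tcls TZero) eadd.
Proof. by elim/extW=> ?; rewrite !eE; apply/tclsP/tcong_add0. Qed.
Fact eaddN : left_inverse (tcls TZero) eopp eadd.
Proof. by elim/extW=> ?; rewrite !eE; apply/tclsP/tcong_addN. Qed.

HB.instance Definition _ := GRing.isZmodule.Build ext_mod eaddA eaddC eadd0 eaddN.

Lemma tclsD s t : tcls (TAdd s t) = tcls s + tcls t.
Proof. by rewrite [RHS]eaddE. Qed.
Lemma tclsN s : tcls (TOpp s) = - tcls s.
Proof. by rewrite [RHS]eoppE. Qed.

Fact escaleA a b x : escale a (escale b x) = escale (a * b) x.
Proof.
elim/extW: x => s; rewrite !eE; elim: s => [c m||s IHs t IHt|s IHs] //=.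
- by rewrite mulrA.
- by rewrite !tclsD IHs IHt.
- by rewrite !tclsN IHs.
Qed.
Fact escale1 : left_id 1 escale.
Proof.
elim/extW=> s; rewrite !eE; elim: s => [c m||s IHs t IHt|s IHs] //=.
- by rewrite mul1r.
- by rewrite !tclsD IHs IHt.
- by rewrite !tclsN IHs.
Qed.
Fact escaleDr : right_distributive escale +%R.
Proof.
by move=> a; elim/extW=> s; elim/extW=> t; rewrite -tclsD !escaleE /= tclsD.
Qed.
Fact escaleDl x : {morph escale^~ x : a b / a + b}.
Proof.
elim/extW: x => s a b; rewrite !eE; elim: s => [c m||s IHs t IHt|s IHs] //=.
- by rewrite mulrDl -tclsD; apply/tclsP/tcong_Dl.
- by rewrite -[LHS]add0r.
- by rewrite !tclsD IHs IHt addrACA.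
- by rewrite !tclsN IHs opprD.
Qed.

HB.instance Definition _ := GRing.Zmodule_isLmodule.Build A ext_mod
  escaleA escale1 escaleDr escaleDl.

Definition tens (a : A) (m : M) : ext_mod := tcls (Tens a m).

End ChangeOfRings.

(* MathComp composes permutations from left to right. *)
Definition compS (g h : 'S_3) : 'S_3 := (h * g)%g.
Notation "g ∘ h" := (compS g h) (at level 40, left associativity).

(* The points 1, 2, 3 are the ordinals 0, 1, 2: sigma3 = (12), tau3 = (123). *)
Definition pt1 : 'I_3 := Ordinal (isT : 0 < 3)%N.
Definition pt2 : 'I_3 := Ordinal (isT : 1 < 3)%N.
Definition pt3 : 'I_3 := Ordinal (isT : 2 < 3)%N.
Definition sigma3 : 'S_3 := tperm pt1 pt2.
Definition tau3 : 'S_3 := tperm pt1 pt2 ∘ tperm pt2 pt3.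

Lemma tau3E : [/\ tau3 pt1 = pt2, tau3 pt2 = pt3 & tau3 pt3 = pt1].
Proof. by rewrite /tau3 /compS !permM !permE; split; apply/val_inj. Qed.

Definition conjS (g h : 'S_3) : 'S_3 := g ∘ h ∘ g^-1%g.

Lemma conjSE g h : conjS g h = (h ^ g)%g.
Proof. by []. Qed.

Definition conj_class (r : 'S_3) : Type := {h : 'S_3 | h \in (r ^: [set: 'S_3])%g}.
HB.instance Definition _ r := SubFinite.on (conj_class r).

Section ConjugacyClass.
Variable r : 'S_3.

Fact class_conj_subproof (g : 'S_3) (h : conj_class r) :
  conjS g (val h) \in (r ^: [set: 'S_3])%g.
Proof.
rewrite conjSE; have /imsetP[z _ ->] := valP h.
by rewrite -conjgM; apply/imset_f; rewrite inE.
Qed.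

Definition class_conj (g : 'S_3) (h : conj_class r) : conj_class r :=
  Sub (conjS g (val h)) (class_conj_subproof g h).

Definition class_base : conj_class r := Sub r (class_refl [set: 'S_3]%G r).

End ConjugacyClass.

Definition transp : Type := conj_class sigma3.
HB.instance Definition _ := SubFinite.on transp.

(* Meaningful for distinct i and j only, when it is the transposition (ij). *)
Definition transp_of (i j : 'I_3) : transp := insubd (class_base sigma3) (tperm i j).

Lemma transp_ofE i j : i != j -> val (transp_of i j) = tperm i j.
Proof.
move=> ij; rewrite val_insubd ifT //.
have p12 : pt1 != pt2 by [].
have [s [s1 s2]] : exists s : 'S_3, s pt1 = i /\ s pt2 = j.
  have ne : tperm pt1 i pt2 != i.
    by rewrite -{2}(tpermL pt1 i) (inj_eq perm_inj).
  exists (tperm pt1 i * tperm (tperm pt1 i pt2) j)%g.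
  rewrite !permM tpermL (tpermL (tperm pt1 i pt2)); split=> //.
  by apply: tpermD => //; rewrite eq_sym.
by rewrite -s1 -s2 -tpermJ; apply/imset_f; rewrite inE.
Qed.

Section Double.
Variable k : fieldType.

Definition sgn (g : 'S_3) : k := (-1) ^+ odd_perm g.

Inductive S3gen : Type := S3_g of 'S_3 | S3_d of 'S_3.

Section S3Relations.
Local Notation G g := (Gen (S3_g g)).
Local Notation D h := (Gen (S3_d h)).

Inductive S3rel : pterm k S3gen -> pterm k S3gen -> Prop :=
| S3rel_mul g h : S3rel (G g * G h) (G (g ∘ h))
| S3rel_one : S3rel (G 1%g) (Cst 1)
| S3rel_orth g h : S3rel (D g * D h) (if g == h then D g else Cst 0)
| S3rel_sum : S3rel (\big[@Add k S3gen/Cst 0]_(h : 'S_3) D h) (Cst 1)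
| S3rel_comm g h : S3rel (D h * G g) (G g * D (g^-1%g ∘ h ∘ g)).

End S3Relations.

Definition DS3 : Type := presented S3rel.
HB.instance Definition _ := GRing.PzRing.on DS3.
HB.instance Definition _ := GRing.Lmodule.on DS3.

(* [DS3] and [Dge0] are presented by the relations of [DD] that involve only
   their own generators.  By the triangular decomposition of [DD] into the
   Nichols algebra, [DS3] and the dual Nichols algebra, the morphisms [S3_to_D]
   and [ge0_to_D] below identify them with the subalgebras of [DD] generated by
   the g, delta_g and by the g, delta_g, y_t respectively. *)

Inductive ge0gen : Type := ge0_S3 of S3gen | ge0_y of transp.

Section Ge0Relations.
Local Notation G g := (Gen (ge0_S3 (S3_g g))).
Local Notation D h := (Gen (ge0_S3 (S3_d h))).
Local Notation y t := (Gen (ge0_y t)).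

Inductive ge0rel : pterm k ge0gen -> pterm k ge0gen -> Prop :=
| ge0rel_S3 a b : S3rel a b -> ge0rel (tmap ge0_S3 a) (tmap ge0_S3 b)
| ge0rel_sqr t : ge0rel (y t * y t) (Cst 0)
| ge0rel_quad i j l : uniq [:: i; j; l] ->
    ge0rel (y (transp_of i j) * y (transp_of i l)
              + y (transp_of j l) * y (transp_of i j)
              + y (transp_of i l) * y (transp_of j l)) (Cst 0)
| ge0rel_d g t : ge0rel (D g * y t) (y t * D (val t ∘ g))
| ge0rel_g g t :
    ge0rel (y t * G g) (Cst (sgn g) * (G g * y (class_conj g^-1%g t))).

End Ge0Relations.

Definition Dge0 : Type := presented ge0rel.
HB.instance Definition _ := GRing.PzRing.on Dge0.
HB.instance Definition _ := GRing.Lmodule.on Dge0.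

Inductive Dgen : Type := D_ge0 of ge0gen | D_x of transp.

Section DRelations.
Local Notation G g := (Gen (D_ge0 (ge0_S3 (S3_g g)))).
Local Notation D h := (Gen (D_ge0 (ge0_S3 (S3_d h)))).
Local Notation y t := (Gen (D_ge0 (ge0_y t))).
Local Notation x t := (Gen (D_x t)).

Inductive Drel : pterm k Dgen -> pterm k Dgen -> Prop :=
| Drel_ge0 a b : ge0rel a b -> Drel (tmap D_ge0 a) (tmap D_ge0 b)
| Drel_sqr t : Drel (x t * x t) (Cst 0)
| Drel_quad i j l : uniq [:: i; j; l] ->
    Drel (x (transp_of i j) * x (transp_of i l)
            + x (transp_of j l) * x (transp_of i j)
            + x (transp_of i l) * x (transp_of j l)) (Cst 0)
| Drel_g g t : Drel (G g * x t) (Cst (sgn g) * (x (class_conj g t) * G g))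
| Drel_d h t : Drel (D h * x t) (x t * D (val t ∘ h))
| Drel_yx t :
    Drel (y t * x t + x t * y t)
         (Cst 1 + G (val t) * (D (val t) - D 1%g))
| Drel_yx' i j l : uniq [:: i; j; l] ->
    Drel (y (transp_of i l) * x (transp_of i j)
            + x (transp_of i j) * y (transp_of j l))
         (G (val (transp_of i j))
            * (D (val (transp_of i l))
                 - D (val (transp_of i l) ∘ val (transp_of i j)))).

End DRelations.

Definition DD : Type := presented Drel.
HB.instance Definition _ := GRing.PzRing.on DD.
HB.instance Definition _ := GRing.Lmodule.on DD.

Definition xD (t : transp) : DD := pgen Drel (D_x t).
Definition yD (t : transp) : DD := pgen Drel (D_ge0 (ge0_y t)).

Definition S3_to_ge0 : {rmorphism DS3 -> Dge0} := plift (pmapP ge0rel_S3).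
Definition ge0_to_D : {rmorphism Dge0 -> DD} := plift (pmapP Drel_ge0).
Definition S3_to_D : {rmorphism DS3 -> DD} := ge0_to_D \o S3_to_ge0.

(* The projection of [D>=0] onto the double of the group algebra that kills
   the [y]'s; modules pulled back along it are those on which the [y]'s act
   by zero. *)
Definition ge0_proj_gen (i : ge0gen) : DS3 :=
  match i with ge0_S3 j => pgen S3rel j | ge0_y _ => 0 end.

Fact ge0_proj_subproof a b :
  ge0rel a b -> teval ge0_proj_gen a = teval ge0_proj_gen b.
Proof.
case=> /=.
- move=> {}a {}b ab.
  have E c : teval ge0_proj_gen (tmap ge0_S3 c) = pcls S3rel c.
    elim: c => [c|i|c IHc d IHd|c IHc|c IHc d IHd] //=.
    + by rewrite pcls_cst.
    + by rewrite IHc IHd pclsD.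
    + by rewrite IHc pclsN.
    + by rewrite IHc IHd pclsM.
  by rewrite !E; apply/pclsP/cong_rel.
- by move=> t; rewrite mul0r scale0r.
- by move=> *; rewrite !mul0r !addr0 scale0r.
- by move=> *; rewrite mulr0 mul0r.
- by move=> *; rewrite mul0r !mulr0.
Qed.

Definition ge0_to_S3 : {rmorphism Dge0 -> DS3} := plift ge0_proj_subproof.

Lemma tact_sum (I : Type) (U : lmodType k) (op : I -> U -> U) (T : Type)
    (s : seq T) (F : T -> pterm k I) u :
  tact op (\big[@Add k I/Cst 0]_(i <- s) F i) u = \sum_(i <- s) tact op (F i) u.
Proof.
by elim: s => [|i s IH]; rewrite ?big_nil ?big_cons /= ?scale0r ?IH.
Qed.

Section ClassModule.
Variables (r : 'S_3) (eps : bool).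

Definition class_op (i : S3gen) (u : {ffun conj_class r -> k^o}) :
    {ffun conj_class r -> k^o} :=
  match i with
  | S3_g g => [ffun h => (if eps then sgn g else 1) * u (class_conj g^-1%g h)]
  | S3_d d => [ffun h => if val h == d then u h else 0]
  end.

Fact class_op_lin i : linear (class_op i).
Proof.
case: i => g a u v; apply/ffunP=> h; rewrite !ffunE.
  by rewrite mulrDr mulrCA.
by case: ifP => _ //; rewrite scaler0 addr0.
Qed.

Fact class_op_rel a b : S3rel a b -> tact class_op a =1 tact class_op b.
Proof.
case=> /=.
- move=> g h u; apply/ffunP=> z; rewrite !ffunE mulrA; congr (_ * u _).
    case: eps; rewrite ?mulr1 // /sgn /compS odd_permM signr_addb mulrC //.
  by apply/val_inj; rewrite /= !conjSE -conjgM /compS invMg.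
- move=> u; apply/ffunP=> z; rewrite !ffunE scale1r.
  have -> : class_conj 1^-1 z = z by apply/val_inj; rewrite /= conjSE invg1 conjg1.
  by case: eps; rewrite /sgn ?odd_perm1 ?expr0 mul1r.
- move=> g h u; apply/ffunP=> z; rewrite !ffunE.
  case: (eqVneq g h) => [<-|gh] /=; rewrite !ffunE.
    by case: (_ == g).
  by rewrite scale0r; case: eqP => // ->; rewrite (negPf gh).
- move=> u; rewrite tact_sum; apply/ffunP=> z; rewrite sum_ffunE /= scale1r.
  rewrite (bigD1 (val z)) //= big1 => [|h hz]; rewrite ffunE ?eqxx ?addr0 //.
  by rewrite eq_sym (negPf hz).
- move=> g h u; apply/ffunP=> z; rewrite !ffunE /=.
  have -> : (conjS g^-1 (val z) == g^-1%g ∘ h ∘ g) = (val z == h).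
    have -> : g^-1%g ∘ h ∘ g = (h ^ g^-1)%g by rewrite -conjSE /conjS invgK.
    by rewrite conjSE (inj_eq (conjg_inj _)).
  by case: ifP; rewrite ?mulr0.
Qed.

Definition class_rep : rep S3rel := Rep class_op_lin class_op_rel.

(* Basis [|h>], for [h] in the conjugacy class of [r]; [|h>] has degree [h] and
   [g|h>] is [|ghg^-1>], multiplied by [sgn g] if [eps] is [true]. *)
Definition class_mod : Type := rep_mod class_rep.
HB.instance Definition _ := GRing.Lmodule.on class_mod.

Definition ket (h : conj_class r) : class_mod := [ffun j => (j == h)%:R : k^o].

End ClassModule.

Definition M_sigma_p : lmodType DS3 := class_mod sigma3 false.
Definition M_sigma_m : lmodType DS3 := class_mod sigma3 true.
Definition M_tau_0 : lmodType DS3 := class_mod tau3 false.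

(* The natural permutation module in degree [e]. *)
Definition nat_op (i : S3gen) (u : {ffun 'I_3 -> k^o}) : {ffun 'I_3 -> k^o} :=
  match i with
  | S3_g g => [ffun j => u (g^-1%g j)]
  | S3_d d => if d == 1%g then u else 0
  end.

Fact nat_op_lin i : linear (nat_op i).
Proof.
case: i => g a u v /=; first by apply/ffunP=> h; rewrite !ffunE.
by case: ifP => _ //; rewrite scaler0 addr0.
Qed.

Fact nat_op_rel a b : S3rel a b -> tact nat_op a =1 tact nat_op b.
Proof.
case=> /=.
- by move=> g h u; apply/ffunP=> z; rewrite !ffunE /compS invMg permM.
- by move=> u; apply/ffunP=> z; rewrite !ffunE scale1r invg1 perm1.
- move=> g h u; case: (eqVneq g h) => [<-|gh] /=.
    by case: (g == _).
  rewrite scale0r; case: eqP => // g1; case: eqP => // h1.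
  by rewrite g1 h1 eqxx in gh.
- move=> u; rewrite tact_sum scale1r (bigD1 1%g) //= big1 ?addr0 ?eqxx //.
  by move=> h /negPf ->.
- move=> g h u; have -> : (g^-1%g ∘ h ∘ g == 1%g) = (h == 1%g).
    have -> : g^-1%g ∘ h ∘ g = (h ^ g^-1)%g by rewrite -conjSE /conjS invgK.
    by rewrite conjg_eq1.
  by case: ifP => // _; apply/ffunP=> z; rewrite !ffunE.
Qed.

Definition nat_rep : rep S3rel := Rep nat_op_lin nat_op_rel.

Fact rho_subproof : is_submod (fun u : rep_mod nat_rep =>
  \sum_j (u : {ffun 'I_3 -> k^o}) j = 0).
Proof.
split; first by rewrite big1 // => j _; rewrite ffunE.
elim/presW=> a u v u0 v0; rewrite [_ *: u]rep_scaleE.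
under eq_bigr => j _ do rewrite ffunE.
rewrite big_split /= v0 addr0.
elim: a u u0 {v v0} => [c|[g|d]|a IHa b IHb|a IHa|a IHa b IHb] u u0 /=.
- by under eq_bigr => j _ do rewrite ffunE; rewrite -scaler_sumr u0 scaler0.
- under eq_bigr => j _ do rewrite ffunE.
  by rewrite (reindex_inj (@perm_inj _ g^-1%g)) in u0.
- by case: ifP => // _; rewrite big1 // => j _; rewrite ffunE.
- by under eq_bigr => j _ do rewrite ffunE; rewrite big_split /= IHa // IHb // addr0.
- by under eq_bigr => j _ do rewrite ffunE; rewrite sumrN IHa // oppr0.
- exact/IHa/IHb.
Qed.

(* The 2-dimensional irreducible representation of S3, in degree [e]: the
   vectors of coordinate sum zero in the natural permutation module. *)
Definition M_e_rho : lmodType DS3 := sub_mod (Submod rho_subproof).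

Definition Verma (M : lmodType DS3) : lmodType DD :=
  ext_mod ge0_to_D (res_mod ge0_to_S3 M).

Definition vket (r : 'S_3) (eps : bool) (h : conj_class r) :
    Verma (class_mod r eps) :=
  tens ge0_to_D 1 (ket eps h : res_mod ge0_to_S3 (class_mod r eps)).

(* A Verma module has a single maximal submodule, which is then its radical. *)
Definition L_simple (M : lmodType DS3) : lmodType DD := head_mod (Verma M).

Definition highest_weight (W : lmodType DD) (M : lmodType DS3) : Prop :=
  exists N : submodClosed (res_mod S3_to_D W),
    [/\ iso_mod (sub_mod N) M,
        forall t (w : W), (w : res_mod S3_to_D W) \in N -> yD t *: w = 0
      & forall w : W, w \in gen_submod (fun u : W => (u : res_mod S3_to_D W) \in N)].

Local Notation Msm := (Verma M_sigma_m).
Local Notation Msm' := (res_mod S3_to_D Msm).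

Definition S3_span (u : Msm) : submodClosed Msm' :=
  gen_submod (fun w : Msm' => w = u).

Local Notation t12 := (transp_of pt1 pt2).
Local Notation t23 := (transp_of pt2 pt3).
Local Notation t13 := (transp_of pt1 pt3).
Local Notation "| t >" := (vket true t) (at level 0, t at level 50).

Variable zeta : k.

Definition vec_v : Msm :=
  (zeta^-1 *: xD t23) *: |t23> + (zeta *: xD t13) *: |t13> + xD t12 *: |t12>.

Definition vec_q : Msm :=
  (xD t12 * xD t23) *: |t23> - (xD t12 * xD t13) *: |t13>.

Definition vec_n0 : Msm :=
  (xD t13 * xD t12 * xD t23) *: |t23> + (xD t12 * xD t13 * xD t23) *: |t12>
    - (xD t12 * xD t13 * xD t12) *: |t13>.

Definition direct4 (R : pzRingType) (U : lmodType R)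
    (N1 N2 N3 N4 : submodClosed U) : Prop :=
  forall u1 u2 u3 u4, u1 \in N1 -> u2 \in N2 -> u3 \in N3 -> u4 \in N4 ->
  u1 + u2 + u3 + u4 = 0 -> [/\ u1 = 0, u2 = 0, u3 = 0 & u4 = 0].

Definition VQN_direct : Prop :=
  direct4 (res_submod S3_to_D (socle_mod Msm))
    (S3_span vec_v) (S3_span vec_q) (S3_span vec_n0).

Definition VQN : submodClosed Msm' :=
  add_submod (add_submod (add_submod
    (res_submod S3_to_D (socle_mod Msm)) (S3_span vec_v))
    (S3_span vec_q)) (S3_span vec_n0).

End Double.

(* Main.v *)
Require Import Defs.
From HB Require Import structures.
From mathcomp Require Import all_boot all_order all_fingroup all_algebra.
From mathcomp Require Import boolp ring.

(* Integral tables define D-modules of dimensions 36 and 7; the defining relations of D are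
   checked on basis vectors by computation. The Verma module of weight (sigma, -) maps to the
   36-dimensional one, and the map is bijective because the twelve basis words of the Nichols
   algebra, applied to the |t>, span the Verma module and go to a basis.

   A nonzero submodule of this Verma module contains, after multiplication by enough x's, a
   nonzero vector of top degree, hence all of the top degree. So the submodule generated by
   the top degree is the unique simple submodule, that is, the socle. Functionals dual to
   explicit bases of the socle, V, Q and N_0 then identify VQN / S with the 7-dimensional
   module L7. The latter is simple: a vector whose components outside degree e vanish is
   either 0 or moved out of degree e by some x_t, and every homogeneous line in the other
   degrees generates L7.

   The simple module L(e, rho) is identified with L7 as follows. Words of length 5 in the x's
   vanish, so (Nakayama) a submodule of the Verma module of M(e, rho) that generates it modulo
   the image of the x's is everything. As the x's do not reach the highest-weight space of L7,
   a maximal submodule not containing the kernel of the map onto L7 would have this property;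
   hence that kernel is the only maximal submodule. *)

Set Implicit Arguments.
Unset Strict Implicit.
Unset Printing Implicit Defensive.
Import GRing.Theory.
Local Open Scope ring_scope.

(** The presentation of D yields upper bounds only: relations show that certain words span, never
    that they are independent. Independence therefore comes from modules written down in advance,
    and no basis of D itself is needed. Verifying such a module is a finite computation because
    nothing in the tables depends on the field: all structure constants are integers, so the checks
    run over the integers and are transported to [k]. The only divisions forced by the tables are by
    2, 3 or 6, and this is where characteristic zero enters. The root zeta occurs in v alone. The
    space V has an integral basis, being the set of all sums of a_t x_t|t> whose coefficients a_t
    add up to 0; zeta matters only for the fact that v generates all of it. Having L7 as a common
    model for VQN / S and for L(e, rho) also means that the Verma module of M(e, rho) is never
    expanded in a basis. *)

(** * Integral combinations of basis vectors *)

(* The list of the [(c, i)] stands for the linear combination of the basis vectors [i] with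
   coefficients [c]. *)
Definition fv := seq (int * nat).

Definition coef (v : fv) (i : nat) : int :=
  foldr (fun p c => if p.2 == i then p.1 + c else c) 0 v.

Definition fscale (c : int) (v : fv) : fv := [seq (c * p.1, p.2) | p <- v].

Definition fapp (A : nat -> fv) (v : fv) : fv :=
  flatten [seq fscale p.1 (A p.2) | p <- v].

Definition feq (n : nat) (v w : fv) : bool :=
  all (fun i => coef v i == coef w i) (iota 0 n).

Definition fnorm (n : nat) (v : fv) : fv :=
  [seq (coef v i, i) | i <- iota 0 n & coef v i != 0].

Definition dot (d v : fv) : int := foldr (fun p c => p.1 * coef v p.2 + c) 0 d.

Section Eval.
Variables (U : zmodType) (E : nat -> U).

(** Integral coefficients need only an additive group, so the same lists can be evaluated in both
    table modules and on words in operators. *)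
Definition ev (v : fv) : U := \sum_(p <- v) E p.2 *~ p.1.

Lemma ev_nil : ev [::] = 0. Proof. by rewrite /ev big_nil. Qed.

Lemma ev_cons p v : ev (p :: v) = E p.2 *~ p.1 + ev v.
Proof. by rewrite /ev big_cons. Qed.

Lemma ev1 i : ev [:: (1, i)] = E i.
Proof. by rewrite ev_cons ev_nil addr0. Qed.

Lemma ev_cat v w : ev (v ++ w) = ev v + ev w.
Proof. by rewrite /ev big_cat. Qed.

Lemma ev_scale c v : ev (fscale c v) = ev v *~ c.
Proof.
elim: v => [|p v IH]; first by rewrite ev_nil mul0rz.
by rewrite !ev_cons IH mulrzDl mulrC mulrzA.
Qed.

Lemma ev_app (V : zmodType) (T : {additive V -> U}) (E' : nat -> V) (A : nat -> fv) v :
  (forall i, T (E' i) = ev (A i)) ->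
  T (\sum_(p <- v) E' p.2 *~ p.1) = ev (fapp A v).
Proof.
move=> TA; elim: v => [|p v IH]; first by rewrite big_nil raddf0 ev_nil.
by rewrite big_cons /fapp /= ev_cat ev_scale -TA raddfD raddfMz IH.
Qed.

Variable n : nat.
Hypothesis E0 : forall i, (n <= i)%N -> E i = 0.

Lemma ev_coef v : ev v = \sum_(i < n) E i *~ coef v i.
Proof.
elim: v => [|[c j] v IH]; first by rewrite ev_nil big1 // => i _; rewrite mulr0z.
rewrite ev_cons IH /=; case: (ltnP j n) => [jn|nj].
  rewrite (bigD1 (Ordinal jn)) //= [RHS](bigD1 (Ordinal jn)) //= eqxx mulrzDr addrA.
  by congr (_ + _); apply: eq_bigr => i; rewrite -val_eqE eq_sym /= => /negPf ->.
rewrite E0 // mul0rz add0r; apply: eq_bigr => i _.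
by rewrite gtn_eqF // (leq_trans (ltn_ord i)).
Qed.

(** The test may ignore the indices from [n] on, since [E] vanishes there. *)
Lemma feqP v w : feq n v w -> ev v = ev w.
Proof.
move=> /allP vw; rewrite !ev_coef; apply: eq_bigr => i _.
by rewrite (eqP (vw i _)) // mem_iota ltn_ord.
Qed.

End Eval.

(* A permutation is coded by the list of its values, a transposition also by the point it
   fixes. *)
Definition S3c : seq (seq nat) :=
  [:: [:: 0; 1; 2]; [:: 0; 2; 1]; [:: 1; 0; 2]; [:: 1; 2; 0]; [:: 2; 0; 1]; [:: 2; 1; 0]]%N.
Definition ccomp (c d : seq nat) := [seq nth 0%N c i | i <- d].
Definition cinv (c : seq nat) := [seq index i c | i <- iota 0 3].
Definition cconj (c d : seq nat) := ccomp (ccomp c d) (cinv c).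
Definition ctr (t : nat) := nth [::] [:: [:: 0; 2; 1]; [:: 2; 1; 0]; [:: 1; 0; 2]]%N t.
Definition cfix (c : seq nat) := find (fun i => nth 0%N c i == i) (iota 0 3).
Definition codd (c : seq nat) : bool := c \in [seq ctr t | t <- iota 0 3].
Definition csgn (c : seq nat) : int := if codd c then -1 else 1.

Definition code (g : 'S_3) : seq nat := [seq val (g i) | i <- [:: pt1; pt2; pt3]].

Lemma I3P (P : 'I_3 -> Prop) : P pt1 -> P pt2 -> P pt3 -> forall i, P i.
Proof.
move=> P1 P2 P3; case=> [[|[|[|m]]] lt_m] //.
- by rewrite (_ : Ordinal _ = pt1) //; apply/val_inj.
- by rewrite (_ : Ordinal _ = pt2) //; apply/val_inj.
- by rewrite (_ : Ordinal _ = pt3) //; apply/val_inj.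
Qed.

Lemma nth_code g (i : 'I_3) : nth 0%N (code g) i = g i.
Proof. by elim/I3P: i. Qed.

Lemma code_inj : injective code.
Proof.
move=> g h gh; apply/permP=> i; apply/val_inj.
by rewrite /= -!nth_code gh.
Qed.

Lemma code_in g : code g \in S3c.
Proof.
have: uniq (code g) by rewrite map_inj_uniq // => i j /val_inj /perm_inj.
rewrite /code /=; move: (g pt1) (g pt2) (g pt3).
by do 3!elim/I3P.
Qed.

Lemma code_comp g h : code (g ∘ h) = ccomp (code g) (code h).
Proof. by rewrite /ccomp {3}/code -map_comp; apply: eq_map => i /=; rewrite nth_code permM. Qed.

Lemma code1 : code 1 = [:: 0; 1; 2]%N.
Proof. by rewrite /code /= !perm1. Qed.

Lemma code_inv g : code g^-1 = cinv (code g).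
Proof.
have: ccomp (code g) (code g^-1) = [:: 0; 1; 2]%N by rewrite -code_comp /compS mulVg code1.
move: (code g^-1) (code_in g^-1) (code g) (code_in g) => d dS c cS.
have /allP/(_ c cS)/allP/(_ d dS)/implyP H : all (fun c => all (fun d =>
  (ccomp c d == [:: 0; 1; 2]%N) ==> (d == cinv c)) S3c) S3c by [].
by move/eqP/H/eqP.
Qed.

Lemma code_conj g h : code (conjS g h) = cconj (code g) (code h).
Proof. by rewrite /conjS !code_comp code_inv. Qed.

Lemma code_tperm : [/\ code (tperm pt2 pt3) = ctr 0, code (tperm pt1 pt3) = ctr 1
  & code (tperm pt1 pt2) = ctr 2].
Proof. by split; rewrite /code /= !permE. Qed.

Lemma codd_odd g : odd_perm g = codd (code g).
Proof.
have [c0 c1 c2] := code_tperm.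
have E (h : 'S_3) : code h = code g -> odd_perm h = codd (code h) -> odd_perm g = codd (code g).
  by move/code_inj ->.
have := code_in g; rewrite !inE => /or4P[/eqP gc|/eqP gc|/eqP gc|].
- by apply: (E 1%g); rewrite ?code1 ?odd_perm1.
- by apply: (E (tperm pt2 pt3)); rewrite ?odd_tperm c0.
- by apply: (E (tperm pt1 pt2)); rewrite ?odd_tperm c2.
case/or3P=> /eqP gc.
- by apply: (E (tperm pt1 pt2 ∘ tperm pt2 pt3)); rewrite code_comp c2 c0 ?odd_permM ?odd_tperm.
- by apply: (E (tperm pt2 pt3 ∘ tperm pt1 pt2)); rewrite code_comp c2 c0 ?odd_permM ?odd_tperm.
- by apply: (E (tperm pt1 pt3)); rewrite ?odd_tperm c1.
Qed.

Lemma sgnE (k : fieldType) g : sgn k g = (csgn (code g))%:~R.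
Proof. by rewrite /sgn codd_odd /csgn; case: codd. Qed.

Definition tfix (t : transp) : nat := cfix (code (val t)).

Lemma transp_code (t : transp) : code (val t) \in [seq ctr i | i <- iota 0 3].
Proof.
have /imsetP[z _ ->] := valP t; rewrite -conjSE code_conj.
have [_ _ ->] := code_tperm.
by have /allP/(_ _ (code_in z)) : all (fun c => cconj c (ctr 2) \in [seq ctr i | i <- iota 0 3]) S3c.
Qed.

Lemma tfix_lt t : (tfix t < 3)%N.
Proof.
by have /allP/(_ _ (transp_code t)) : all (fun c => cfix c < 3)%N [seq ctr i | i <- iota 0 3].
Qed.

Lemma code_val t : code (val t) = ctr (tfix t).
Proof.
by have /allP/(_ _ (transp_code t))/eqP :
  all (fun c => c == ctr (cfix c))%N [seq ctr i | i <- iota 0 3].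
Qed.

Lemma tfix_inj : injective tfix.
Proof. by move=> s t st; apply/val_inj/code_inj; rewrite !code_val st. Qed.

Lemma tfix_conj g t : tfix (class_conj g t) = nth 0%N (code g) (tfix t).
Proof.
rewrite /tfix /= code_conj; have := transp_code t.
have /allP/(_ _ (code_in g))/allP H : all (fun c => all (fun d =>
  cfix (cconj c d) == nth 0%N c (cfix d)) [seq ctr i | i <- iota 0 3]) S3c by [].
by move=> /H/eqP.
Qed.

Lemma tfix_of i j l : uniq [:: i; j; l] -> tfix (transp_of i j) = l.
Proof.
move=> u; have ij : i != j by move: u; rewrite /= inE negb_or => /andP[/andP[]].
rewrite /tfix transp_ofE //; move: u {ij}; have [c0 c1 c2] := code_tperm.
by elim/I3P: i; elim/I3P: j; elim/I3P: l; rewrite //= ?[tperm pt2 pt1]tpermC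
  ?[tperm pt3 pt1]tpermC ?[tperm pt3 pt2]tpermC ?c0 ?c1 ?c2.
Qed.

Lemma code_surj c : c \in S3c -> exists g, code g = c.
Proof.
move=> cS; have [c0 c1 c2] := code_tperm.
have := cS; rewrite !inE => /or4P[/eqP->|/eqP->|/eqP->|/or3P[]/eqP->].
- by exists 1%g; exact: code1.
- by exists (tperm pt2 pt3).
- by exists (tperm pt1 pt2).
- by exists (tperm pt1 pt2 ∘ tperm pt2 pt3); rewrite code_comp c2 c0.
- by exists (tperm pt2 pt3 ∘ tperm pt1 pt2); rewrite code_comp c2 c0.
- by exists (tperm pt1 pt3).
Qed.

(** The default value of [nth] supplies (12), the transposition of code 2. *)
Definition tcode (n : nat) : transp :=
  nth (transp_of pt1 pt2) [:: transp_of pt2 pt3; transp_of pt1 pt3] n.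

Lemma tfix_tcode n : (n < 3)%N -> tfix (tcode n) = n.
Proof.
case: n => [|[|[|//]]] _.
- exact: (@tfix_of _ _ pt1). - exact: (@tfix_of _ _ pt2). - exact: (@tfix_of _ _ pt3).
Qed.

Lemma tcodeK t : tcode (tfix t) = t.
Proof. by apply: tfix_inj; rewrite tfix_tcode ?tfix_lt. Qed.

(** * Modules given by integral tables *)

Inductive tgen := tX of nat | tY of nat | tG of seq nat | tD of seq nat.

Definition dcode (i : Dgen) : tgen :=
  match i with
  | D_ge0 (ge0_S3 (S3_g g)) => tG (code g)
  | D_ge0 (ge0_S3 (S3_d h)) => tD (code h)
  | D_ge0 (ge0_y t) => tY (tfix t)
  | D_x t => tX (tfix t)
  end.

(** Linearity is needed before any relation is known, in order to establish the relations of a [rep]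
    on basis vectors. *)
Lemma tact_linear (k : fieldType) (I : Type) (U : lmodType k) (op : I -> U -> U) a :
  (forall i, linear (op i)) -> linear (tact op a).
Proof.
move=> linop; elim: a => [c|i|a IHa b IHb|a IHa|a IHa b IHb] d u v /=.
- by rewrite scalerDr !scalerA mulrC.
- exact: linop.
- by rewrite IHa IHb scalerDr addrACA.
- by rewrite IHa opprD scalerN.
- by rewrite IHb IHa.
Qed.

(* [tab g i] is the image of the [i]-th basis vector under the generator [g]; a table
   vanishing from the index [n] on describes operators on an [n]-dimensional space. *)
Section Table.
Variables (n : nat) (tab : tgen -> nat -> fv).

Fixpoint ftact (a : pterm int tgen) (v : fv) : fv :=
  match a with
  | Cst c => fscale c v
  | Gen g => fapp (tab g) v
  | Add a b => ftact a v ++ ftact b v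
  | Opp a => fscale (-1) (ftact a v)
  | Mul a b => ftact a (ftact b v)
  end.

Definition same (a b : pterm int tgen) : bool :=
  all (fun i => feq n (ftact a [:: (1, i)]) (ftact b [:: (1, i)])) (iota 0 n).

Local Notation x t := (Gen (tX t)).
Local Notation y t := (Gen (tY t)).
Local Notation G c := (Gen (tG c)).
Local Notation D c := (Gen (tD c)).
Let all_t (P : pred nat) := all P (iota 0 3).
Let all_c (P : pred (seq nat)) := all P S3c.
Let all_ijl (P : nat -> nat -> nat -> bool) :=
  all_t (fun i => all_t (fun j => all_t (fun l => uniq [:: i; j; l] ==> P i j l))).

(** The relations of D in terms of codes. For distinct i, j, l the transposition (ij) fixes l, so
    x_(ij), x_(il), x_(jl) appear as [x l], [x j], [x i], and likewise for the y's. *)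
Definition table_ok : bool :=
  [&& all_c (fun c => all_c (fun d => same (G c * G d) (G (ccomp c d)))),
      same (G [:: 0; 1; 2]%N) (Cst 1),
      all_c (fun c => all_c (fun d => same (D c * D d) (if c == d then D c else Cst 0))),
      same (foldr (fun c a => D c + a)%PT (Cst 0) S3c) (Cst 1),
      all_c (fun c => all_c (fun d => same (D d * G c) (G c * D (ccomp (ccomp (cinv c) d) c)))),
      all_t (fun t => same (y t * y t) (Cst 0)),
      all_ijl (fun i j l => same (y l * y j + y i * y l + y j * y i) (Cst 0)),
      all_c (fun c => all_t (fun t => same (D c * y t) (y t * D (ccomp (ctr t) c)))),
      all_c (fun c => all_t (fun t =>
        same (y t * G c) (Cst (csgn c) * (G c * y (nth 0%N (cinv c) t))))),
      all_t (fun t => same (x t * x t) (Cst 0)),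
      all_ijl (fun i j l => same (x l * x j + x i * x l + x j * x i) (Cst 0)),
      all_c (fun c => all_t (fun t =>
        same (G c * x t) (Cst (csgn c) * (x (nth 0%N c t) * G c)))),
      all_c (fun c => all_t (fun t => same (D c * x t) (x t * D (ccomp (ctr t) c)))),
      all_t (fun t => same (y t * x t + x t * y t)
        (Cst 1 + G (ctr t) * (D (ctr t) - D [:: 0; 1; 2]%N)))
    & all_ijl (fun i j l => same (y j * x l + x l * y i)
        (G (ctr l) * (D (ctr j) - D (ccomp (ctr j) (ctr l)))))]%PT.

Variable k : fieldType.
Definition tspace : lmodType k := {ffun 'I_n -> k^o}.
Implicit Types (u : tspace).

Definition tbase (i : nat) : tspace := [ffun j : 'I_n => (val j == i)%:R : k^o].

Lemma tbase0 i : (n <= i)%N -> tbase i = 0.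
Proof.
move=> ni; apply/ffunP=> j; rewrite !ffunE ltn_eqF //.
exact: leq_trans (ltn_ord j) ni.
Qed.

Lemma tbase_sum u : u = \sum_(i < n) (u : {ffun _}) i *: tbase i.
Proof.
apply/ffunP=> j; rewrite sum_ffunE (bigD1 j) //= big1 => [|i /negPf ij].
  by rewrite !ffunE eqxx addr0 [RHS]mulr1.
by rewrite !ffunE val_eqE eq_sym ij scaler0.
Qed.

Lemma tbase_coord v j : (ev tbase v : {ffun _}) j = (coef v (val j))%:~R.
Proof.
elim: v => [|[c i] v IH]; first by rewrite ev_nil ffunE.
rewrite ev_cons ffunE IH /=.
have -> : (tbase i *~ c : {ffun _}) j = (val j == i)%:R * c%:~R.
  rewrite -scaler_int !ffunE; exact: mulrC.
by rewrite [i == _]eq_sym; case: eqP => _; rewrite ?mul1r ?mul0r ?add0r ?rmorphD.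
Qed.

Definition top_of (A : nat -> fv) u : tspace := \sum_(i < n) (u : {ffun _}) i *: ev tbase (A i).

Fact top_of_lin A : linear (top_of A).
Proof.
move=> c u v; rewrite /top_of scaler_sumr -big_split /=; apply: eq_bigr => i _.
by rewrite !ffunE scalerDl scalerA.
Qed.
HB.instance Definition _ A := GRing.isLinear.Build k tspace tspace _ (top_of A) (top_of_lin A).

Hypothesis tab_out : forall g i, (n <= i)%N -> tab g i = [::].

Lemma top_of_base g i : top_of (tab g) (tbase i) = ev tbase (tab g i).
Proof.
case: (ltnP i n) => ni; last first.
  by rewrite tbase0 // raddf0 tab_out // ev_nil.
rewrite /top_of (bigD1 (Ordinal ni)) //= big1 => [|j].
  by rewrite ffunE eqxx scale1r addr0.
by rewrite -val_eqE /= => /negPf ij; rewrite ffunE ij scale0r.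
Qed.

Lemma top_of_ev g v : top_of (tab g) (ev tbase v) = ev tbase (fapp (tab g) v).
Proof. by apply: ev_app => i; exact: top_of_base. Qed.

Definition table_op (i : Dgen) : tspace -> tspace := top_of (tab (dcode i)).

Fixpoint pint (a : pterm int tgen) : pterm k tgen :=
  match a with
  | Cst c => Cst c%:~R
  | Gen i => Gen i
  | Add a b => pint a + pint b
  | Opp a => - pint a
  | Mul a b => pint a * pint b
  end%PT.

(** The hypothesis is a syntactic equality of terms, after which [ftact] runs on integers alone:
    this turns a relation over [k] into a computation that does not see [k]. *)
Lemma table_tact a za v :
  tmap dcode a = pint za -> tact table_op a (ev tbase v) = ev tbase (ftact za v).
Proof.
elim: a za v => [c|i|a IHa b IHb|a IHa|a IHa b IHb] [d|j|za zb|za|za zb] v //=.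
- by case=> ->; rewrite ev_scale scaler_int.
- by case=> <-; exact: top_of_ev.
- by case=> ea eb; rewrite (IHa za) // (IHb zb) // ev_cat.
- by case=> ea; rewrite (IHa za) // ev_scale mulrN1z.
- by case=> ea eb; rewrite (IHb zb) // (IHa za).
Qed.

Lemma table_lin i : linear (table_op i).
Proof. exact: top_of_lin. Qed.

Lemma table_tact_lin a : linear (tact table_op a).
Proof. by apply: tact_linear => i; exact: table_lin. Qed.

Lemma linear_base (U : lmodType k) (S T : tspace -> U) :
  linear S -> linear T -> (forall i, (i < n)%N -> S (tbase i) = T (tbase i)) -> S =1 T.
Proof.
move=> linS linT ST u.
have zero (R : tspace -> U) : linear R -> R 0 = 0.
  by move=> linR; have := linR (-1) 0 0; rewrite scaler0 addr0 scaleN1r addNr.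
have sum (R : tspace -> U) : linear R ->
    R u = \sum_(i < n) (u : {ffun _}) i *: R (tbase i).
  move=> linR; rewrite {1}[u]tbase_sum; apply: (big_ind2 (fun x y => R x = y)) => [|a _ b _ <- <-|i _].
  - exact: zero.
  - by have := linR 1 a b; rewrite !scale1r.
  - by have := linR ((u : {ffun _}) i) (tbase i) 0; rewrite !addr0 zero // addr0.
by rewrite (sum S) // (sum T) //; apply: eq_bigr => i _; rewrite ST.
Qed.

Lemma tact_same a b za zb :
  tmap dcode a = pint za -> tmap dcode b = pint zb -> same za zb ->
  tact table_op a =1 tact table_op b.
Proof.
move=> ea eb /allP ab; apply: linear_base; try exact: table_tact_lin.
move=> i ni; rewrite -[tbase i]ev1 (table_tact _ ea) (table_tact _ eb).
by apply: (feqP tbase0); apply: ab; rewrite mem_iota.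
Qed.

End Table.

Lemma tmap_sum (k I J T : Type) (f : I -> J) (s : seq T) (c : k) (F : T -> pterm k I) :
  tmap f (\big[@Add k I/Cst c]_(i <- s) F i) = \big[@Add k J/Cst c]_(i <- s) tmap f (F i).
Proof. by elim: s => [|i s IH]; rewrite ?big_nil ?big_cons //= IH. Qed.

Lemma sum_code (U : zmodType) (F : seq nat -> U) :
  \sum_(g : 'S_3) F (code g) = \sum_(c <- S3c) F c.
Proof.
transitivity (\sum_(g <- enum 'S_3) F (code g)); first by rewrite big_enum.
rewrite -(big_map code predT F); apply: perm_big.
have uc : uniq (map code (enum 'S_3)) by rewrite map_inj_uniq ?enum_uniq //; exact: code_inj.
apply: uniq_perm => //.
have sc : {subset map code (enum 'S_3) <= S3c} by move=> _ /mapP[g _ ->]; exact: code_in.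
have sz : (size S3c <= size (map code (enum 'S_3)))%N by rewrite size_map -cardE card_Sn.
by have [] := uniq_min_size uc sc sz.
Qed.

(** * From a checked table to a D-module *)

Section TableRep.
Variables (n : nat) (tab : tgen -> nat -> fv).
Hypothesis tab_out : forall g i, (n <= i)%N -> tab g i = [::].
Hypothesis tab_ok : table_ok n tab.
Variable k : fieldType.
Local Notation act := (tact (@table_op n tab k)).

Local Notation x t := (Gen (tX t)).
Local Notation y t := (Gen (tY t)).
Local Notation G c := (Gen (tG c)).
Local Notation D c := (Gen (tD c)).

Let allc P : all P S3c -> forall g, P (code g).
Proof. by move/allP=> PS g; apply/PS/code_in. Qed.

Let allt P : all P (iota 0 3) -> forall t, P (tfix t).
Proof. by move/allP=> PS t; apply/PS; rewrite mem_iota tfix_lt. Qed.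

Let allI P (i : 'I_3) : all P (iota 0 3) -> P (val i).
Proof. by move/allP; apply; rewrite mem_iota ltn_ord. Qed.

Let allijl P (i j l : 'I_3) : uniq [:: i; j; l] ->
  all (fun i => all (fun j => all (fun l => uniq [:: i; j; l] ==> P i j l)
    (iota 0 3)) (iota 0 3)) (iota 0 3) -> P i j l.
Proof.
move=> u /(allI i)/(allI j)/(allI l)/implyP; apply.
by rewrite -(map_inj_uniq val_inj) in u.
Qed.

Lemma table_rel (a b : pterm k Dgen) : Drel a b -> act a =1 act b.
Proof.
pose sm (a b : pterm k Dgen) za zb := @tact_same n tab k tab_out a b za zb.
move: tab_ok; rewrite /table_ok.
case/and5P=> okGG okG1 okDD okD1 /and5P[okDG okyy okyyy okDy /and5P[okyG okxx okxxx okGx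
  /and3P[okDx okyx okyx']]].
have fx i j l : uniq [:: i; j; l] ->
    [/\ tfix (transp_of i j) = l, tfix (transp_of i l) = j & tfix (transp_of j l) = i].
  by move: i j l; do 3!elim/I3P; move=> // _; split; exact: tfix_of.
case=> [_ _ [_ _ [g h||g h||g h]|t|i j l u|g t|g t]|t|i j l u|g t|h t|t|i j l u].
- apply: (sm _ _ (G (code g) * G (code h))%PT (G (ccomp (code g) (code h)))) => //=.
    by rewrite code_comp.
  exact: (allc (allc okGG g) h).
- by apply: (sm _ _ (G [:: 0; 1; 2]%N) (Cst 1)) => //=; rewrite code1.
- apply: (sm _ _ (D (code g) * D (code h))%PT
    (if code g == code h then D (code g) else Cst 0)) => //=.
    by rewrite (inj_eq code_inj); case: eqP.
  exact: (allc (allc okDD g) h).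
(* The terms of this sum come in the order of the enumeration of the group, so it does not match a
   coded term syntactically; it is evaluated and then reindexed by codes. *)
- move=> u; rewrite !tmap_sum tact_sum /=.
  rewrite (sum_code (fun c => @top_of n k (tab (tD c)) u)).
  have E s : tact (fun c => @top_of n k (tab c)) (foldr (fun c a => D c + a)%PT (Cst 0) s) u
      = \sum_(c <- s) @top_of n k (tab (tD c)) u.
    by elim: s => [|c s IH]; rewrite ?big_nil ?big_cons /= ?scale0r ?IH.
  rewrite -E scale1r; move: u {E}; apply: linear_base.
  + by apply: tact_linear => c; exact: top_of_lin.
  + by [].
  + move=> i ni; move/allP: okD1 => /(_ i); rewrite mem_iota => /(_ ni)/(feqP (tbase0 k)).
    rewrite /= !(ev_cat, =^~ top_of_ev k tab_out, ev_scale, ev1).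
    by rewrite ev_cons ev_nil mul0r mulr0z addr0 scale0r.
- apply: (sm _ _ (D (code h) * G (code g))%PT
    (G (code g) * D (ccomp (ccomp (cinv (code g)) (code h)) (code g)))%PT) => //=.
    by rewrite !code_comp code_inv.
  exact: (allc (allc okDG g) h).
- apply: (sm _ _ (y (tfix t) * y (tfix t))%PT (Cst 0)) => //=.
  exact: (allt okyy t).
- have [f1 f2 f3] := fx _ _ _ u.
  apply: (sm _ _ (y (val l) * y (val j) + y (val i) * y (val l) + y (val j) * y (val i))%PT
    (Cst 0)) => //=; first by rewrite f1 f2 f3.
  exact: (allijl u okyyy).
- apply: (sm _ _ (D (code g) * y (tfix t))%PT
    (y (tfix t) * D (ccomp (ctr (tfix t)) (code g)))%PT) => //=.
    by rewrite code_comp code_val.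
  exact: (allt (allc okDy g) t).
- apply: (sm _ _ (y (tfix t) * G (code g))%PT
    (Cst (csgn (code g)) * (G (code g) * y (nth 0%N (cinv (code g)) (tfix t))))%PT) => //=.
    by rewrite tfix_conj code_inv sgnE.
  exact: (allt (allc okyG g) t).
- apply: (sm _ _ (x (tfix t) * x (tfix t))%PT (Cst 0)) => //=.
  exact: (allt okxx t).
- have [f1 f2 f3] := fx _ _ _ u.
  apply: (sm _ _ (x (val l) * x (val j) + x (val i) * x (val l) + x (val j) * x (val i))%PT
    (Cst 0)) => //=; first by rewrite f1 f2 f3.
  exact: (allijl u okxxx).
- apply: (sm _ _ (G (code g) * x (tfix t))%PT
    (Cst (csgn (code g)) * (x (nth 0%N (code g) (tfix t)) * G (code g)))%PT) => //=.
    by rewrite tfix_conj sgnE.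
  exact: (allt (allc okGx g) t).
- apply: (sm _ _ (D (code h) * x (tfix t))%PT
    (x (tfix t) * D (ccomp (ctr (tfix t)) (code h)))%PT) => //=.
    by rewrite code_comp code_val.
  exact: (allt (allc okDx h) t).
- apply: (sm _ _ (y (tfix t) * x (tfix t) + x (tfix t) * y (tfix t))%PT
    (Cst 1 + G (ctr (tfix t)) * (D (ctr (tfix t)) - D [:: 0; 1; 2]%N))%PT) => //=.
    by rewrite code_val code1.
  exact: (allt okyx t).
- have [f1 f2 f3] := fx _ _ _ u.
  apply: (sm _ _ (y (val j) * x (val l) + x (val l) * y (val i))%PT
    (G (ctr l) * (D (ctr j) - D (ccomp (ctr j) (ctr l))))%PT) => //=.
    by rewrite f1 f2 f3.
  by rewrite code_comp !code_val f1 f2.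
  exact: (allijl u okyx').
Qed.

Definition table_rep : rep (@Drel k) := Rep (@table_lin n tab k) table_rel.

End TableRep.

(* The twelve words 1, a, b, c, ab, ac, ba, bc, aba, abc, bac, abac, in this order,
   form a basis of B(V), where a, b, c are x_(23), x_(13), x_(12); [whead] and [wtail]
   give the first letter and the remaining word.  A transposition is coded by its fixed
   point, so that a, b, c have codes 0, 1, 2. *)
Definition whead (b : nat) := nth 0 [:: 0; 0; 1; 2; 0; 0; 1; 1; 0; 0; 1; 0]%N b.
Definition wtail (b : nat) := nth 0 [:: 0; 0; 0; 0; 2; 3; 1; 3; 6; 7; 5; 10]%N b.

Definition pm (p m : seq nat) : fv := [seq (1, i) | i <- p] ++ [seq (-1, i) | i <- m].

Arguments pm (p m)%_N.

(** Left multiplication of B(V) on its twelve basis words. The table has two uses: it defines the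
    action of the x's on the 36-dimensional module, and [word_mul] derives it from the relations in
    an arbitrary module. *)
Definition wmul (t b : nat) : fv :=
  nth [::] (nth [::]
    [:: [:: pm [:: 1] [::]; [::]; pm [:: 4] [::]; pm [:: 5] [::]; [::]; [::];
            pm [:: 8] [::]; pm [:: 9] [::]; [::]; [::]; pm [:: 11] [::]; [::]];
        [:: pm [:: 2] [::]; pm [:: 6] [::]; [::]; pm [:: 7] [::]; pm [:: 8] [::];
            pm [:: 10] [::]; [::]; [::]; [::]; pm [:: 11] [::]; [::]; [::]];
        [:: pm [:: 3] [::]; pm [::] [:: 4; 7]; pm [::] [:: 5; 6]; [::]; pm [:: 10] [::];
            pm [::] [:: 9]; pm [:: 9] [::]; pm [::] [:: 10]; pm [::] [:: 11];
            [::]; [::]; [::]]] t) b.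

(* The index [3 * w + t] stands for the word [w] applied to [|t>]. *)
Definition mX (t i : nat) : fv := [seq (p.1, 3 * p.2 + i %% 3)%N | p <- wmul t (i %/ 3)].

Definition mtl (i : nat) : nat := (3 * wtail (i %/ 3) + i %% 3)%N.

(** The relation g x_t = sgn(g) x_{gtg^-1} g moves g through the word until it meets |t>, where the
    weight (sigma, -) gives one more sign. Words have at most four letters, so a fuel of 5
    suffices. *)
Fixpoint mG_rec (fuel : nat) (c : seq nat) (i : nat) : fv :=
  if fuel is m.+1 then
    if (i < 3)%N then [:: (csgn c, nth 0%N c i)] else
    fscale (csgn c) (fapp (mX (nth 0%N c (whead (i %/ 3)))) (mG_rec m c (mtl i)))
  else [::].
Definition mG := mG_rec 5.

(** By delta_h x_t = x_t delta_{th}, the letter x_t multiplies the degree by t on the left. *)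
Fixpoint mdeg_rec (fuel i : nat) : seq nat :=
  if fuel is m.+1 then
    if (i < 3)%N then ctr i else ccomp (ctr (whead (i %/ 3))) (mdeg_rec m (mtl i))
  else [::].
Definition mdeg := mdeg_rec 5.

Definition mD (c : seq nat) (i : nat) : fv := if mdeg i == c then [:: (1, i)] else [::].

(* The recursion on the word moves y_s to the right by the cross relations. *)
Fixpoint mY_rec (fuel : nat) (s i : nat) : fv :=
  if fuel is m.+1 then
    if (i < 3)%N then [::] else
    let t := whead (i %/ 3) in let j := mtl i in
    if s == t then
      [:: (1, j)] ++ fscale (-1) (fapp (mX t) (mY_rec m t j))
        ++ fapp (mG (ctr t)) (mD (ctr t) j ++ fscale (-1) (mD [:: 0; 1; 2]%N j))
    else
      fscale (-1) (fapp (mX t) (mY_rec m (3 - s - t)%N j))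
        ++ fapp (mG (ctr t)) (mD (ctr s) j ++ fscale (-1) (mD (ccomp (ctr s) (ctr t)) j))
  else [::].
Definition mY := mY_rec 5.

(** Entries are normalized, so that later checks may compare lists by [==]. The tables are stored
    evaluated, so that those checks look up entries without rerunning the recursions. *)
Definition tabulate (n : nat) (f : nat -> fv) := [seq fnorm n (f i) | i <- iota 0 n].

Definition vtabX := Eval vm_compute in [seq tabulate 36 (mX t) | t <- iota 0 3].
Definition vtabY := Eval vm_compute in [seq tabulate 36 (mY t) | t <- iota 0 3].
Definition vtabG := Eval vm_compute in [seq tabulate 36 (mG c) | c <- S3c].
Definition vtabD := Eval vm_compute in [seq tabulate 36 (mD c) | c <- S3c].

Definition lookup (X Y G D : seq (seq fv)) (g : tgen) (i : nat) : fv :=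
  nth [::] (match g with
    | tX t => nth [::] X t
    | tY t => nth [::] Y t
    | tG c => nth [::] G (index c S3c)
    | tD c => nth [::] D (index c S3c)
    end) i.

Lemma lookup_out X Y G D n : all (all (fun s => size s <= n)%N) [:: X; Y; G; D] ->
  forall g i, (n <= i)%N -> lookup X Y G D g i = [::].
Proof.
move=> /and5P[sX sY sG sD _] g i ni; rewrite /lookup nth_default //.
have sz (s : seq (seq fv)) j : all (fun s => size s <= n)%N s -> (size (nth [::] s j) <= i)%N.
  move=> ss; case: (ltnP j (size s)) => js; last by rewrite nth_default.
  by apply: leq_trans ni; exact: (allP ss) (mem_nth _ js).
by case: g => a; exact: sz.
Qed.

Definition vtab := lookup vtabX vtabY vtabG vtabD.

Lemma vtab_out g i : (36 <= i)%N -> vtab g i = [::].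
Proof. exact: lookup_out. Qed.

(** This is where independence of the 36 vectors comes from: the relations hold on formal basis
    vectors, so they cannot make the Verma module any smaller. *)
Lemma vtab_ok : table_ok 36 vtab.
Proof. by vm_compute. Qed.

(* [fS] spans the socle; [fL] lists bases of the modules V, Q and N_0, in this order, where
   the elements of the bases of Q and N_0 are permuted by S_3. The functionals [dS] and [dL]
   vanish on all vectors of [fS ++ fL] but their own. *)
Definition fS : seq fv :=
  [:: pm [:: 12; 16; 19; 21] [::]; pm [:: 13; 17] [::]; pm [:: 18; 23] [::];
      pm [:: 24; 31] [::]; pm [:: 25; 32] [::]; pm [:: 27] [:: 32]; pm [:: 29] [:: 31];
      pm [:: 33] [::]; pm [:: 34] [::]; pm [:: 35] [::]].

Definition fL : seq fv :=
  [:: pm [:: 3] [:: 11]; pm [:: 7] [:: 11];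
      pm [:: 13] [:: 17]; pm [:: 23] [:: 18]; pm [:: 16; 19] [:: 12; 21];
      pm [:: 29; 31] [:: 24]; pm [:: 27; 32] [:: 25]].

Definition dS : seq fv :=
  [:: pm [:: 12; 16] [::]; pm [:: 13; 17] [::]; pm [:: 18; 23] [::];
      pm [:: 24; 24; 29; 31] [::]; pm [:: 25; 25; 27; 32] [::];
      pm [:: 25; 27; 27] [:: 32]; pm [:: 24; 29; 29] [:: 31];
      pm [:: 33] [::]; pm [:: 34] [::]; pm [:: 35] [::]].

Definition dL : seq fv :=
  [:: pm [:: 3] [::]; pm [:: 7] [::];
      pm [:: 13] [:: 17]; pm [:: 23] [:: 18]; pm [:: 16] [:: 12];
      pm [:: 29; 31] [:: 24]; pm [:: 27; 32] [:: 25]].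

(* The basis of [L7] consists of the classes of the vectors of [fL] divided by [lweight]; this
   scaling makes the action integral and [dL] the coordinate functions. *)
Definition lweight : seq nat := [:: 1; 1; 2; 2; 2; 3; 3]%N.
(** Truncated division. Its exactness is never assumed: the table obtained with it is validated by
    [ltab_ok] and [projX_gen], and the coefficients in [span_coefs] by [in_span]. *)
Definition ldiv (c : int) (m : nat) : int := sgz c * (absz c %/ m)%N.
Definition proj_fv (v : fv) : fv := [seq (dot (nth [::] dL j) v, j) | j <- iota 0 7].
Definition mL (g : tgen) (i : nat) : fv :=
  [seq (ldiv p.1 (nth 1%N lweight i), p.2) | p <- proj_fv (fapp (vtab g) (nth [::] fL i))].
Definition ltabX := Eval vm_compute in [seq tabulate 7 (mL (tX t)) | t <- iota 0 3].
Definition ltabY := Eval vm_compute in [seq tabulate 7 (mL (tY t)) | t <- iota 0 3].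
Definition ltabG := Eval vm_compute in [seq tabulate 7 (mL (tG c)) | c <- S3c].
Definition ltabD := Eval vm_compute in [seq tabulate 7 (mL (tD c)) | c <- S3c].
Definition ltab := lookup ltabX ltabY ltabG ltabD.

Lemma ltab_out g i : (7 <= i)%N -> ltab g i = [::].
Proof. exact: lookup_out. Qed.

Lemma ltab_ok : table_ok 7 ltab.
Proof. by vm_compute. Qed.

(** * Modules over presented algebras *)

Section PresentedModules.
Variables (k : fieldType) (I : Type) (rel : pterm k I -> pterm k I -> Prop).
Local Notation A := (presented rel).

(** A module over [A] comes without a separate action of [k]; scalars act through the multiples of
    1, which are central. *)
Definition kscale (U : lmodType A) (c : k) (u : U) : U := (c *: (1 : A)) *: u.

Section Scalars.
Variable U : lmodType A.
Implicit Types (u v : U) (c d : k) (a : A).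

Lemma pscale_scale c a u : (c *: a) *: u = kscale c (a *: u).
Proof. by rewrite /kscale scalerA -pscalerAl mul1r. Qed.

Lemma ks_scale c a u : a *: kscale c u = kscale c (a *: u).
Proof. by rewrite /kscale !scalerA -pscalerAl -pscalerAr mul1r mulr1. Qed.

Lemma ksA c d u : kscale c (kscale d u) = kscale (c * d) u.
Proof. by rewrite /kscale scalerA -pscalerAl mul1r scalerA. Qed.

Lemma ks1 u : kscale 1 u = u.
Proof. by rewrite /kscale scale1r scale1r. Qed.

Lemma ks0 u : kscale 0 u = 0.
Proof. by rewrite /kscale scale0r scale0r. Qed.

Fact ks_is_additive c : zmod_morphism (kscale (U := U) c).
Proof. by move=> u v; rewrite /kscale scalerBr. Qed.
HB.instance Definition _ c := GRing.isZmodMorphism.Build U U (kscale (U := U) c) (ks_is_additive c).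

Lemma ksDl c d u : kscale (c + d) u = kscale c u + kscale d u.
Proof. by rewrite /kscale scalerDl scalerDl. Qed.

Lemma ks_int (z : int) u : kscale z%:~R u = u *~ z.
Proof.
have nat m : kscale m%:R u = u *+ m.
  by elim: m => [|m IH]; rewrite ?ks0 // -natr1 ksDl IH ks1 mulrSr.
case: z => m; first exact: nat.
rewrite NegzE [in RHS]mulrNz intrN; apply: (addIr (kscale m.+1%:R u)).
by rewrite -ksDl addNr ks0 nat addNr.
Qed.

End Scalars.

Lemma pgenW (P : A -> Prop) :
  (forall c, P (c *: (1 : A))) -> (forall i, P (pgen rel i)) ->
  (forall a b, P a -> P b -> P (a + b)) -> (forall a, P a -> P (- a)) ->
  (forall a b, P a -> P b -> P (a * b)) -> forall a, P a.
Proof.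
move=> Pc Pg PD PN PM; elim/presW.
elim=> [c|i|a IHa b IHb|a IHa|a IHa b IHb].
- by rewrite pcls_cst.
- exact: Pg.
- by rewrite pclsD; exact: PD.
- by rewrite pclsN; exact: PN.
- by rewrite pclsM; exact: PM.
Qed.

Lemma is_submod_gen (U : lmodType A) (P : U -> Prop) :
  P 0 -> (forall u v, P u -> P v -> P (u + v)) ->
  (forall c u, P u -> P (kscale c u)) -> (forall i u, P u -> P (pgen rel i *: u)) ->
  is_submod P.
Proof.
move=> P0 PD Pc Pg; split=> [//|a u v Pu Pv]; apply: (PD) => //.
elim/pgenW: a u Pu {v Pv} => [c|i|a b IHa IHb|a IHa|a b IHa IHb] u Pu.
- exact: Pc.
- exact: Pg.
- by rewrite scalerDl; apply: PD; [exact: IHa|exact: IHb].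
- by rewrite scaleNr -scalerN; apply: IHa; rewrite -(mulrN1z u) -ks_int; exact: Pc.
- by rewrite -scalerA; apply/IHa/IHb.
Qed.

Lemma scalable_gen (U V : lmodType A) (f : {additive U -> V}) :
  (forall c u, f (kscale c u) = kscale c (f u)) ->
  (forall i u, f (pgen rel i *: u) = pgen rel i *: f u) ->
  scalable f.
Proof.
move=> fc fg; elim/pgenW => [c|i|a b IHa IHb|a IHa|a b IHa IHb] u.
- exact: fc.
- exact: fg.
- by rewrite !scalerDl raddfD /= IHa IHb.
- by rewrite !scaleNr raddfN /= IHa.
- by rewrite -!scalerA IHa IHb.
Qed.

Lemma rep_ks (V : rep rel) c (u : rep_mod V) : kscale c u = c *: (u : rep_space V).
Proof. by rewrite /kscale -pcls_cst [LHS]rep_scaleE. Qed.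

Lemma rep_gen (V : rep rel) i (u : rep_mod V) : pgen rel i *: u = rep_op i (u : rep_space V).
Proof. exact: rep_scaleE. Qed.

End PresentedModules.

Section DDmodules.
Variable k : fieldType.
Local Notation DD := (DD k).
Local Notation DS3 := (DS3 k).
Local Notation G g := (pgen (@Drel k) (D_ge0 (ge0_S3 (S3_g g)))).
Local Notation D g := (pgen (@Drel k) (D_ge0 (ge0_S3 (S3_d g)))).
Local Notation y t := (yD k t).
Local Notation x t := (xD k t).

Lemma ge0_to_D_gen i : ge0_to_D k (pgen (@ge0rel k) i) = pgen (@Drel k) (D_ge0 i).
Proof. exact: pliftE. Qed.

Lemma S3_to_D_gen i : S3_to_D k (pgen (@S3rel k) i) = pgen (@Drel k) (D_ge0 (ge0_S3 i)).
Proof. by rewrite /= /S3_to_ge0 [X in ge0_to_D k X]pliftE ge0_to_D_gen. Qed.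

Lemma ge0_to_D_scalar c : ge0_to_D k (c *: (1 : Dge0 k)) = c *: (1 : DD).
Proof. by rewrite -pcls_cst; exact: pliftE. Qed.

Lemma S3_to_D_scalar c : S3_to_D k (c *: (1 : DS3)) = c *: (1 : DD).
Proof.
rewrite -pcls_cst /= /S3_to_ge0 [X in ge0_to_D k X]pliftE /=.
exact: ge0_to_D_scalar.
Qed.

Lemma ge0_to_S3_scalar c : ge0_to_S3 k (c *: (1 : Dge0 k)) = c *: (1 : DS3).
Proof. by rewrite -pcls_cst; exact: pliftE. Qed.

Lemma ge0_to_S3_gen i : ge0_to_S3 k (pgen (@ge0rel k) i) = ge0_proj_gen k i.
Proof. exact: pliftE. Qed.

Lemma DD_rel a b : Drel a b -> pcls (@Drel k) a = pcls (@Drel k) b.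
Proof. by move=> ab; apply/pclsP/cong_rel. Qed.

Lemma DD_Gx g t : G g * x t = sgn k g *: (x (class_conj g t) * G g).
Proof.
by have := DD_rel (Drel_g k g t); rewrite !pclsM pcls_cst -pscalerAl mul1r.
Qed.

Lemma DD_Dx h t : D h * x t = x t * D (val t ∘ h).
Proof. by have := DD_rel (Drel_d k h t); rewrite !pclsM. Qed.

Lemma DD_yx t : y t * x t = 1 + G (val t) * (D (val t) - D 1%g) - x t * y t.
Proof.
have := DD_rel (Drel_yx k t); rewrite !(pclsD, pclsM, pclsN) pcls_cst scale1r => <-.
by rewrite addrK.
Qed.

Lemma DD_yx' i j l : uniq [:: i; j; l] ->
  y (transp_of i l) * x (transp_of i j) =
  G (val (transp_of i j)) * (D (val (transp_of i l))
     - D (val (transp_of i l) ∘ val (transp_of i j)))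
  - x (transp_of i j) * y (transp_of j l).
Proof.
move=> u; have := DD_rel (Drel_yx' k u); rewrite !(pclsD, pclsM, pclsN) => <-.
by rewrite addrK.
Qed.

Lemma DD_xx t : x t * x t = 0.
Proof. by have := DD_rel (Drel_sqr k t); rewrite !pclsM pcls_cst scale0r. Qed.

Lemma DD_xxx i j l : uniq [:: i; j; l] ->
  x (transp_of i j) * x (transp_of i l) + x (transp_of j l) * x (transp_of i j)
  + x (transp_of i l) * x (transp_of j l) = 0.
Proof. by move=> u; have := DD_rel (Drel_quad k u); rewrite !(pclsD, pclsM) pcls_cst scale0r. Qed.

(** The mixed cross relation is stated in terms of three points; this brings any two different
    transpositions into that form. *)
Lemma transp_pair t s : t != s ->
  exists i j l, [/\ uniq [:: i; j; l], t = transp_of i l & s = transp_of i j].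
Proof.
have [j jt] : exists j : 'I_3, tfix t = j by exists (Ordinal (tfix_lt t)).
have [l ls] : exists l : 'I_3, tfix s = l by exists (Ordinal (tfix_lt s)).
rewrite -(inj_eq tfix_inj) jt ls => jl.
have [i u] : exists i, uniq [:: i; j; l].
  move: {jt ls} jl; elim/I3P: j; elim/I3P: l => // _.
  - by exists pt3. - by exists pt2. - by exists pt3.
  - by exists pt1. - by exists pt2. - by exists pt1.
exists i, j, l; split=> //; apply: tfix_inj; last by rewrite (tfix_of u).
by rewrite jt; apply/esym/tfix_of; move: i j l u {jt ls jl}; do 3!elim/I3P.
Qed.

(* The cross relations move g, delta_g and y_t to the right of any word in the x's, so words
   in the x's applied to vectors killed by the y's span a D-submodule. *)
Section HighestWeight.
Variables (M : lmodType DS3) (U : lmodType DD) (f : M -> U).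
Hypothesis fD : {morph f : m m' / m + m'}.
Hypothesis fZ : forall a m, f (a *: m) = S3_to_D k a *: f m.
Hypothesis fy : forall t m, y t *: f m = 0.

Inductive xspan : U -> Prop :=
| xspan_base m : xspan (f m)
| xspan_add u v : xspan u -> xspan v -> xspan (u + v)
| xspan_x t u : xspan u -> xspan (x t *: u).

Lemma xspan_ks c u : xspan u -> xspan (kscale c u).
Proof.
elim=> [m|v w _ IHv _ IHw|t v _ IH].
- by rewrite /kscale -S3_to_D_scalar -fZ; exact: xspan_base.
- by rewrite raddfD; exact: xspan_add.
- by rewrite -ks_scale; exact: xspan_x.
Qed.

Lemma xspan_0 : xspan 0.
Proof. by rewrite -(ks0 (f 0)); exact/xspan_ks/xspan_base. Qed.

Lemma xspan_opp u : xspan u -> xspan (- u).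
Proof. by move=> Pu; rewrite -(mulrN1z u) -ks_int; exact: xspan_ks. Qed.

Lemma xspan_G g u : xspan u -> xspan (G g *: u).
Proof.
elim=> [m|v w _ IHv _ IHw|t v _ IH].
- by rewrite -S3_to_D_gen -fZ; exact: xspan_base.
- by rewrite scalerDr; exact: xspan_add.
- by rewrite scalerA DD_Gx pscale_scale -scalerA; exact/xspan_ks/xspan_x.
Qed.

Lemma xspan_D g u : xspan u -> xspan (D g *: u).
Proof.
move=> Pu; elim: Pu g => [m|v w _ IHv _ IHw|t v _ IH] g.
- by rewrite -S3_to_D_gen -fZ; exact: xspan_base.
- by rewrite scalerDr; exact: xspan_add.
- by rewrite scalerA DD_Dx -scalerA; exact/xspan_x.
Qed.

Lemma xspan_y t u : xspan u -> xspan (y t *: u).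
Proof.
move=> Pu; elim: Pu t => [m|v w _ IHv _ IHw|s v Pv IH] t.
- by rewrite fy; exact: xspan_0.
- by rewrite scalerDr; exact: xspan_add.
have GD g h h' : xspan ((G g * (D h - D h')) *: v).
  rewrite -scalerA; apply: xspan_G; rewrite scalerBl.
  by apply: xspan_add; [|apply: xspan_opp]; exact: xspan_D.
have xy t' : xspan (- ((x s * y t') *: v)).
  by apply: xspan_opp; rewrite -scalerA; exact: xspan_x.
rewrite scalerA; have [->|ts] := eqVneq t s.
  rewrite DD_yx scalerBl scalerDl scale1r.
  by apply: xspan_add => //; apply: xspan_add.
have [i [j [l [ijl Et Es]]]] := transp_pair ts.
rewrite {1}Et {1}Es DD_yx' // scalerBl; apply: xspan_add => //.
by rewrite -Es.
Qed.

Lemma xspan_submod : is_submod xspan.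
Proof.
apply: is_submod_gen.
- exact: xspan_0.
- exact: xspan_add.
- exact: xspan_ks.
case=> [[[g|g]|t]|t] u.
- exact: xspan_G. - exact: xspan_D. - exact: xspan_y. - exact: xspan_x.
Qed.

(** Separates the part of x-degree 0 from the image of the x's, as the Nakayama argument
    requires. *)
Lemma xspan_split u : xspan u -> exists m v, u = f m + \sum_t x t *: v t.
Proof.
have f0 : f 0 = 0 by apply: (addIr (f 0)); rewrite -fD !add0r.
elim=> [m|_ _ _ [m [v ->]] _ [m' [v' ->]]|t w _ _].
- by exists m, (fun=> 0); rewrite big1 ?addr0 // => t _; rewrite scaler0.
- exists (m + m'), (fun t => v t + v' t); rewrite fD addrACA -big_split /=.
  by congr (_ + _); apply: eq_bigr => t _; rewrite scalerDr.
- exists 0, (fun s => if s == t then w else 0).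
  rewrite f0 add0r (bigD1 t) //= eqxx big1 ?addr0 // => s /negPf ->.
  exact: scaler0.
Qed.

End HighestWeight.
End DDmodules.

(** * Verma modules *)

Section Verma.
Variables (k : fieldType) (M : lmodType (DS3 k)).
Local Notation DD := (DD k).
Local Notation V := (Verma M).

Definition vtop (m : M) : V := tens (ge0_to_D k) 1 (m : res_mod (ge0_to_S3 k) M).

Lemma tensE a (m : res_mod (ge0_to_S3 k) M) : tens (ge0_to_D k) a m = a *: (vtop m : V).
Proof. by rewrite [RHS]escaleE /= mulr1. Qed.

Lemma vtopD : {morph vtop : m m' / m + m'}.
Proof. by move=> m m'; rewrite /vtop /tens -tclsD; apply/tclsP/tcong_Dr. Qed.

Lemma vtop_bal b m : ge0_to_D k b *: vtop m = vtop (ge0_to_S3 k b *: m).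
Proof.
rewrite /vtop [LHS]escaleE /= mulr1 -[ge0_to_D k b]mul1r.
exact/tclsP/tcong_bal.
Qed.

Lemma vtopZ a m : vtop (a *: m) = S3_to_D k a *: vtop m.
Proof.
have E b : ge0_to_S3 k (S3_to_ge0 k b) = b.
  elim/pgenW: b => [c|i|b c Eb Ec|b Eb|b c Eb Ec].
  - rewrite /S3_to_ge0 /= -pcls_cst [X in ge0_to_S3 k X]pliftE /=.
    by rewrite ge0_to_S3_scalar pcls_cst.
  - by rewrite /S3_to_ge0 /= [X in ge0_to_S3 k X]pliftE /= ge0_to_S3_gen.
  - by rewrite !rmorphD Eb Ec.
  - by rewrite !rmorphN Eb.
  - by rewrite !rmorphM Eb Ec.
by rewrite /= vtop_bal E.
Qed.

Lemma vtop_y t m : yD k t *: vtop m = 0.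
Proof.
rewrite /yD -ge0_to_D_gen vtop_bal ge0_to_S3_gen /= scale0r.
by apply: (addIr (vtop 0)); rewrite -vtopD !add0r.
Qed.

Lemma Verma_ind (P : V -> Prop) : is_submod P -> (forall m, P (vtop m)) -> forall u, P u.
Proof.
move=> [P0 PL] Pm; elim/extW; elim=> [a m||s IHs t IHt|s IHs].
- by rewrite [tcls _ _]tensE -[_ *: _]addr0; exact: PL.
- exact: P0.
- by rewrite tclsD -[tcls _ s]scale1r; exact: PL.
- by rewrite tclsN -scaleN1r -[_ *: _]addr0; exact: PL.
Qed.

Lemma Verma_xspan u : xspan vtop u.
Proof.
apply: Verma_ind u => [|m]; last exact: xspan_base.
by apply: xspan_submod; [exact: vtopZ|exact: vtop_y].
Qed.

Section Lift.
Variables (U : lmodType DD) (f : M -> U).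
Hypothesis fD : {morph f : m m' / m + m'}.
Hypothesis fZ : forall a m, f (a *: m) = S3_to_D k a *: f m.
Hypothesis fy : forall t m, yD k t *: f m = 0.

(** On generators: g and delta_g act compatibly by [fZ], and a y gives zero on both sides. This is
    the balancing relation of the tensor product. *)
Lemma fbal b m : ge0_to_D k b *: f m = f (ge0_to_S3 k b *: m).
Proof.
have f0 : f 0 = 0 by apply: (addIr (f 0)); rewrite -fD !add0r.
elim/pgenW: b m => [c|[i|t]|b c Eb Ec|b Eb|b c Eb Ec] m.
- by rewrite ge0_to_D_scalar ge0_to_S3_scalar fZ S3_to_D_scalar.
- by rewrite ge0_to_D_gen ge0_to_S3_gen fZ S3_to_D_gen.
- rewrite ge0_to_D_gen ge0_to_S3_gen /= fy scale0r.
  by rewrite f0.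
- by rewrite !rmorphD !scalerDl Eb Ec fD.
- by rewrite !rmorphN !scaleNr Eb; apply: (addIr (f (ge0_to_S3 k b *: m))); rewrite -fD !addNr f0.
- by rewrite !rmorphM -!scalerA Ec Eb.
Qed.

Fixpoint tlift (s : tterm DD (res_mod (ge0_to_S3 k) M)) : U :=
  match s with
  | Tens a m => a *: f m
  | TZero => 0
  | TAdd s t => tlift s + tlift t
  | TOpp s => - tlift s
  end.

Lemma tlift_cong s t : tcong (ge0_to_D k) s t -> tlift s = tlift t.
Proof.
elim=> //=.
- by move=> ? ? ? _ -> _ ->.
- by move=> ? ? ? ? _ -> _ ->.
- by move=> ? ? _ ->.
- by move=> *; rewrite addrA.
- by move=> *; rewrite addrC.
- by move=> *; rewrite add0r.
- by move=> *; rewrite addNr.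
- by move=> *; rewrite scalerDl.
- by move=> *; rewrite fD scalerDr.
- by move=> *; rewrite -scalerA fbal.
Qed.

(** The universal property of the Verma module. The three properties of [f] are arguments, so that
    the linear structure, which depends on them, is inferred from the term. *)
Definition vlift of {morph f : m m' / m + m'} & (forall a m, f (a *: m) = S3_to_D k a *: f m)
    & (forall t m, yD k t *: f m = 0) :=
  fun u : V => tlift (generic_quotient.repr u).
Local Notation phi := (vlift fD fZ fy).

Lemma vliftE s : phi (tcls _ s) = tlift s.
Proof. exact/tlift_cong/repr_tcong. Qed.

Fact vlift_linear : linear phi.
Proof.
move=> a; elim/extW=> s; elim/extW=> t.
rewrite [a *: _]escaleE -tclsD !vliftE /=; congr (_ + _).
elim: s => [b m||s IHs s' IHs'|s IHs] /=.
- by rewrite scalerA.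
- by rewrite scaler0.
- by rewrite scalerDr IHs IHs'.
- by rewrite scalerN IHs.
Qed.
HB.instance Definition _ := GRing.isLinear.Build DD V U _ phi vlift_linear.

Lemma vlift_top m : phi (vtop m) = f m.
Proof. by rewrite [LHS]vliftE /= scale1r. Qed.

End Lift.
End Verma.

(** * Multiplication of words in the Nichols algebra *)

Section QuadraticOperators.
Variables (U : zmodType) (X : nat -> {additive U -> U}).
Local Notation a := (X 0).
Local Notation b := (X 1).
Local Notation c := (X 2).
Implicit Types u : U.
Hypotheses (aa : forall u, a (a u) = 0) (bb : forall u, b (b u) = 0)
  (cc : forall u, c (c u) = 0).
Hypotheses (abc : forall u, a (b u) + c (a u) + b (c u) = 0)
  (acb : forall u, a (c u) + b (a u) + c (b u) = 0).

Let ca u : c (a u) = - a (b u) - b (c u).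
Proof. by apply/eqP; rewrite -opprD -addr_eq0 addrCA addrA abc. Qed.

Let cb u : c (b u) = - a (c u) - b (a u).
Proof. by apply/eqP; rewrite -opprD -addr_eq0 addrC acb. Qed.

(** The braid relation. Put b to the right of cb = -ac - ba: the left side vanishes by bb = 0, and
    acb = -aba by aa = 0. *)
Let bab u : b (a (b u)) = a (b (a u)).
Proof.
have := cb (b u); rewrite bb raddf0 cb raddfB raddfN aa oppr0 add0r opprK.
by move/esym/eqP; rewrite subr_eq0 => /eqP.
Qed.

Definition word u (w : nat) : U :=
  nth 0 [:: u; a u; b u; c u; a (b u); a (c u); b (a u); b (c u); a (b (a u));
    a (b (c u)); b (a (c u)); a (b (a (c u)))] w.

(** The vanishing squares and the rules for ca, cb and bab form a rewriting system. An irreducible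
    word has c at most as its last letter, preceded by one of 1, a, b, ab, ba, aba: these are the
    twelve words. *)
Lemma word_mul t u i : (t < 3)%N -> X t (word u i) = ev (word u) (wmul t i).
Proof.
case: t => [|[|[|//]]] _.
all: do 12?[case: i => [|i]]; rewrite /= ?(ev_cons, ev_nil) /= ?addr0 ?mulr1z ?mulrN1z
  ?(aa, bb, cc) //.
all: rewrite /word /= ?nth_nil; try by rewrite raddf0 /wmul /= nth_nil ev_nil.
all: by rewrite !(ca, cb, aa, bb, cc, bab, raddfN, raddfB, raddf0, oppr0, opprK,
  opprB, add0r, addr0, subr0, sub0r).
Qed.

Lemma word_mul_ev t u (v : fv) : (t < 3)%N ->
  X t (ev (word u) v) = ev (word u) (fapp (wmul t) v).
Proof. by move=> t3; apply: ev_app => i; exact: word_mul. Qed.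

(** The top degree of B(V) is 4: each of the 3^5 words of length five reduces to zero under
    [wmul]. *)
Lemma word_nilpotent (w : seq nat) u :
  size w = 5%N -> all (fun t => t < 3)%N w -> foldr X u w = 0.
Proof.
move=> sw wP.
have -> : foldr X u w = ev (word u) (foldr (fun t v => fapp (wmul t) v) [:: (1, 0%N)] w).
  elim: w wP {sw} => [|t w IH] /=; first by rewrite ev1.
  by case/andP=> t3 wP; rewrite IH // word_mul_ev.
have out i : (12 <= i)%N -> word u i = 0 by move=> i12; rewrite /word nth_default.
rewrite -(ev_nil (word u)); apply: (feqP out).
case: w sw wP => [|t1 [|t2 [|t3 [|t4 [|t5 [|]]]]]] //= _ /and5P[t1P t2P t3P t4P].
rewrite andbT => t5P; pose A (P : pred nat) := all P (iota 0 3).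
have ok : A (fun t1 => A (fun t2 => A (fun t3 => A (fun t4 => A (fun t5 =>
    feq 12 (foldr (fun t v => fapp (wmul t) v) [:: (1, 0%N)] [:: t1; t2; t3; t4; t5]) [::]))))).
  by vm_compute.
have Ap P t : A P -> (t < 3)%N -> P t by move/allP=> AP tP; apply: AP; rewrite mem_iota.
by move: ok => /(Ap _ t1)/(_ t1P)/(Ap _ t2)/(_ t2P)/(Ap _ t3)/(_ t3P)/(Ap _ t4)/(_ t4P)
  /(Ap _ t5)/(_ t5P).
Qed.

End QuadraticOperators.

Section Words.
Variables (k : fieldType) (U : lmodType (DD k)).

Definition xop (t : nat) : {additive U -> U} := *:%R (xD k (tcode t)).

Lemma xop_sq t u : xop t (xop t u) = 0.
Proof. by rewrite /= scalerA DD_xx scale0r. Qed.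

Lemma xop_quad (i j l : 'I_3) : uniq [:: i; j; l] ->
  forall u, xop l (xop j u) + xop i (xop l u) + xop j (xop i u) = 0.
Proof.
move=> ijl u; rewrite /= !scalerA -!scalerDl -(scale0r u); congr (_ *: u).
rewrite -(DD_xxx k ijl).
have E (i' j' l' : 'I_3) : uniq [:: i'; j'; l'] -> tcode l' = transp_of i' j'.
  by move=> ijl'; rewrite -(tcodeK (transp_of i' j')) (tfix_of ijl').
by rewrite (E i j l) // (E i l j) ?(E j l i) //; move: i j l ijl; do 3!elim/I3P.
Qed.

Lemma xword_mul t u i :
  xD k t *: word xop u i = ev (word xop u) (wmul (tfix t) i).
Proof.
rewrite -{1}(tcodeK t); apply: word_mul (tfix_lt t); try by move=> v; exact: xop_sq.
- exact: (@xop_quad pt3 pt2 pt1).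
- exact: (@xop_quad pt2 pt3 pt1).
Qed.

Lemma x_nilpotent (w : seq transp) (u : U) :
  size w = 5%N -> foldr (fun t v => xD k t *: v) u w = 0.
Proof.
move=> sw; have := @word_nilpotent U xop.
move=> /(_ (@xop_sq 0) (@xop_sq 1) (@xop_sq 2) (@xop_quad pt3 pt2 pt1 isT)
  (@xop_quad pt2 pt3 pt1 isT) (map tfix w) u); rewrite size_map => /(_ sw) <-.
  by elim: w {sw} => //= t w ->; rewrite tcodeK.
by apply/allP=> _ /mapP[t _ ->]; exact: tfix_lt.
Qed.

End Words.

(** * Kernels, images and quotients of linear maps *)

Definition sub_intro (R : pzRingType) (U : lmodType R) (N : submodClosed U) u (Nu : u \in N) :
  sub_mod N := exist (fun u => u \in N) u Nu.

Lemma add_submod_sub (R : pzRingType) (U : lmodType R) (N1 N2 : submodClosed U) :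
  {subset N1 <= add_submod N1 N2} /\ {subset N2 <= add_submod N1 N2}.
Proof.
by split=> u Nu; apply/SubmodP; [exists u, 0|exists 0, u]; rewrite ?addr0 ?add0r rpred0.
Qed.

Lemma ker_submod_subproof (R : pzRingType) (U V : lmodType R) (f : {linear U -> V}) :
  is_submod (fun u => f u = 0).
Proof. by split=> [|a u v fu fv]; rewrite ?raddf0 // linearP fu fv scaler0 addr0. Qed.

Definition ker_submod R U V f := Submod (@ker_submod_subproof R U V f).

Lemma im_submod_subproof (R : pzRingType) (U V : lmodType R) (f : {linear U -> V})
  (N : submodClosed U) : is_submod (fun v => exists2 u, u \in N & v = f u).
Proof.
split=> [|a _ _ [u Nu ->] [u' Nu' ->]]; first by exists 0; rewrite ?rpred0 ?raddf0.
by exists (a *: u + u'); rewrite ?linearP // rpredD ?rpredZ.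
Qed.

Definition im_submod R U V f N := Submod (@im_submod_subproof R U V f N).

Lemma preim_submod_subproof (R : pzRingType) (U V : lmodType R) (f : {linear U -> V})
  (N : submodClosed V) : is_submod (fun u => f u \in N).
Proof.
split=> [|a u v Nu Nv]; first by rewrite raddf0 rpred0.
by rewrite linearP rpredD ?rpredZ.
Qed.

Definition preim_submod R U V f N := Submod (@preim_submod_subproof R U V f N).

Lemma linear_bij_inv (R : pzRingType) (U V : lmodType R) (f : {linear U -> V}) (g : V -> U) :
  cancel f g -> cancel g f -> linear g.
Proof. by move=> fK gK a u v; rewrite -{1}[u]gK -{1}[v]gK -linearP fK. Qed.

Lemma quot_iso (R : pzRingType) (U V : lmodType R) (N : submodClosed U) (f : {linear U -> V}) :
  (forall v, exists u, f u = v) -> (forall u, u \in N <-> f u = 0) ->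
  exists g : {linear quot_mod N -> V}, bijective g /\ forall u, g (quot_pi N u) = f u.
Proof.
move=> fsurj Nf; pose g (x : quot_mod N) := f (generic_quotient.repr x).
have gE u : g (quot_pi N u) = f u.
  apply/eqP; rewrite -subr_eq0 -raddfB; apply/eqP/Nf/quot_piP.
  by rewrite /quot_pi generic_quotient.reprK.
have glin : linear g.
  move=> a; elim/quotW_mod=> u; elim/quotW_mod=> v.
  by rewrite [a *: _]quot_scaleE -quot_piD !gE linearP.
pose gL := GRing.isLinear.Build R (quot_mod N) V _ g glin.
pose gl : {linear quot_mod N -> V} := HB.pack g gL.
exists gl; split=> //.
have h v : {x : quot_mod N | g x = v}.
  by apply/cid; have [u <-] := fsurj v; exists (quot_pi N u).
exists (fun v => sval (h v)) => [|v]; last exact: (svalP (h v)).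
elim/quotW_mod=> u; have := svalP (h (g (quot_pi N u))).
elim/quotW_mod: (sval _) => w; rewrite !gE => fwu; apply/quot_piP/Nf.
by rewrite linearB /= fwu subrr.
Qed.

(** * The head of a Verma module with a given simple quotient *)

Section Head.
Variables (k : fieldType) (M : lmodType (DS3 k)) (U : lmodType (DD k)).
Variables (f : M -> U) (p : U -> M).
Hypothesis fD : {morph f : m m' / m + m'}.
Hypothesis fZ : forall a m, f (a *: m) = S3_to_D k a *: f m.
Hypothesis fy : forall t m, yD k t *: f m = 0.
Hypothesis pD : {morph p : u v / u + v}.
Hypothesis px : forall t u, p (xD k t *: u) = 0.
Hypothesis fK : cancel f p.
Hypothesis simpleU : simple_mod U.
Variable m0 : M.
Hypothesis m0_neq0 : m0 != 0.

Local Notation V := (Verma M).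
Local Notation phi := (vlift fD fZ fy).

Let p_sum (v : transp -> U) : p (\sum_t xD k t *: v t) = 0.
Proof.
have p0 : p 0 = 0 by apply: (addIr (p 0)); rewrite -pD !add0r.
by elim/big_ind: _ => [//|u w pu pw|t _]; rewrite ?pD ?pu ?pw ?addr0.
Qed.

(** As [p] retracts [f], the vector [f m0] is nonzero; so the image is a nonzero submodule of a
    simple module. *)
Lemma vlift_surj u : exists v, u = phi v.
Proof.
have tt : is_submod (fun _ : V => True) by split.
pose T := im_submod phi (Submod tt).
have [T0|T1] := simpleU.2 T; last by have /SubmodP[v _ ->] := T1 u; exists v.
have: phi (vtop m0) \in T by apply/SubmodP; exists (vtop m0) => //; exact/SubmodP.
move/T0; rewrite [LHS]vlift_top => f0; case/eqP: m0_neq0.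
by apply: (addIr (p (f m0))); rewrite -{1}[m0]fK -pD f0 !add0r.
Qed.

Lemma ker_vlift_maximal : maximal_submod (ker_submod phi).
Proof.
split.
  exists (vtop m0); apply/SubmodP; rewrite /= vlift_top => f0; case/eqP: m0_neq0.
  by apply: (addIr (p (f m0))); rewrite -{1}[m0]fK -pD f0 !add0r.
move=> N KN; have [T0|T1] := simpleU.2 (im_submod phi N).
  left=> u; apply/idP/idP => [Nu|]; last exact: KN.
  by apply/SubmodP/T0/SubmodP; exists u.
right=> u; have /SubmodP[n Nn fu] := T1 (phi u).
rewrite -(subrK n u) rpredD //; apply/KN/SubmodP.
by rewrite linearB /= fu subrr.
Qed.

Lemma nakayama (N : submodClosed V) :
  (forall u, exists n v, n \in N /\ u = n + \sum_t xD k t *: v t) -> forall u, u \in N.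
Proof.
move=> H.
(* Descending induction on the length of [w]. Applied to [n], the word stays in [N]; applied to x_t
   v it becomes a word with one more letter, appended by [rcons] because the last letter acts
   first. *)
have words m (w : seq transp) : (size w + m)%N = 5%N ->
    forall u, foldr (fun t v => xD k t *: v) u w \in N.
  elim: m w => [|m IH] w; first by rewrite addn0 => sw u; rewrite x_nilpotent ?rpred0.
  move=> sw u; have [n [v [Nn ->]]] := H u.
  have -> : foldr (fun t v => xD k t *: v) (n + \sum_t xD k t *: v t) w
     = foldr (fun t v => xD k t *: v) n w
       + \sum_t foldr (fun t v => xD k t *: v) (v t) (rcons w t).
    elim: w {sw} => [|s w IHw] //=.
    by rewrite IHw scalerDr scaler_sumr.
  rewrite rpredD //; last first.
    by apply: rpred_sum => t _; apply: IH; rewrite size_rcons addSnnS.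
  by elim: w {sw} => //= t w IHw; exact: rpredZ.
exact: (words 5 [::]).
Qed.

Lemma ker_vlift_radical : radical_mod V =i ker_submod phi.
Proof.
move=> u; apply/SubmodP/idP => [|Ku N Nmax]; first by apply; exact: ker_vlift_maximal.
have [NN KN] := add_submod_sub N (ker_submod phi).
have [E|all] := Nmax.2 _ NN; first by rewrite -E; exact: KN.
case: Nmax => -[w Nw] _; case/negP: Nw; apply: nakayama => {}w.
have [m [v ->]] := xspan_split (@vtopD _ _) (Verma_xspan w).
have /SubmodP[n [n' [Nn /SubmodP phin' E]]] := all (vtop m).
have [m' [v' En]] := xspan_split (@vtopD _ _) (Verma_xspan n).
(* The map [p] after [phi] reads off the component in the highest-weight space, and [n] differs from
   [vtop m] by an element of the kernel of [phi]. *)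
have mm' : m' = m.
  have: phi n = f m by rewrite -[RHS](vlift_top fD fZ fy) E linearD /= phin' addr0.
  rewrite En linearD linear_sum; under eq_bigr => t _ do rewrite linearZ.
  rewrite /= vlift_top => /(congr1 p).
  by rewrite pD p_sum fK addr0 fK.
exists n, (fun t => v t - v' t); split=> //.
under [in RHS]eq_bigr => t _ do rewrite scalerBr.
by rewrite big_split /= sumrN En mm' addrACA subrr addr0.
Qed.

Theorem L_simple_iso : exists g : {linear L_simple M -> U}, bijective g.
Proof.
have surj u : exists v, phi v = u by have [v ->] := vlift_surj u; exists v.
have [|g [gbij _]] := quot_iso (N := radical_mod V) surj; last by exists g.
by move=> u; rewrite ker_vlift_radical; split=> [/SubmodP //|fu0]; exact/SubmodP.
Qed.

End Head.

(** * Bases of modules given by tables *)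

Definition tvalid (g : tgen) : bool :=
  match g with tX t | tY t => (t < 3)%N | tG c | tD c => c \in S3c end.

Lemma tvalidP g : tvalid g -> exists i, dcode i = g.
Proof.
case: g => [t|t|c|c] /=.
- by move=> t3; exists (D_x (tcode t)); rewrite /= tfix_tcode.
- by move=> t3; exists (D_ge0 (ge0_y (tcode t))); rewrite /= tfix_tcode.
- by case/code_surj=> g <-; exists (D_ge0 (ge0_S3 (S3_g g))).
- by case/code_surj=> g <-; exists (D_ge0 (ge0_S3 (S3_d g))).
Qed.

Section TableModule.
Variables (n : nat) (tab : tgen -> nat -> fv).
Hypothesis tab_out : forall g i, (n <= i)%N -> tab g i = [::].
Hypothesis tab_ok : table_ok n tab.
Variable k : fieldType.

Definition tmod : lmodType (DD k) := rep_mod (table_rep tab_out tab_ok k).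
Implicit Types (u : tmod) (v : fv).
Definition tb (i : nat) : tmod := tbase n k i.

Lemma tmod_ks c u : kscale c u = c *: (u : tspace n k).
Proof. exact: rep_ks. Qed.

Lemma tmod_gen i u : pgen (@Drel k) i *: u = top_of (tab (dcode i)) u.
Proof. exact: rep_gen. Qed.

Lemma tmod_gen_ev i v : pgen (@Drel k) i *: ev tb v = ev tb (fapp (tab (dcode i)) v).
Proof. by rewrite tmod_gen; exact: top_of_ev. Qed.

Lemma tmod_gen_tb i j : pgen (@Drel k) i *: tb j = ev tb (tab (dcode i) j).
Proof. by rewrite tmod_gen; exact: top_of_base. Qed.

Lemma tmod_feq v w : feq n v w -> ev tb v = ev tb w.
Proof. exact/feqP/tbase0. Qed.

(** The sign [s] and the word [gs] form a certificate, found beforehand, that [w] lies in the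
    submodule generated by [v]. *)
Lemma tmod_word (N : submodClosed tmod) (gs : seq tgen) (s : int) v w :
  all tvalid gs -> feq n (fscale s (foldr (fun g => fapp (tab g)) v gs)) w ->
  ev tb v \in N -> ev tb w \in N.
Proof.
move=> gsP /tmod_feq <- Nv; rewrite ev_scale -ks_int rpredZ //.
elim: gs gsP => //= g gs IH /andP[/tvalidP[i <-] /IH Ngs].
by rewrite -tmod_gen_ev rpredZ.
Qed.

(** The index is a bare natural number: out of range the sum is empty and the coordinate is 0. *)
Definition tcoord (i : nat) u : k := \sum_(j < n | val j == i) (u : {ffun 'I_n -> k^o}) j.

Fact co_additive i : zmod_morphism (tcoord i).
Proof. by move=> u u'; rewrite /tcoord -sumrB; apply: eq_bigr => j _; rewrite !ffunE. Qed.
HB.instance Definition _ i := GRing.isZmodMorphism.Build tmod k (tcoord i) (co_additive i).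

Lemma co_ks i c u : tcoord i (kscale c u) = c * tcoord i u.
Proof. by rewrite tmod_ks /tcoord mulr_sumr; apply: eq_bigr => j _; rewrite ffunE. Qed.

Lemma co_ord (j : 'I_n) u : tcoord j u = (u : {ffun 'I_n -> k^o}) j.
Proof. by rewrite /tcoord (big_pred1 j) // => i; rewrite val_eqE. Qed.

Lemma co_tb i j : tcoord i (tb j) = ((i < n)%N && (i == j))%:R.
Proof.
case: ltnP => [ni|ni]; last first.
  by rewrite /tcoord big_pred0 // => j'; apply: ltn_eqF; exact: leq_trans (ltn_ord j') ni.
by rewrite (co_ord (Ordinal ni)) ffunE.
Qed.

Lemma co_ev i v : (i < n)%N -> tcoord i (ev tb v) = (coef v i)%:~R.
Proof. by move=> ni; rewrite (co_ord (Ordinal ni)); exact: tbase_coord. Qed.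

Lemma tmod_sum u : u = \sum_(i < n) kscale (tcoord i u) (tb i).
Proof.
rewrite {1}[u](tbase_sum (u : tspace n k)); apply: eq_bigr => i _.
by rewrite tmod_ks co_ord.
Qed.

Lemma co_inj u u' : (forall i, (i < n)%N -> tcoord i u = tcoord i u') -> u = u'.
Proof.
by move=> uu'; rewrite [u]tmod_sum [u']tmod_sum; apply: eq_bigr => i _; rewrite uu'.
Qed.

Lemma tmod_gen_sum i u :
  pgen (@Drel k) i *: u = \sum_(j < n) kscale (tcoord j u) (ev tb (tab (dcode i) j)).
Proof.
rewrite {1}[u]tmod_sum scaler_sumr; apply: eq_bigr => j _.
by rewrite ks_scale -[tb j]ev1 tmod_gen_ev /fapp /= cats0 ev_scale.
Qed.

Definition pairing (d : fv) u : k := \sum_(p <- d) p.1%:~R * tcoord p.2 u.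

Fact pairing_additive d : zmod_morphism (pairing d).
Proof. by move=> u u'; rewrite /pairing -sumrB; apply: eq_bigr => p _; rewrite raddfB mulrBr. Qed.
HB.instance Definition _ d := GRing.isZmodMorphism.Build tmod k (pairing d) (pairing_additive d).

Lemma pairing_ks d c u : pairing d (kscale c u) = c * pairing d u.
Proof. by rewrite /pairing mulr_sumr; apply: eq_bigr => p _; rewrite co_ks mulrCA. Qed.

Lemma pairing1 i u : pairing [:: (1, i)] u = tcoord i u.
Proof. by rewrite /pairing big_seq1 mul1r. Qed.

Lemma pairing_ev d v : all (fun p => p.2 < n)%N d -> pairing d (ev tb v) = (dot d v)%:~R.
Proof.
rewrite /pairing; elim: d => [|p d IH] /=; first by rewrite big_nil.
by case/andP=> pn dn; rewrite big_cons IH // co_ev // rmorphD rmorphM.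
Qed.

(** The transposed action: [d] composed with the generator [i] is [d']. It gives coordinates of a
    product for an arbitrary vector from a check on basis vectors. *)
Definition pair_ok i d d' := [&& all (fun p => p.2 < n)%N d, all (fun p => p.2 < n)%N d'
  & all (fun j => dot d (tab i j) == dot d' [:: (1, j)]) (iota 0 n)].

Lemma pairing_gen i d d' u : pair_ok (dcode i) d d' ->
  pairing d (pgen (@Drel k) i *: u) = pairing d' u.
Proof.
case/and3P=> dn d'n /allP dd'; rewrite tmod_gen_sum raddf_sum {2}[u]tmod_sum raddf_sum.
apply: eq_bigr => j _; rewrite /= !pairing_ks pairing_ev // -[tb j]ev1 pairing_ev //.
by congr (_ * _%:~R); apply/eqP/dd'; rewrite mem_iota ltn_ord.
Qed.

Lemma tmod_full (N : submodClosed tmod) :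
  (forall i, (i < n)%N -> tb i \in N) -> forall u, u \in N.
Proof. by move=> Nb u; rewrite [u]tmod_sum rpred_sum // => i _; rewrite rpredZ ?Nb. Qed.

End TableModule.

Lemma S3_semilinear (k : fieldType) (M : lmodType (DS3 k)) (U : lmodType (DD k)) (f : M -> U) :
  {morph f : m m' / m + m'} ->
  (forall c (m : M), f (@kscale k S3gen (@S3rel k) M c m) = @kscale k Dgen (@Drel k) U c (f m)) ->
  (forall i m, f (pgen (@S3rel k) i *: m) = pgen (@Drel k) (D_ge0 (ge0_S3 i)) *: f m) ->
  forall a m, f (a *: m) = S3_to_D k a *: f m.
Proof.
move=> fD fc fg; have f0 : f 0 = 0 by apply: (addIr (f 0)); rewrite -fD !add0r.
elim/pgenW => [c|i|a b Ea Eb|a Ea|a b Ea Eb] m.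
- by rewrite S3_to_D_scalar; exact: fc.
- by rewrite S3_to_D_gen; exact: fg.
- by rewrite raddfD /= !scalerDl fD Ea Eb.
- by rewrite raddfN /= !scaleNr -Ea; apply: (addIr (f (a *: m))); rewrite -fD !addNr.
- by rewrite rmorphM /= -!scalerA Ea Eb.
Qed.

Section ClassMap.
Variables (k : fieldType) (r : 'S_3) (eps : bool) (U : lmodType (DD k)).
Variable b : conj_class r -> U.
Local Notation G g := (pgen (@Drel k) (D_ge0 (ge0_S3 (S3_g g)))).
Local Notation D g := (pgen (@Drel k) (D_ge0 (ge0_S3 (S3_d g)))).
Local Notation ks := (@kscale k Dgen (@Drel k) U).
Hypothesis bG : forall g h, G g *: b h = ks (if eps then sgn k g else 1) (b (class_conj g h)).
Hypothesis bD : forall g h, D g *: b h = if val h == g then b h else 0.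

(** The map prescribed on the kets; [bG] and [bD] require the chosen images to transform as the kets
    do. *)
Definition class_map (m : class_mod k r eps) : U :=
  \sum_h ks ((m : {ffun conj_class r -> k^o}) h) (b h).

Lemma class_mapD : {morph class_map : m m' / m + m'}.
Proof.
move=> m m'; rewrite /class_map -big_split /=; apply: eq_bigr => h _.
by rewrite ffunE ksDl.
Qed.

Lemma class_conjK (g : 'S_3) : cancel (@class_conj r g) (class_conj g^-1%g).
Proof. by move=> h; apply/val_inj; rewrite /= !conjSE conjgK. Qed.

Lemma class_mapZ a m : class_map (a *: m) = S3_to_D k a *: class_map m.
Proof.
apply: S3_semilinear a m => [|c m|[g|d] m]; first exact: class_mapD.
- rewrite /class_map raddf_sum; apply: eq_bigr => h _ /=.
  by rewrite rep_ks ffunE ksA.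
- rewrite rep_gen /class_map scaler_sumr /= (reindex_inj (can_inj (class_conjK g))) /=.
  apply: eq_bigr => h _; rewrite ffunE class_conjK ks_scale bG ksA.
  by congr (ks _ _); rewrite mulrC.
- rewrite rep_gen /class_map scaler_sumr /=; apply: eq_bigr => h _.
  by rewrite ffunE ks_scale bD; case: ifP => _; rewrite ?ks0 ?raddf0.
Qed.

Lemma class_map_ket h : class_map (ket k eps h) = b h.
Proof.
rewrite /class_map (bigD1 h) //= ffunE eqxx ks1 big1 ?addr0 // => j /negPf jh.
by rewrite ffunE jh ks0.
Qed.

End ClassMap.

(** * The simple module L7 *)

Section L7.
Variable k : fieldType.
Hypothesis char0 : [pchar k] =i pred0.
Definition L7 : lmodType (DD k) := tmod ltab_out ltab_ok k.
Implicit Types u : L7.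
Local Notation e i := (tb ltab_out ltab_ok k i).
Local Notation ks := (@kscale k Dgen (@Drel k) L7).
Local Notation G g := (pgen (@Drel k) (D_ge0 (ge0_S3 (S3_g g)))).
Local Notation D g := (pgen (@Drel k) (D_ge0 (ge0_S3 (S3_d g)))).

Lemma natk_neq0 m : m.+1%:R != 0 :> k.
Proof. by rewrite ((pcharf0P k).1 char0). Qed.

(* Signs and words in the generators that carry [e i] to [e 2], respectively [e 2] to [e i]. *)
Definition to2 (i : nat) : int * seq tgen :=
  nth (1, [::]) [:: (1, [::]); (1, [::]); (1, [::]); (1, [:: tG [:: 1; 0; 2]%N]);
    (1, [:: tG [:: 2; 1; 0]%N]); (1, [:: tY 2]); (-1, [:: tY 1])] i.
Definition from2 (i : nat) : int * seq tgen :=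
  nth (1, [::]) [:: (-1, [:: tY 1; tG [:: 1; 0; 2]%N]); (1, [:: tY 0]); (1, [::]);
    (1, [:: tG [:: 1; 0; 2]%N]); (1, [:: tG [:: 2; 1; 0]%N]); (1, [:: tX 2]); (-1, [:: tX 1])] i.

Definition word_ok n tab (w : int * seq tgen) (v v' : fv) :=
  all tvalid w.2 && feq n (fscale w.1 (foldr (fun g => fapp (tab g)) v w.2)) v'.

Lemma L7_gen (N : submodClosed L7) i : (2 <= i < 7)%N -> e i \in N -> forall u, u \in N.
Proof.
move=> i27; rewrite -ev1 => Ni.
have Ne2 : ev (tb ltab_out ltab_ok k) [:: (1, 2%N)] \in N.
  have /allP/(_ i) : all (fun i => word_ok 7 ltab (to2 i) [:: (1, i)] [:: (1, 2%N)]) (iota 2 5).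
    by vm_compute.
  by rewrite mem_iota => /(_ i27)/andP[ok1 ok2]; exact: tmod_word ok1 ok2 Ni.
apply: tmod_full => j j7; rewrite -ev1.
have /allP/(_ j) : all (fun i => word_ok 7 ltab (from2 i) [:: (1, 2%N)] [:: (1, i)]) (iota 0 7).
  by vm_compute.
by rewrite mem_iota => /(_ j7)/andP[ok1 ok2]; exact: tmod_word ok1 ok2 Ne2.
Qed.

Definition ldeg (i : nat) : seq nat :=
  nth [::] [:: [:: 0; 1; 2]; [:: 0; 1; 2]; ctr 0; ctr 1; ctr 2; [:: 1; 2; 0]; [:: 2; 0; 1]]%N i.

Lemma L7_D g u : D g *: u = \sum_(i < 7 | ldeg i == code g) ks (tcoord i u) (e i).
Proof.
rewrite tmod_gen_sum [RHS]big_mkcond; apply: eq_bigr => i _ /=.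
have /allP/(_ _ (code_in g))/allP/(_ i) : all (fun c => all (fun i =>
    ltab (tD c) i == if ldeg i == c then [:: (1, i)] else [::]) (iota 0 7)) S3c.
  by vm_compute.
rewrite mem_iota => /(_ (ltn_ord i))/eqP ->.
by case: ifP => _; rewrite ?ev1 // ev_nil raddf0.
Qed.

Lemma L7_simple : simple_mod L7.
Proof.
split.
  exists (e 0); apply/eqP=> /(congr1 (tcoord 0)); rewrite co_tb raddf0 /=.
  by apply/eqP; exact: oner_neq0.
move=> N; have [[u Nu u0]|N0] := pselect (exists2 u, u \in N & u != 0); last first.
  by left=> u Nu; apply/eqP; apply: contra_notT N0 => u0; exists u.
right.
have main i v : (2 <= i < 7)%N -> v \in N -> tcoord i v != 0 -> forall w, w \in N.
  move=> i27 Nv vi; apply: (L7_gen i27).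
  have [g gE] : exists g, code g = ldeg i.
    apply: code_surj; have /allP/(_ i) : all (fun i => ldeg i \in S3c) (iota 2 5) by [].
    by rewrite mem_iota => /(_ i27).
  have i7 : (i < 7)%N by case/andP: i27.
  (* The basis vectors 2 to 6 have pairwise different degrees, none of them e, so delta_g isolates a
     single coordinate. *)
  have Dv : D g *: v = ks (tcoord i v) (e i).
    rewrite L7_D (big_pred1 (Ordinal i7)) // => j /=; rewrite gE -val_eqE /=.
    have /allP/(_ i) : all (fun i => all (fun j => (ldeg j == ldeg i) == (j == i)) (iota 0 7)) (iota 2 5).
      by [].
    rewrite mem_iota => /(_ i27)/allP/(_ j); rewrite mem_iota => /(_ (ltn_ord j))/eqP.
    by [].
  have <- : ks (tcoord i v)^-1 (D g *: v) = e i by rewrite Dv ksA mulVf // ks1.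
  by rewrite /kscale !rpredZ.
have [/existsP[i /andP[i2 ui]]|] := boolP [exists i : 'I_7, (2 <= i)%N && (tcoord i u != 0)].
  by apply: (main i) Nu ui; rewrite i2 ltn_ord.
rewrite negb_exists => /forallP ui.
have xN t : xD k (tcode t) *: u \in N by exact: rpredZ.
have xc t d : pair_ok 7 ltab (dcode (D_x (tcode t))) [:: (1, (2 + t)%N)] d ->
    tcoord (2 + t) (xD k (tcode t) *: u) = pairing d u.
  by move=> ok; rewrite -(pairing1 (2 + t)); exact: pairing_gen.
have [x0|] := eqVneq (tcoord 2 (xD k (tcode 0) *: u)) 0; last exact: main.
have [x1|] := eqVneq (tcoord 3 (xD k (tcode 1) *: u)) 0; last exact: main.
have [x2|] := eqVneq (tcoord 4 (xD k (tcode 2) *: u)) 0; last exact: main.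
move: x0 x1 x2.
(* Coordinate [2 + t] of x_t u is a linear form in the two coordinates of degree e. The three forms
   are u_0 + 2 u_1, -2 u_0 - u_1 and u_0 - u_1; the first minus the third is 3 u_1, and 3 is
   invertible. *)
rewrite (xc 0 [:: (1, 0%N); (2, 1%N)]); last by rewrite /= tfix_tcode //; vm_compute.
rewrite (xc 1 [:: (-2, 0%N); (-1, 1%N)]); last by rewrite /= tfix_tcode //; vm_compute.
rewrite (xc 2 [:: (1, 0%N); (-1, 1%N)]); last by rewrite /= tfix_tcode //; vm_compute.
rewrite /pairing !big_cons !big_nil /= !addr0 => x0 x1 x2.
case/eqP: u0; apply: co_inj => i i7; rewrite raddf0.
have u1 : tcoord 1 u = 0.
  have /eqP : 3%:R * tcoord 1 u = 0 by rewrite -[RHS](subrr 0) -[X in _ = X - _]x0 -x2; ring.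
  by rewrite mulf_eq0 (negPf (natk_neq0 2)) => /eqP.
case: i i7 => [|[|i]] i7.
- by move: x2; rewrite u1 mulr0 mul1r addr0.
- exact: u1.
- by have := ui (Ordinal i7); rewrite /= negbK => /eqP.
Qed.

End L7.

(** * The highest-weight space of L7 and the module L(e, rho) *)

Section RhoMap.
Variable k : fieldType.
Hypothesis char0 : [pchar k] =i pred0.
Local Notation L7 := (L7 k).
Local Notation Mrho := (M_e_rho k).
Local Notation e i := (tb ltab_out ltab_ok k i).
Local Notation ks := (@kscale k Dgen (@Drel k) L7).
Implicit Types (u : L7) (m : Mrho).

Definition point (i : nat) : 'I_3 := nth pt3 [:: pt1; pt2] i.
Definition rho_coord (i : nat) m : k := (val m : {ffun 'I_3 -> k^o}) (point i).

Lemma rc_additive i : zmod_morphism (rho_coord i).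
Proof. by move=> m m'; rewrite /rho_coord raddfB !ffunE. Qed.
HB.instance Definition _ i := GRing.isZmodMorphism.Build Mrho k (rho_coord i) (rc_additive i).

Lemma rc_sum m : rho_coord 0 m + rho_coord 1 m + rho_coord 2 m = 0.
Proof.
have /SubmodP := valP m; rewrite !big_ord_recl big_ord0 addr0 addrA => <-.
by congr (_ + _ + _); congr ((val m : {ffun 'I_3 -> k^o}) _); apply/val_inj.
Qed.

Lemma rc_inj m m' : rho_coord 0 m = rho_coord 0 m' -> rho_coord 1 m = rho_coord 1 m' -> m = m'.
Proof.
move=> e0 e1; apply/val_inj/ffunP; elim/I3P => //.
change (rho_coord 2 m = rho_coord 2 m').
by apply: (addrI (rho_coord 0 m + rho_coord 1 m)); rewrite rc_sum e0 e1 rc_sum.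
Qed.

Lemma rc_ks i c m : rho_coord i (@kscale k S3gen (@S3rel k) Mrho c m) = c * rho_coord i m.
Proof.
rewrite /rho_coord /kscale linearZ /=.
by have := rep_ks c (val m : rep_mod (nat_rep k)); rewrite /kscale => ->; rewrite ffunE.
Qed.

Lemma rc_G i g m : (i < 3)%N ->
  rho_coord i (pgen (@S3rel k) (S3_g g) *: m) = rho_coord (nth 0%N (cinv (code g)) i) m.
Proof.
move=> i3; rewrite /rho_coord linearZ /= rep_gen /= ffunE -code_inv.
congr ((val m : {ffun 'I_3 -> k^o}) _); apply/val_inj => /=.
have pE (j : 'I_3) : point j = j by elim/I3P: j.
have iE : i = point i :> nat by case: i i3 => [|[|[|]]].
by rewrite {2}iE nth_code pE.
Qed.

Lemma rc_D i d m : rho_coord i (pgen (@S3rel k) (S3_d d) *: m) = if code d == [:: 0; 1; 2]%N then rho_coord i m else 0.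
Proof.
rewrite /rho_coord linearZ /= rep_gen /= -code1 (inj_eq code_inj).
by case: ifP => // _; rewrite ffunE.
Qed.

(** The basis vectors 0 and 1 are the classes of x_(23)|23> - x_(12)|12> and x_(13)|13> -
    x_(12)|12>. As the coordinates of m add up to 0, this is the class of the sum of m_i x_t|t>,
    where t is the transposition fixing the point i. *)
Definition rho_map m : L7 := ks (rho_coord 0 m) (e 0) + ks (rho_coord 1 m) (e 1).

Lemma rho_mapD : {morph rho_map : m m' / m + m'}.
Proof. by move=> m m'; rewrite /rho_map !raddfD /= !ksDl addrACA. Qed.

Lemma rho_mapZ a m : rho_map (a *: m) = S3_to_D k a *: rho_map m.
Proof.
apply: S3_semilinear a m => [|c m|[g|d] m]; first exact: rho_mapD.
- by rewrite /rho_map raddfD /= !ksA !rc_ks.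
- have m2 : rho_coord 2 m = - rho_coord 0 m - rho_coord 1 m.
    by apply: (addrI (rho_coord 0 m + rho_coord 1 m)); rewrite rc_sum; ring.
  (* Read [e j] as p_j - p_2 in the natural permutation module with basis p. Then g sends it to
     p_{gj} - p_{g2}, and subtracting p_2 from both terms gives the formula below, with
     [e' 2 = 0]. *)
  pose e' j := if (j < 2)%N then e j else 0.
  have E j : (j < 2)%N -> pgen (@Drel k) (D_ge0 (ge0_S3 (S3_g g))) *: e j
      = e' (nth 0%N (code g) j) - e' (nth 0%N (code g) 2).
    move=> j2; pose v i : fv := if (i < 2)%N then [:: (1, i)] else [::].
    have Ev i : e' i = ev (tb ltab_out ltab_ok k) (v i).
      by rewrite /e' /v; case: ifP; rewrite ?ev1 ?ev_nil.
    rewrite !Ev -mulrN1z -ev_scale -ev_cat tmod_gen_tb; apply: tmod_feq.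
    have /allP/(_ _ (code_in g))/allP/(_ j) : all (fun c => all (fun j =>
        feq 7 (ltab (tG c) j) (v (nth 0%N c j) ++ fscale (-1) (v (nth 0%N c 2)))) (iota 0 2)) S3c.
      by vm_compute.
    by rewrite mem_iota => /(_ j2).
  rewrite /rho_map !rc_G // scalerDr !ks_scale !E // /e'.
  move: (code g) (code_in g) {E} => c; rewrite !inE => /or4P[|||/or3P[]] /eqP-> /=;
    by apply: co_inj => i _; rewrite ?m2; do 3?[rewrite ?raddfD ?raddfN ?raddf0 ?co_ks /=]; ring.
- have E j : (j < 2)%N -> pgen (@Drel k) (D_ge0 (ge0_S3 (S3_d d))) *: e j
      = if code d == [:: 0; 1; 2]%N then e j else 0.
    move=> j2; rewrite tmod_gen_tb.
    have /allP/(_ _ (code_in d))/allP/(_ j) : all (fun c => all (fun j =>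
        ltab (tD c) j == if c == [:: 0; 1; 2]%N then [:: (1, j)] else [::]) (iota 0 2)) S3c.
      by vm_compute.
    by rewrite mem_iota => /(_ j2)/eqP->; case: ifP; rewrite ?ev1 ?ev_nil.
  rewrite /rho_map !rc_D scalerDr !ks_scale !E //.
  by case: ifP => // _; rewrite !ks0 !raddf0 addr0.
Qed.

Lemma rho_map_y t m : yD k t *: rho_map m = 0.
Proof.
rewrite /rho_map scalerDr !ks_scale !tmod_gen_tb /dcode.
have /allP/(_ (tfix t))  : all (fun t => (ltab (tY t) 0 == [::]) && (ltab (tY t) 1 == [::])) (iota 0 3).
  by vm_compute.
by rewrite mem_iota tfix_lt => /(_ isT)/andP[/eqP-> /eqP->]; rewrite ev_nil !raddf0 addr0.
Qed.

Definition rho_vec (a0 a1 : k) : {ffun 'I_3 -> k^o} := [ffun j => nth (- a0 - a1) [:: a0; a1] (val j)].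

Lemma rho_vec_sum a0 a1 : (rho_vec a0 a1 : rep_mod (nat_rep k)) \in Submod (rho_subproof k).
Proof. by apply/SubmodP; rewrite !big_ord_recl big_ord0 !ffunE /=; ring. Qed.

Definition rho_proj u : Mrho := sub_intro (rho_vec_sum (tcoord 0 u) (tcoord 1 u)).

Lemma rc_rho_proj i u : (i < 2)%N -> rho_coord i (rho_proj u) = tcoord i u.
Proof. by case: i => [|[|//]] _; rewrite /rho_coord /= ffunE. Qed.

Lemma rho_projD : {morph rho_proj : u v / u + v}.
Proof. by move=> u v; apply: rc_inj; rewrite raddfD /= !rc_rho_proj ?raddfD. Qed.

(** The coordinates 0 and 1 belong to the classes of V, the lowest x-degree in L7, and every x_t
    raises that degree. *)
Lemma rho_proj_x t u : rho_proj (xD k t *: u) = 0.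
Proof.
have x0 i : (i < 2)%N -> tcoord i (xD k t *: u) = 0.
  move=> i2; rewrite -(pairing1 i) (pairing_gen (d' := [::])) /pairing ?big_nil //.
  have /allP/(_ (tfix t)) : all (fun t => all (fun i =>
      pair_ok 7 ltab (tX t) [:: (1, i)] [::]) (iota 0 2)) (iota 0 3) by vm_compute.
  by rewrite mem_iota tfix_lt => /(_ isT)/allP/(_ i); rewrite mem_iota => /(_ i2).
by apply: rc_inj; rewrite raddf0 rc_rho_proj ?x0.
Qed.

Lemma rho_mapK : cancel rho_map rho_proj.
Proof.
by move=> m; apply: rc_inj; rewrite rc_rho_proj // raddfD /= !co_ks !co_tb /=
  ?mulr1 ?mulr0 ?addr0 ?add0r.
Qed.

Lemma rho_neq0 : exists m, m != 0.
Proof.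
exists (sub_intro (rho_vec_sum 1 0) : Mrho); apply/eqP=> /(congr1 (rho_coord 0)).
by rewrite raddf0 /rho_coord /= ffunE /=; apply/eqP; exact: oner_neq0.
Qed.

Lemma L_simple_L7 : exists g : {linear L_simple Mrho -> L7}, bijective g.
Proof.
have [m m0] := rho_neq0.
exact: (L_simple_iso rho_mapD rho_mapZ rho_map_y rho_projD rho_proj_x rho_mapK (L7_simple char0) m0).
Qed.

Lemma L7_highest_weight : highest_weight L7 Mrho.
Proof.
pose f : Mrho -> res_mod (S3_to_D k) L7 := rho_map.
have flin : linear f by move=> a m m'; rewrite /f rho_mapD rho_mapZ.
pose fL : {linear Mrho -> res_mod (S3_to_D k) L7} :=
  HB.pack f (GRing.isLinear.Build _ _ _ _ f flin).
have tt : is_submod (fun _ : Mrho => True) by split.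
pose N := im_submod fL (Submod tt).
have fN m : f m \in N by apply/SubmodP; exists m => //; exact/SubmodP.
exists N; split.
- have glin : linear (fun m : Mrho => sub_intro (fN m)).
    by move=> a m m'; apply/val_inj; rewrite linearP /= flin.
  have hP (w : sub_mod N) : {m | f m = val w}.
    by apply/cid; have /SubmodP[m _ ->] := valP w; exists m.
  have fh : cancel (fun w => sval (hP w)) (fun m : Mrho => sub_intro (fN m)).
    by move=> w; apply/val_inj; rewrite /= (svalP (hP w)).
  have hf : cancel (fun m : Mrho => sub_intro (fN m)) (fun w => sval (hP w)).
    by move=> m; apply: (can_inj rho_mapK); rewrite -/f (svalP (hP _)).
  pose gL : {linear Mrho -> sub_mod N} := HB.pack (fun m : Mrho => sub_intro (fN m))
    (GRing.isLinear.Build _ _ _ _ (fun m : Mrho => sub_intro (fN m)) glin).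
  have hlin : linear (fun w => sval (hP w)) := linear_bij_inv (f := gL) hf fh.
  pose hL : {linear sub_mod N -> Mrho} := HB.pack (fun w => sval (hP w))
    (GRing.isLinear.Build _ _ _ _ (fun w => sval (hP w)) hlin).
  exists hL.
  by exists (fun m : Mrho => sub_intro (fN m)).
- by move=> t w /SubmodP[m _ ->]; exact: rho_map_y.
- have [[u u0] gen] := L7_simple char0; move=> w.
  set T := gen_submod _; case: (gen T) => [T0|//].
  have [m m0] := rho_neq0; case/eqP: m0; rewrite -[m]rho_mapK.
  have -> : rho_map m = 0 by apply/T0/SubmodP=> N' NN'; exact/NN'/fN.
  by apply: (addIr (rho_proj 0)); rewrite -rho_projD !add0r.
Qed.

End RhoMap.

(** * L7 as a module over the double of the group algebra *)

Section Decomposition.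
Variable k : fieldType.
Local Notation L7 := (L7 k).
Local Notation e i := (tb ltab_out ltab_ok k i).
Local Notation ks := (@kscale k Dgen (@Drel k) L7).
Local Notation P := (M_e_rho k * M_sigma_p k * M_tau_0 k)%type.

Definition cindex (c : seq nat) : nat := if c == [:: 1; 2; 0]%N then 5 else 6.
Definition tindex (h : conj_class tau3) : nat := cindex (code (val h)).

Lemma tau_code (h : conj_class tau3) : code (val h) \in [:: [:: 1; 2; 0]; [:: 2; 0; 1]]%N.
Proof.
have /imsetP[z _ ->] := valP h; rewrite -conjSE code_conj.
have [c0 _ c2] := code_tperm; rewrite code_comp c0 c2.
by have /allP/(_ _ (code_in z)) : all (fun c => cconj c (ccomp (ctr 2) (ctr 0))
  \in [:: [:: 1; 2; 0]; [:: 2; 0; 1]]%N) S3c.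
Qed.

Lemma tindex_inj : injective tindex.
Proof.
move=> h h'; rewrite /tindex /cindex => E; apply/val_inj/code_inj; move: E.
by have := tau_code h; have := tau_code h'; rewrite !inE => /orP[]/eqP-> /orP[]/eqP->.
Qed.

Lemma tindex_surj i : (5 <= i < 7)%N -> exists h, tindex h = i.
Proof.
have [c0 _ c2] := code_tperm.
have ct : code tau3 = [:: 1; 2; 0]%N by rewrite code_comp c0 c2.
case: i => [|[|[|[|[|[|[|i]]]]]]] // _.
  by exists (class_base tau3); rewrite /tindex /cindex /= ct.
by exists (class_conj sigma3 (class_base tau3)); rewrite /tindex /cindex /= code_conj ct c2.
Qed.

Definition sigma_map : M_sigma_p k -> L7 := class_map (fun t : transp => e (2 + tfix t)).
Definition tau_map : M_tau_0 k -> L7 := class_map (fun h : conj_class tau3 => e (tindex h)).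

Lemma sigma_G (g : 'S_3) (t : transp) :
  pgen (@Drel k) (D_ge0 (ge0_S3 (S3_g g))) *: e (2 + tfix t)
  = ks (if false then sgn k g else 1) (e (2 + tfix (class_conj g t))).
Proof.
rewrite ks1 tmod_gen_tb tfix_conj -ev1; apply: tmod_feq.
have /allP/(_ _ (code_in g))/allP/(_ (tfix t)) : all (fun c => all (fun t =>
  feq 7 (ltab (tG c) (2 + t)) [:: (1, (2 + nth 0%N c t)%N)]) (iota 0 3)) S3c by vm_compute.
by rewrite mem_iota tfix_lt; apply.
Qed.

Lemma sigma_D (g : 'S_3) (t : transp) :
  pgen (@Drel k) (D_ge0 (ge0_S3 (S3_d g))) *: e (2 + tfix t)
  = if val t == g then e (2 + tfix t) else 0.
Proof.
rewrite tmod_gen_tb -(inj_eq code_inj) code_val.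
have /allP/(_ _ (code_in g))/allP/(_ (tfix t)) : all (fun c => all (fun t =>
  ltab (tD c) (2 + t) == if ctr t == c then [:: (1, (2 + t)%N)] else [::]) (iota 0 3)) S3c.
  by vm_compute.
by rewrite mem_iota tfix_lt => /(_ isT)/eqP->; case: ifP; rewrite ?ev1 ?ev_nil.
Qed.

Lemma tau_G (g : 'S_3) (h : conj_class tau3) :
  pgen (@Drel k) (D_ge0 (ge0_S3 (S3_g g))) *: e (tindex h)
  = ks (if false then sgn k g else 1) (e (tindex (class_conj g h))).
Proof.
rewrite ks1 tmod_gen_tb -ev1 /tindex /= code_conj; apply: tmod_feq.
by have /allP/(_ _ (code_in g))/allP/(_ _ (tau_code h)) : all (fun c => all (fun d =>
  feq 7 (ltab (tG c) (cindex d))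
    [:: (1, cindex (cconj c d))])
  [:: [:: 1; 2; 0]; [:: 2; 0; 1]]%N) S3c by vm_compute.
Qed.

Lemma tau_D (g : 'S_3) (h : conj_class tau3) :
  pgen (@Drel k) (D_ge0 (ge0_S3 (S3_d g))) *: e (tindex h)
  = if val h == g then e (tindex h) else 0.
Proof.
rewrite tmod_gen_tb -(inj_eq code_inj) /tindex.
have /allP/(_ _ (code_in g))/allP/(_ _ (tau_code h))/eqP -> : all (fun c => all (fun d =>
  ltab (tD c) (cindex d)
  == if d == c then [:: (1, cindex d)] else [::])
  [:: [:: 1; 2; 0]; [:: 2; 0; 1]]%N) S3c by vm_compute.
by case: (_ == code g); rewrite ?ev1 ?ev_nil.
Qed.

Lemma sigma_mapZ a q : sigma_map (a *: q) = S3_to_D k a *: sigma_map q.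
Proof. exact: (@class_mapZ k sigma3 false L7 _ sigma_G sigma_D). Qed.

Lemma tau_mapZ a n : tau_map (a *: n) = S3_to_D k a *: tau_map n.
Proof. exact: (@class_mapZ k tau3 false L7 _ tau_G tau_D). Qed.

(** In this direction linearity follows from that of the three summands. The inverse reads the
    coordinates 0 and 1, then 2 to 4, then 5 and 6, and is linear because it is an inverse. *)
Definition sum_map (w : P) : res_mod (S3_to_D k) L7 :=
  rho_map w.1.1 + sigma_map w.1.2 + tau_map w.2.

Fact sum_map_linear : linear sum_map.
Proof.
move=> a [[m q] n] [[m' q'] n'].
have Em : rho_map (a *: m + m') = S3_to_D k a *: rho_map m + rho_map m'.
  by rewrite rho_mapD rho_mapZ.
have Eq : sigma_map (a *: q + q') = S3_to_D k a *: sigma_map q + sigma_map q'.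
  by rewrite -sigma_mapZ; exact: class_mapD.
have En : tau_map (a *: n + n') = S3_to_D k a *: tau_map n + tau_map n'.
  by rewrite -tau_mapZ; exact: class_mapD.
change (rho_map (a *: m + m') + sigma_map (a *: q + q') + tau_map (a *: n + n')
  = S3_to_D k a *: (rho_map m + sigma_map q + tau_map n)
    + (rho_map m' + sigma_map q' + tau_map n')).
rewrite Em Eq En; move: (rho_map m) (sigma_map q) (tau_map n) (rho_map m') (sigma_map q')
  (tau_map n') => A B C A' B' C'.
by rewrite !scalerDr [X in X + _ = _]addrACA [LHS]addrACA.
Qed.
HB.instance Definition _ := GRing.isLinear.Build (DS3 k) P (res_mod (S3_to_D k) L7) _
  sum_map sum_map_linear.

Definition sum_inv (u : res_mod (S3_to_D k) L7) : P :=
  (rho_proj u, [ffun t : transp => tcoord (2 + tfix t) (u : L7) : k^o],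
   [ffun h : conj_class tau3 => tcoord (tindex h) (u : L7) : k^o]).

Lemma co_class_map (r : 'S_3) (b : conj_class r -> L7) (m : class_mod k r false) i :
  tcoord i (class_map b m) = \sum_h (m : {ffun conj_class r -> k^o}) h * tcoord i (b h).
Proof. by rewrite raddf_sum; apply: eq_bigr => h _ /=; rewrite co_ks. Qed.

Lemma co_rho_map m i : tcoord i (rho_map m : L7) = if (i < 2)%N then rho_coord i m else 0.
Proof.
rewrite /rho_map raddfD /= !co_ks !co_tb.
by case: i => [|[|i]] /=; rewrite ?mulr1 ?mulr0 ?addr0 ?add0r ?andbF ?mulr0 ?addr0.
Qed.

Lemma co_sigma_map q i : tcoord i (sigma_map q) =
  \sum_(t : transp | i == (2 + tfix t)%N) (q : {ffun transp -> k^o}) t.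
Proof.
rewrite co_class_map [RHS]big_mkcond; apply: eq_bigr => t _; rewrite co_tb.
case: eqP => [->|]; rewrite ?andbF ?mulr0 //.
by rewrite (_ : (_ < 7)%N) ?mulr1 //; have := tfix_lt t; case: (tfix t) => [|[|[|]]].
Qed.

Lemma co_tau_map n i : tcoord i (tau_map n) =
  \sum_(h : conj_class tau3 | i == tindex h) (n : {ffun conj_class tau3 -> k^o}) h.
Proof.
rewrite co_class_map [RHS]big_mkcond; apply: eq_bigr => t _; rewrite co_tb.
case: eqP => [->|]; rewrite ?andbF ?mulr0 //.
by rewrite (_ : (_ < 7)%N) ?mulr1 // /tindex /cindex; case: ifP.
Qed.

Lemma tindex_ge h : (5 <= tindex h)%N. Proof. by rewrite /tindex /cindex; case: ifP. Qed.

Lemma co_sum_map i m q n : tcoord i (sum_map (m, q, n) : L7) =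
  (if (i < 2)%N then rho_coord i m else 0)
  + \sum_(t : transp | i == (2 + tfix t)%N) (q : {ffun transp -> k^o}) t
  + \sum_(h : conj_class tau3 | i == tindex h) (n : {ffun conj_class tau3 -> k^o}) h.
Proof.
rewrite -co_rho_map -co_sigma_map -co_tau_map /sum_map [LHS]raddfD.
by congr (_ + _); exact: raddfD.
Qed.

Lemma sum_mapK : cancel sum_map sum_inv.
Proof.
case=> [[m q] n]; rewrite /sum_inv; congr (_, _, _).
- apply: rc_inj; rewrite rc_rho_proj // co_sum_map /=;
  rewrite !big_pred0 ?addr0 // => h; apply: ltn_eqF => //; exact: leq_trans (tindex_ge h).
- apply/ffunP=> t; rewrite ffunE co_sum_map /=.
  rewrite add0r (big_pred1 t) => [|s]; last by rewrite eqn_add2l (inj_eq tfix_inj) eq_sym.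
  rewrite big_pred0 ?addr0 // => h; apply: ltn_eqF; apply: leq_trans (tindex_ge h).
  exact: tfix_lt.
- apply/ffunP=> h; rewrite ffunE co_sum_map /=.
  rewrite ltnNge (leq_trans _ (tindex_ge h)) // add0r big_pred0 => [|t]; last first.
    rewrite eq_sym; apply: ltn_eqF; apply: leq_trans (tindex_ge h); exact: tfix_lt.
  by rewrite add0r (big_pred1 h) // => h'; rewrite (inj_eq tindex_inj) eq_sym.
Qed.

Lemma sum_invK : cancel sum_inv sum_map.
Proof.
move=> u; apply: co_inj => i i7.
rewrite co_sum_map.
case: (ltnP i 2) => i2.
  rewrite rc_rho_proj // !big_pred0 ?addr0 // => h; apply: ltn_eqF.
    by apply: leq_trans (tindex_ge h); exact: leq_trans i2 _.
  exact: leq_trans i2 _.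
rewrite add0r; case: (ltnP i 5) => i5.
  have i3 : (i - 2 < 3)%N by rewrite ltn_subLR.
  rewrite (big_pred1 (tcode (i - 2))) => [|s].
    rewrite ffunE tfix_tcode // subnKC // big_pred0 ?addr0 // => h; apply: ltn_eqF.
    exact: leq_trans (tindex_ge h).
  by rewrite /= -(inj_eq tfix_inj) tfix_tcode // -(eqn_add2l 2 (tfix s)) subnKC // eq_sym.
rewrite big_pred0 => [|t]; last first.
  by rewrite eq_sym; apply: ltn_eqF; apply: leq_trans i5; exact: tfix_lt.
have [h hi] : exists h, tindex h = i by apply: tindex_surj; rewrite i5.
rewrite add0r (big_pred1 h) ?ffunE ?hi // => h'.
by rewrite -hi (inj_eq tindex_inj) eq_sym.
Qed.

End Decomposition.

(** * The Verma module of weight (sigma, -) *)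

Definition letters (w : nat) : seq nat :=
  nth [::] [:: [::]; [:: 0]; [:: 1]; [:: 2]; [:: 0; 1]; [:: 0; 2]; [:: 1; 0]; [:: 1; 2];
    [:: 0; 1; 0]; [:: 0; 1; 2]; [:: 1; 0; 2]; [:: 0; 1; 0; 2]]%N w.

Lemma word_letters (U : zmodType) (X : nat -> {additive U -> U}) u w :
  (w < 12)%N -> word X u w = foldr X u (letters w).
Proof. by do 12?[case: w => [//|w]]. Qed.

Lemma word_out (U : zmodType) (X : nat -> {additive U -> U}) u w :
  (12 <= w)%N -> word X u w = 0.
Proof. by move=> w12; rewrite /word nth_default. Qed.

Section VermaSigma.
Variable k : fieldType.
Local Notation V := (Verma (M_sigma_m k)).
Local Notation X := (tmod vtab_out vtab_ok k).
Local Notation e i := (tb vtab_out vtab_ok k i).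
Local Notation ksX := (@kscale k Dgen (@Drel k) X).
Local Notation ksV := (@kscale k Dgen (@Drel k) V).

Definition top_map : M_sigma_m k -> X := class_map (fun t : transp => e (tfix t)).

Lemma top_G (g : 'S_3) (t : transp) :
  pgen (@Drel k) (D_ge0 (ge0_S3 (S3_g g))) *: e (tfix t)
  = ksX (if true then sgn k g else 1) (e (tfix (class_conj g t))).
Proof.
rewrite sgnE ks_int tmod_gen_tb tfix_conj -ev1 -ev_scale; apply: tmod_feq.
have /allP/(_ _ (code_in g))/allP/(_ (tfix t)) : all (fun c => all (fun t =>
  feq 36 (vtab (tG c) t) (fscale (csgn c) [:: (1, (nth 0%N c t)%N)])) (iota 0 3)) S3c.
  by vm_compute.
by rewrite mem_iota tfix_lt; apply.
Qed.

Lemma top_D (g : 'S_3) (t : transp) :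
  pgen (@Drel k) (D_ge0 (ge0_S3 (S3_d g))) *: e (tfix t) = if val t == g then e (tfix t) else 0.
Proof.
rewrite tmod_gen_tb -(inj_eq code_inj) code_val.
have /allP/(_ _ (code_in g))/allP/(_ (tfix t)) : all (fun c => all (fun t =>
  vtab (tD c) t == if ctr t == c then [:: (1, t)] else [::]) (iota 0 3)) S3c by vm_compute.
by rewrite mem_iota tfix_lt => /(_ isT)/eqP->; case: ifP; rewrite ?ev1 ?ev_nil.
Qed.

Lemma top_mapD : {morph top_map : m m' / m + m'}.
Proof. exact: class_mapD. Qed.

Lemma top_mapZ a m : top_map (a *: m) = S3_to_D k a *: top_map m.
Proof. exact: (@class_mapZ k sigma3 true X _ top_G top_D). Qed.

Lemma top_map_y t m : yD k t *: top_map m = 0.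
Proof.
rewrite /top_map /class_map scaler_sumr big1 // => s _; rewrite ks_scale tmod_gen_tb.
have /allP/(_ (tfix t)) : all (fun t => all (fun s => vtab (tY t) s == [::]) (iota 0 3)) (iota 0 3).
  by vm_compute.
rewrite mem_iota tfix_lt => /(_ isT)/allP/(_ (tfix s)); rewrite mem_iota tfix_lt.
by move=> /(_ isT)/eqP->; rewrite ev_nil raddf0.
Qed.

Definition vX : V -> X := vlift top_mapD top_mapZ top_map_y.
HB.instance Definition _ := GRing.Linear.on vX.

Lemma vX_vket t : vX (vket k true t) = e (tfix t).
Proof. by rewrite /vX [LHS]vlift_top; exact: class_map_ket. Qed.

Lemma vX_ks c u : vX (ksV c u) = ksX c (vX u).
Proof. exact: linearZ. Qed.

Definition vword (t : transp) (w : nat) : V := word (@xop k V) (vket k true t) w.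

Lemma vX_vword t w : (w < 12)%N -> vX (vword t w) = e (3 * w + tfix t).
Proof.
move=> w12; rewrite /vword word_letters //.
have -> : vX (foldr (@xop k V) (vket k true t) (letters w))
    = foldr (@xop k X) (e (tfix t)) (letters w).
  by elim: (letters w) => [|s l IH] /=; rewrite ?vX_vket // -IH; exact: linearZ.
have lP : all (fun s => s < 3)%N (letters w) by move: w12; do 12?[case: w => [//|w]].
have -> : foldr (@xop k X) (e (tfix t)) (letters w)
    = ev (tb vtab_out vtab_ok k)
        (foldr (fun s => fapp (vtab (tX s))) [:: (1, tfix t)] (letters w)).
  elim: (letters w) lP => [|s l IH] /=; first by rewrite ev1.
  by case/andP=> s3 /IH ->; rewrite tmod_gen_ev /= tfix_tcode.
rewrite -[RHS]ev1; apply: tmod_feq.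
have /allP/(_ w) : all (fun w => all (fun t => feq 36
    (foldr (fun s => fapp (vtab (tX s))) [:: (1, t)] (letters w)) [:: (1, (3 * w + t)%N)])
    (iota 0 3)) (iota 0 12) by vm_compute.
by rewrite mem_iota => /(_ w12)/allP; apply; rewrite mem_iota tfix_lt.
Qed.

(** The candidate inverse of [vX], sending each basis vector to the corresponding word applied to
    some |t>. That it is a left inverse expresses that these words span, and that it is a right
    inverse, that they go to the basis. *)
Definition vrecon (v : X) : V := \sum_(i < 36) ksV (tcoord i v) (vword (tcode (i %% 3)) (i %/ 3)).

Fact vrecon_additive : zmod_morphism vrecon.
Proof.
move=> u v; rewrite /vrecon -sumrB; apply: eq_bigr => i _.
by rewrite raddfB ksDl /kscale scaleNr scaleNr.
Qed.
HB.instance Definition _ := GRing.isZmodMorphism.Build X V vrecon vrecon_additive.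

Lemma vrecon_ks c v : vrecon (ksX c v) = ksV c (vrecon v).
Proof.
by rewrite /vrecon raddf_sum; apply: eq_bigr => i _ /=; rewrite co_ks ksA.
Qed.

Lemma vrecon_tb i : (i < 36)%N -> vrecon (e i) = vword (tcode (i %% 3)) (i %/ 3).
Proof.
move=> i36; rewrite /vrecon (bigD1 (Ordinal i36)) //= co_tb eqxx i36 ks1 big1 ?addr0 // => j.
by rewrite -val_eqE /= co_tb ltn_ord => /negPf ->; rewrite ks0.
Qed.

Lemma vXK : cancel vX vrecon.
Proof.
have Pw t w : vrecon (vX (vword t w)) = vword t w.
  case: (ltnP w 12) => w12; last by rewrite /vword word_out // !raddf0.
  have t3 := tfix_lt t.
  have Em : ((3 * w + tfix t) %% 3)%N = tfix t by rewrite mulnC modnMDl modn_small.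
  have Ed : ((3 * w + tfix t) %/ 3)%N = w by rewrite mulnC divnMDl // divn_small // addn0.
  have i36 : (3 * w + tfix t < 36)%N.
    by apply: (@leq_trans (3 * w + 3)); rewrite ?ltn_add2l // -mulnSr (@leq_mul2l 3 _ 12).
  by rewrite (vX_vword _ w12) (vrecon_tb i36) Em Ed tcodeK.
have PD u v : vrecon (vX u) = u -> vrecon (vX v) = v -> vrecon (vX (u + v)) = u + v.
  by move=> Pu Pv; rewrite !raddfD /= Pu Pv.
have Pk c u : vrecon (vX u) = u -> vrecon (vX (ksV c u)) = ksV c u.
  by move=> Pu; rewrite vX_ks vrecon_ks Pu.
have Psum (I : Type) (r : seq I) (F : I -> V) :
    (forall i, vrecon (vX (F i)) = F i) -> vrecon (vX (\sum_(i <- r) F i)) = \sum_(i <- r) F i.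
  by move=> PF; rewrite !raddf_sum; apply: eq_bigr => i _; exact: PF.
(* In the case of x_t, the induction hypothesis writes [u] as a combination of words, and
   [xword_mul] turns x_t times a word into such a combination again. *)
move=> u; elim: (Verma_xspan u) => [m|{}u v _ Pu _ Pv|t {}u _ Pu]; last 1 first.
- rewrite -Pu /vrecon scaler_sumr; apply: (Psum) => i; rewrite ks_scale; apply: (Pk).
  rewrite xword_mul; apply: (Psum) => p; rewrite -ks_int; apply: (Pk).
  exact: Pw.
- have -> : vtop m = \sum_h ksV ((m : {ffun conj_class sigma3 -> k^o}) h) (vket k true h).
    have {1}-> : m = \sum_h @kscale k S3gen (@S3rel k) (M_sigma_m k)
        ((m : {ffun conj_class sigma3 -> k^o}) h) (ket k true h).
      apply/ffunP=> j; rewrite sum_ffunE (bigD1 j) //= big1 ?addr0 => [|i /negPf ij].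
        by rewrite rep_ks !ffunE eqxx [RHS]mulr1.
      by rewrite rep_ks !ffunE eq_sym ij scaler0.
    elim/big_ind2: _ => [|a b a' b' <- <-|h _]; last 1 first.
    - by rewrite /kscale vtopZ S3_to_D_scalar.
    - by apply: (addIr (vtop 0)); rewrite -vtopD !add0r.
    - exact: vtopD.
  by apply: (Psum) => h; apply: (Pk); have := Pw h 0%N.
- exact: PD.
Qed.

Lemma vreconK : cancel vrecon vX.
Proof.
move=> v; rewrite [in RHS](tmod_sum v) /vrecon raddf_sum; apply: eq_bigr => i _ /=.
rewrite vX_ks vX_vword; last by rewrite ltn_divLR // ltn_ord.
by rewrite tfix_tcode ?ltn_mod // mulnC -divn_eq.
Qed.

Lemma vX_inj : injective vX.
Proof. exact: can_inj vXK. Qed.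

End VermaSigma.

(** Any nonzero submodule of [S] contains [S], so [S] is simple. Conversely a simple [N] has the
    nonzero submodule [S] inside it, so it equals [S]. *)
Lemma socle_unique (R : pzRingType) (U : lmodType R) (S : submodClosed U) :
  (exists2 u, u \in S & u != 0) ->
  (forall N : submodClosed U, (exists2 u, u \in N & u != 0) -> {subset S <= N}) ->
  socle_mod U =i S.
Proof.
move=> [s Ss s0] minS.
have val_neq0 (N : submodClosed U) (w : sub_mod N) : w != 0 -> val w != 0.
  by apply: contra => /eqP vw; apply/eqP/val_inj; rewrite vw raddf0.
have sub_sub (N : submodClosed U) (N' : submodClosed (sub_mod N)) :
    is_submod (fun u => exists2 w : sub_mod N, w \in N' & u = val w).
  split=> [|a _ _ [w Nw ->] [w' Nw' ->]]; first by exists 0; rewrite ?rpred0 ?raddf0.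
  by exists (a *: w + w'); rewrite ?linearP // rpredD ?rpredZ.
have simpleS : simple_mod (sub_mod S).
  split; first by exists (sub_intro Ss); apply: contra s0 => /eqP/(congr1 val) /= ->.
  move=> N; have [[w Nw w0]|N0] := pselect (exists2 w, w \in N & w != 0); last first.
    by left=> w Nw; apply/eqP; apply: contra_notT N0 => w0; exists w.
  right=> v; suff /SubmodP[v' Nv' /val_inj -> //] : val v \in Submod (sub_sub S N).
  apply: minS (valP v); exists (val w); first by apply/SubmodP; exists w.
  exact: val_neq0.
move=> u; apply/SubmodP/idP => [|Su N]; last by apply; exists S.
apply=> w [N [[[n n0] simN] Nw]].
have SN : {subset S <= N} by apply: minS; exists (val n); [exact: valP|exact: val_neq0].
have [T0|T1] := simN (restr_submod S N); last by have /SubmodP := T1 (sub_intro Nw).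
case/eqP: s0; rewrite -[s]/(val (sub_intro (SN s Ss))) (T0 (sub_intro (SN s Ss))) ?raddf0 //.
exact/SubmodP.
Qed.

(** * The socle of the Verma module of weight (sigma, -) *)

Section Socle.
Variable k : fieldType.
Local Notation V := (Verma (M_sigma_m k)).
Local Notation X := (tmod vtab_out vtab_ok k).
Local Notation E := (tb vtab_out vtab_ok k).
Local Notation e i := (E i).
Local Notation ks := (@kscale k Dgen (@Drel k) X).
Implicit Types u : X.

(* Basis vectors of index at least [level_start d] are those of degree at least [d] in the x's. *)
Definition level_start (d : nat) : nat := nth 36 [:: 0; 3; 12; 24; 33]%N d.

Lemma thr_le d : (d < 4)%N -> (level_start d.+1 <= 33)%N.
Proof. by case: d => [|[|[|[|]]]]. Qed.

(* For [raise w] = [(t, w')], the basis word [w'] occurs in [x_t w''] for [w'' = w] only,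
   where its coefficient is [raise_sign w]. *)
Definition raise (w : nat) : nat * nat :=
  nth (0, 0)%N [:: (0, 1); (1, 6); (0, 4); (0, 5); (1, 8); (1, 10); (0, 8); (0, 9); (2, 11);
    (1, 11); (0, 11)]%N w.
Definition raise_sign (w : nat) : int := if w == 8%N then -1 else 1.

Lemma co_gen i j u : (j < 36)%N -> tcoord j (pgen (@Drel k) i *: u) =
  \sum_(h < 36) tcoord h u * (coef (vtab (dcode i) h) j)%:~R.
Proof.
by move=> j36; rewrite tmod_gen_sum raddf_sum; apply: eq_bigr => h _; rewrite /= co_ks co_ev.
Qed.

Lemma socle_top_vector (N : submodClosed X) : (exists2 u, u \in N & u != 0) ->
  exists2 u, u \in N & u != 0 /\ (forall i, (i < 33)%N -> tcoord i u = 0).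
Proof.
(* Here [d] bounds from below the x-degrees occurring in [u], and [m] is the distance from [d] to
   the top degree 4. *)
suff main m d u : (d + m = 4)%N -> u \in N -> u != 0 -> (forall i, (i < level_start d)%N -> tcoord i u = 0) ->
    exists2 u, u \in N & u != 0 /\ (forall i, (i < 33)%N -> tcoord i u = 0).
  by case=> u Nu u0; apply: (main 4 0 u).
elim: m d u => [|m IH] d u dm Nu u0 ud.
  by exists u => //; split=> //; rewrite -[d]addn0 dm in ud.
have [ud1|] := pselect (forall i, (i < level_start d.+1)%N -> tcoord i u = 0).
  by apply: (IH d.+1 u) => //; rewrite addSnnS.
move=> /existsNP[i /not_implyP[id1 /eqP ui]].
have di : (level_start d <= i)%N by rewrite leqNgt; apply: contra_neqN ui => /ud.
have d4 : (d < 4)%N by rewrite -dm addnS ltnS leq_addr.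
have i33 : (i < 33)%N.
  exact: leq_trans id1 (thr_le d4).
pose s := raise_sign (i %/ 3); pose t := (raise (i %/ 3)).1.
pose i' := (3 * (raise (i %/ 3)).2 + i %% 3)%N.
have /allP/(_ i) : all (fun i => let: (t, w) := raise (i %/ 3) in
    [&& (t < 3)%N, (3 * w + i %% 3 < 36)%N & pair_ok 36 vtab (tX t)
      [:: (1, (3 * w + i %% 3)%N)] [:: (raise_sign (i %/ 3), i)]]) (iota 0 33).
  by vm_compute.
rewrite mem_iota => /(_ i33); rewrite (surjective_pairing (raise _)).
rewrite -/t -/s -/i' => /and3P[t3 i'36 ok].
(* A nonzero coordinate of lowest degree cannot cancel: only the basis vector [i] contributes to the
   coordinate [i'] of x_t u, with coefficient 1 or -1. *)
have xu : tcoord i' (xD k (tcode t) *: u) = s%:~R * tcoord i u.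
  rewrite -pairing1 (pairing_gen (d' := [:: (s, i)])) /=; last by rewrite tfix_tcode.
  by rewrite /pairing big_seq1.
apply: (IH d.+1 (xD k (tcode t) *: u)); first by rewrite addSnnS.
- exact: rpredZ.
- apply: contra_neq ui => xu0; move: xu; rewrite xu0 raddf0 => /esym/eqP.
  rewrite mulf_eq0 => /orP[|/eqP //]; rewrite /s /raise_sign.
  by case: ifP => _; rewrite ?rmorphN ?oppr_eq0 oner_eq0.
move=> j jd1.
have j36 : (j < 36)%N.
  exact: leq_trans (leq_trans jd1 (thr_le d4)) _.
rewrite co_gen // big1 // => h _; case: (ltnP h (level_start d)) => hd; first by rewrite ud ?mul0r.
have /allP/(_ d) : all (fun d => all (fun t => all (fun h => (level_start d <= h)%N ==>
    all (fun j => coef (vtab (tX t) h) j == 0) (iota 0 (level_start d.+1))) (iota 0 36)) (iota 0 3)) (iota 0 4).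
  by vm_compute.
rewrite mem_iota => /(_ d4)/allP/(_ t); rewrite mem_iota => /(_ t3)/allP/(_ h).
rewrite mem_iota => /(_ (ltn_ord h)); rewrite hd => /allP/(_ j); rewrite mem_iota => /(_ jd1).
by rewrite /= tfix_tcode // => /eqP->; rewrite mulr0.
Qed.

(* Signs and words in the generators that carry [e 33] to the vectors of [fS]. *)
Definition fS_words : seq (int * seq tgen) :=
  let r1 := tG [:: 1; 2; 0]%N in let r2 := tG [:: 2; 0; 1]%N in
  [:: (1, [:: tY 1; tY 0; r1]); (1, [:: tY 1; tY 0; r2]); (1, [:: tY 2; tY 1]);
      (1, [:: tY 0; r1]); (-1, [:: tY 2; r1]); (-1, [:: tY 0; r2]); (1, [:: tY 1; r2]);
      (1, [::]); (1, [:: r1]); (1, [:: r2])].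

Lemma socle_generated (N : submodClosed X) : (exists2 u, u \in N & u != 0) ->
  forall j, (j < 10)%N -> ev E (nth [::] fS j) \in N.
Proof.
move=> /socle_top_vector[u Nu [u0 ud]] j j10.
have [h h3 uh] : exists2 h, (h < 3)%N & tcoord (33 + h) u != 0.
  have [[h h3 uh]|none] := pselect (exists2 h, (h < 3)%N & tcoord (33 + h) u != 0); first by exists h.
  case/eqP: u0; apply: co_inj => i i36; rewrite raddf0; case: (ltnP i 33) => [|i33]; first exact: ud.
  apply/eqP; apply: contra_notT none => ui; exists (i - 33)%N; last by rewrite subnKC.
  by rewrite ltn_subLR.
have [g gE] : exists g, code g = ctr h.
  by apply: code_surj; have /allP/(_ h) : all (fun h => ctr h \in S3c) (iota 0 3) by []; rewrite mem_iota; apply.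
(* The top word abac has degree e, because aba and c have the same degree. So the three top vectors
   keep the distinct degrees of the |t>, and delta_g singles one out. *)
have Dv : pgen (@Drel k) (D_ge0 (ge0_S3 (S3_d g))) *: u = ks (tcoord (33 + h) u) (e (33 + h)).
  apply: co_inj => i i36; rewrite co_gen // co_ks co_tb i36 /=.
  have h36 : (33 + h < 36)%N by rewrite (ltn_add2l 33 h 3).
  rewrite (bigD1 (Ordinal h36)) //= big1 => [|l].
    rewrite addr0 gE; congr (_ * _).
    have /allP/(_ h) : all (fun h => all (fun i => coef (vtab (tD (ctr h)) (33 + h)) i
        == Posz (i == 33 + h)%N) (iota 0 36)) (iota 0 3) by vm_compute.
    rewrite mem_iota => /(_ h3)/allP/(_ i); rewrite mem_iota => /(_ i36)/eqP->.
    by case: eqP.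
  rewrite -val_eqE /= => lh; case: (ltnP l 33) => l33; first by rewrite ud ?mul0r.
  have /allP/(_ h) : all (fun h => all (fun l => (l != 33 + h)%N ==>
      all (fun i => coef (vtab (tD (ctr h)) l) i == 0) (iota 0 36)) (iota 33 3)) (iota 0 3).
    by vm_compute.
  rewrite mem_iota => /(_ h3)/allP/(_ l); rewrite mem_iota l33 ltn_ord => /(_ isT).
  rewrite lh => /allP/(_ i); rewrite mem_iota => /(_ i36); rewrite gE => /eqP->.
  by rewrite mulr0.
have Nh : e (33 + h) \in N.
  have <- : ks (tcoord (33 + h) u)^-1 (pgen (@Drel k) (D_ge0 (ge0_S3 (S3_d g))) *: u) = e (33 + h).
    by rewrite Dv ksA mulVf // ks1.
  by rewrite /kscale !rpredZ.
have N33 : ev E [:: (1, 33%N)] \in N.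
  pose gs := nth [::] [:: [::]; [:: tG [:: 2; 0; 1]%N]; [:: tG [:: 1; 2; 0]%N]] h.
  have /allP/(_ h) : all (fun h =>
      let gs := nth [::] [:: [::]; [:: tG [:: 2; 0; 1]%N]; [:: tG [:: 1; 2; 0]%N]] h in
      all tvalid gs && feq 36 (fscale 1 (foldr (fun g => fapp (vtab g)) [:: (1, (33 + h)%N)] gs))
        [:: (1, 33%N)]) (iota 0 3) by vm_compute.
  rewrite mem_iota => /(_ h3)/andP[ok1 ok2]; apply: tmod_word ok1 ok2 _.
  by rewrite ev1.
have /allP/(_ j) : all (fun j => let: (s, gs) := nth (1, [::]) fS_words j in
    all tvalid gs && feq 36 (fscale s (foldr (fun g => fapp (vtab g)) [:: (1, 33%N)] gs))
      (nth [::] fS j)) (iota 0 10) by vm_compute.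
rewrite mem_iota => /(_ j10); case: (nth _ fS_words j) => s gs /andP[ok1 ok2].
exact: tmod_word ok1 ok2 N33.
Qed.

End Socle.

(** * The quotient VQN / S *)

Section Span.
Variable k : fieldType.
Hypothesis char0 : [pchar k] =i pred0.
Local Notation X := (tmod vtab_out vtab_ok k).
Local Notation E := (tb vtab_out vtab_ok k).
Local Notation ks := (@kscale k Dgen (@Drel k) X).
Local Notation L7 := (L7 k).
Local Notation EL := (tb ltab_out ltab_ok k).
Local Notation ksL := (@kscale k Dgen (@Drel k) L7).
Implicit Types u : X.

Definition fspan (fs : seq fv) u : Prop :=
  exists c : nat -> k, u = \sum_(j < size fs) ks (c j) (ev E (nth [::] fs j)).

Lemma intk_neq0 (z : int) : z != 0 -> z%:~R != 0 :> k.
Proof.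
case: z => [[|m]|m] // _; first exact: natk_neq0.
by rewrite NegzE rmorphN oppr_eq0; exact: natk_neq0.
Qed.

Lemma fspan_mem fs f : f \in fs -> fspan fs (ev E f).
Proof.
move=> ffs; exists (fun j => (j == index f fs)%:R).
have fi : (index f fs < size fs)%N by rewrite index_mem.
rewrite (bigD1 (Ordinal fi)) //= eqxx ks1 nth_index // big1 ?addr0 // => j.
by rewrite -val_eqE /= => /negPf ->; rewrite ks0.
Qed.

Lemma fspanD fs u u' : fspan fs u -> fspan fs u' -> fspan fs (u + u').
Proof.
move=> [c ->] [c' ->]; exists (fun j => c j + c' j).
by rewrite -big_split; apply: eq_bigr => j _ /=; rewrite ksDl.
Qed.

Lemma fspan_ks fs a u : fspan fs u -> fspan fs (ks a u).
Proof.
move=> [c ->]; exists (fun j => a * c j).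
by rewrite raddf_sum; apply: eq_bigr => j _ /=; rewrite ksA.
Qed.

Lemma fspan0 fs : fspan fs 0.
Proof. by exists (fun=> 0); rewrite big1 // => j _; rewrite ks0. Qed.

Lemma fspan_ind (P : X -> Prop) fs :
  P 0 -> (forall u u', P u -> P u' -> P (u + u')) -> (forall c u, P u -> P (ks c u)) ->
  (forall f, f \in fs -> P (ev E f)) -> forall u, fspan fs u -> P u.
Proof.
move=> P0 PD Pk Pf _ [c ->]; elim/big_ind: _ => [|u u'|j _] //; first exact: PD.
by apply: (Pk); apply/Pf/mem_nth.
Qed.

Lemma fspan_sub fs gs u : {subset fs <= gs} -> fspan fs u -> fspan gs u.
Proof.
move=> fg; apply: fspan_ind; [exact: fspan0|exact: fspanD|exact: fspan_ks|].
by move=> f /fg; exact: fspan_mem.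
Qed.

Lemma fspan_cat fs gs u : fspan (fs ++ gs) u ->
  exists u1 u2, [/\ fspan fs u1, fspan gs u2 & u = u1 + u2].
Proof.
move: u; apply: fspan_ind => [|_ _ [u1 [u2 [f1 g2 ->]]] [v1 [v2 [f1' g2' ->]]]|c _ [u1 [u2 [f1 g2 ->]]]|f].
- by exists 0, 0; split; rewrite ?addr0 //; exact: fspan0.
- by exists (u1 + v1), (u2 + v2); split; [exact: fspanD|exact: fspanD|rewrite addrACA].
- by exists (ks c u1), (ks c u2); split; [exact: fspan_ks|exact: fspan_ks|rewrite raddfD].
rewrite mem_cat => /orP[] /fspan_mem Hf.
- by exists (ev E f), 0; split; rewrite ?addr0 //; exact: fspan0.
- by exists 0, (ev E f); split; rewrite ?add0r //; exact: fspan0.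
Qed.

Lemma fspan_catI fs gs u1 u2 : fspan fs u1 -> fspan gs u2 -> fspan (fs ++ gs) (u1 + u2).
Proof.
by move=> f1 g2; apply: fspanD; [apply: fspan_sub f1|apply: fspan_sub g2] => f fi;
  rewrite mem_cat fi ?orbT.
Qed.

Definition combine (a : seq int) (fs : seq fv) : fv :=
  flatten [seq fscale p.1 p.2 | p <- zip a fs].

(** The dual-basis formula: the coefficient at f is d(w) / d(f). The denominators d(f) are 1, 2 or
    3, so six times each coefficient is an integer. *)
Definition span_coefs (ds fs : seq fv) (w : fv) : seq int :=
  [seq ldiv 6 (absz (dot p.1 p.2)) * dot p.1 w | p <- zip ds fs].

Definition in_span ds fs w := feq 36 (fscale 6 w) (combine (span_coefs ds fs w) fs).

Lemma in_spanP ds fs w : in_span ds fs w -> fspan fs (ev E w).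
Proof.
move=> /(tmod_feq vtab_out vtab_ok k) ok.
have -> : ev E w = ks 6%:R^-1 (ev E (fscale 6 w)).
  by rewrite ev_scale -ks_int ksA mulVf ?ks1 //; exact: natk_neq0.
rewrite ok; apply: fspan_ks; rewrite /combine.
elim: fs (span_coefs _ _ _) {ok} => [|f fs IH] [|a s] /=; try by rewrite ev_nil; exact: fspan0.
rewrite ev_cat ev_scale -ks_int; apply: fspanD.
  by apply/fspan_ks/fspan_mem; rewrite mem_head.
by apply: fspan_sub (IH s) => g gfs; rewrite inE gfs orbT.
Qed.

Definition gens_S3 (P : pred tgen) : bool := all (fun c => P (tG c) && P (tD c)) S3c.
Definition gens_all (P : pred tgen) : bool :=
  all (fun t => P (tX t) && P (tY t)) (iota 0 3) && gens_S3 P.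

Lemma gens_S3P P i : gens_S3 P -> P (dcode (D_ge0 (ge0_S3 i))).
Proof. by move=> /allP allP; case: i => g; have /andP[] := allP _ (code_in g). Qed.

Lemma gens_allP P i : gens_all P -> P (dcode i).
Proof.
case/andP=> /allP Pxy Ps.
have Pt t : P (tX (tfix t)) && P (tY (tfix t)) by apply: Pxy; rewrite mem_iota tfix_lt.
by case: i => [[i|t]|t]; first exact: gens_S3P; have /andP[] := Pt t.
Qed.

Definition stable_under ds fs (g : tgen) := all (fun f => in_span ds fs (fapp (vtab g) f)) fs.

Lemma fspan_stable ds fs i u :
  stable_under ds fs (dcode i) -> fspan fs u -> fspan fs (pgen (@Drel k) i *: u).
Proof.
move=> /allP st; move: u; apply: fspan_ind => [|u1 u2 H1 H2|c u1 H1|f ffs].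
- by rewrite raddf0; exact: fspan0.
- by rewrite scalerDr; exact: fspanD.
- by rewrite ks_scale; exact: fspan_ks.
- by rewrite tmod_gen_ev; apply: in_spanP; exact: st.
Qed.

Definition fW := fS ++ fL.
Definition dW := dS ++ dL.

Lemma fspan_S_submod : is_submod (fspan fS).
Proof.
apply: is_submod_gen; [exact: fspan0|exact: fspanD|exact: fspan_ks|move=> i u].
have ok : gens_all (stable_under dS fS) by vm_compute.
exact: fspan_stable (gens_allP i ok).
Qed.

Lemma fspan_W_submod : is_submod (fspan fW).
Proof.
apply: is_submod_gen; [exact: fspan0|exact: fspanD|exact: fspan_ks|move=> i u].
have ok : gens_all (stable_under dW fW) by vm_compute.
exact: fspan_stable (gens_allP i ok).
Qed.

Definition bounded (d : fv) := all (fun p => p.2 < 36)%N d.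

Definition orthogonal ds fs := all (fun d => bounded d && all (fun f => dot d f == 0) fs) ds.

Lemma pairing_orthogonal ds fs d u : orthogonal ds fs -> d \in ds -> fspan fs u -> pairing d u = 0.
Proof.
move=> /allP o dds; have /andP[bd /allP od] := o d dds; move: u; apply: fspan_ind => [|u1 u2 H1 H2|c u1 H1|f ffs].
- exact: raddf0.
- by rewrite raddfD /= H1 H2 addr0.
- by rewrite pairing_ks H1 mulr0.
- by rewrite pairing_ev // (eqP (od f ffs)).
Qed.

Definition dual_families ds fs := (size ds == size fs) && all (fun i => bounded (nth [::] ds i) &&
  all (fun j => (dot (nth [::] ds i) (nth [::] fs j) == 0) == (i != j)) (iota 0 (size fs)))
  (iota 0 (size fs)).

Lemma dual_eq0 ds fs u : dual_families ds fs -> fspan fs u ->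
  (forall d, d \in ds -> pairing d u = 0) -> u = 0.
Proof.
case/andP=> /eqP sz /allP ok [c ->] d0; rewrite big1 // => i _.
have io (j : 'I_(size fs)) : val j \in iota 0 (size fs) by rewrite mem_iota ltn_ord.
have /andP[bi /allP oki] := ok _ (io i).
suff -> : c i = 0 by rewrite ks0.
have := d0 (nth [::] ds i); rewrite mem_nth ?sz ?ltn_ord // => /(_ isT).
rewrite raddf_sum (bigD1 i) //= big1 => [|j ji].
  rewrite addr0 pairing_ks pairing_ev // => /eqP; rewrite mulf_eq0 => /orP[/eqP //|].
  have /eqP := oki _ (io i).
  by rewrite eqxx => /negbT/intk_neq0/negPf ->.
rewrite pairing_ks pairing_ev //; have /eqP := oki _ (io j).
have -> : (val i != val j) by rewrite eq_sym.
by move/eqP->; rewrite mulr0.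
Qed.

(** The functionals [ds] separate the vectors of [fspan fs] and vanish on [fspan gs], hence on u1 =
    -u2. *)
Lemma fspan_direct ds fs gs u1 u2 : dual_families ds fs -> orthogonal ds gs ->
  fspan fs u1 -> fspan gs u2 -> u1 + u2 = 0 -> u1 = 0.
Proof.
move=> dd oo f1 g2 u0; apply: dual_eq0 dd f1 _ => d dds.
by rewrite -[LHS]addr0 -[X in _ + X](pairing_orthogonal oo dds g2) -raddfD /= u0 raddf0.
Qed.

Definition projX u : L7 := \sum_(j < 7) ksL (pairing (nth [::] dL j) u) (EL j).

Fact projX_additive : zmod_morphism projX.
Proof.
move=> u u'; rewrite /projX -sumrB; apply: eq_bigr => j _.
by rewrite raddfB ksDl /kscale !scaleNr.
Qed.
HB.instance Definition _ := GRing.isZmodMorphism.Build X L7 projX projX_additive.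

Lemma projX_ks c u : projX (ks c u) = ksL c (projX u).
Proof. by rewrite raddf_sum; apply: eq_bigr => j _ /=; rewrite pairing_ks ksA. Qed.

Lemma projX_ev v : projX (ev E v) = ev EL (proj_fv v).
Proof.
rewrite /projX /proj_fv /ev big_map -[iota 0 7]/(index_iota 0 7) big_mkord; apply: eq_bigr => j _.
rewrite pairing_ev ?ks_int //.
have /allP : all (fun j => bounded (nth [::] dL j)) (iota 0 7) by [].
by apply; rewrite mem_iota ltn_ord.
Qed.

(** The restriction to [fspan fW] matters: |23> is sent to 0 by [projX], while x_(23)|23> is not. *)
Lemma projX_gen i u : fspan fW u -> projX (pgen (@Drel k) i *: u) = pgen (@Drel k) i *: projX u.
Proof.
move: u; apply: fspan_ind => [|u1 u2 H1 H2|c u1 H1|f ffs].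
- by rewrite !raddf0.
- by rewrite scalerDr !raddfD /= H1 H2.
- by rewrite ks_scale !projX_ks H1 ks_scale.
rewrite tmod_gen_ev !projX_ev tmod_gen_ev; apply: tmod_feq.
pose P g := all (fun f => feq 7 (proj_fv (fapp (vtab g) f)) (fapp (ltab g) (proj_fv f))) fW.
have ok : gens_all P by vm_compute.
by have /allP := gens_allP i ok; apply.
Qed.

Lemma projX_S u : fspan fS u -> projX u = 0.
Proof.
move: u; apply: fspan_ind => [|u1 u2 H1 H2|c u1 H1|f ffs].
- exact: raddf0.
- by rewrite raddfD /= H1 H2 addr0.
- by rewrite projX_ks H1 raddf0.
rewrite projX_ev -(ev_nil EL); apply: tmod_feq.
by have /allP : all (fun f => feq 7 (proj_fv f) [::]) fS; [vm_compute|apply].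
Qed.

Lemma projX_ker u : fspan fW u -> projX u = 0 -> fspan fS u.
Proof.
move=> /fspan_cat[u1 [u2 [S1 L2 ->]]]; rewrite raddfD /= (projX_S S1) add0r => p0.
suff -> : u2 = 0 by rewrite addr0.
apply: (@dual_eq0 dL fL) => // d dP; have := congr1 (tcoord (index d dL)) p0.
have d7 : (index d dL < 7)%N by rewrite (_ : 7 = size dL)%N // index_mem.
rewrite raddf0 raddf_sum (bigD1 (Ordinal d7)) //= big1 => [|j].
  by rewrite addr0 co_ks co_tb d7 eqxx mulr1 nth_index.
by rewrite -val_eqE /= eq_sym => /negPf jd; rewrite co_ks co_tb jd andbF mulr0.
Qed.

Lemma projX_surj (l : L7) : exists2 u, fspan fW u & projX u = l.
Proof.
pose c j : k := (nth 1%N lweight j)%:R^-1 * tcoord j l.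
exists (\sum_(j < 7) ks (c j) (ev E (nth [::] fL j))).
  by apply: (@fspan_sub fL) => [f fP|]; [rewrite mem_cat fP orbT|exists c].
rewrite [RHS](tmod_sum l) raddf_sum; apply: eq_bigr => j _ /=.
rewrite projX_ks projX_ev.
have /allP/(_ j) : all (fun j => (nth 1 lweight j != 0)%N &&
    feq 7 (proj_fv (nth [::] fL j)) [:: (Posz (nth 1%N lweight j), j)]) (iota 0 7) by vm_compute.
rewrite mem_iota => /(_ (ltn_ord j))/andP[w0 /(tmod_feq ltab_out ltab_ok k) ->].
rewrite ev_cons ev_nil addr0 -ks_int ksA /c mulrAC.
by rewrite mulVf ?mul1r //; exact: (intk_neq0 (z := Posz _)).
Qed.

End Span.

(** * Transport of simplicity and of highest weights along isomorphisms *)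

Section Transfer.
Variables (R : pzRingType) (U W : lmodType R) (g : {linear U -> W}) (h : W -> U).
Hypotheses (gK : cancel g h) (hK : cancel h g).

Lemma simple_mod_iso : simple_mod W -> simple_mod U.
Proof.
move=> [[w w0] simW]; split.
  by exists (h w); apply: contra w0 => /eqP hw; rewrite -(hK w) hw raddf0.
move=> N; have [N0|N1] := simW (im_submod g N).
  left=> u Nu; have gu0 : g u = 0 by apply/N0/SubmodP; exists u.
  by apply: (can_inj gK); rewrite gu0 raddf0.
by right=> u; have /SubmodP[u' Nu' /(can_inj gK) ->] := N1 (g u).
Qed.

End Transfer.

Lemma highest_weight_iso (k : fieldType) (U W : lmodType (DD k)) (M : lmodType (DS3 k))
    (g : {linear U -> W}) (h : W -> U) :
  cancel g h -> cancel h g -> highest_weight W M -> highest_weight U M.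
Proof.
move=> gK hK [N [[f fbij] Ny gen]].
pose g' : res_mod (S3_to_D k) U -> res_mod (S3_to_D k) W := g.
have g'lin : linear g' by move=> a u v; rewrite /g' linearP.
pose gL : {linear res_mod (S3_to_D k) U -> res_mod (S3_to_D k) W} :=
  HB.pack g' (GRing.isLinear.Build _ _ _ _ g' g'lin).
pose N' := preim_submod gL N.
have N'P u : (u \in N') = (g u \in N) by apply/SubmodP/idP.
have hlin : linear h := linear_bij_inv gK hK.
exists N'; split.
- have toN (w : sub_mod N') : g' (val w) \in N by rewrite -N'P (valP w).
  pose r (w : sub_mod N') : sub_mod N := sub_intro (toN w).
  have rlin : linear r.
    move=> a u v; apply/val_inj; rewrite [RHS]linearP /= -g'lin.
    by congr g'; exact: linearP.
  pose rL : {linear sub_mod N' -> sub_mod N} := HB.pack r (GRing.isLinear.Build _ _ _ _ r rlin).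
  exists (f \o rL); apply: bij_comp fbij _.
  have fromN (w : sub_mod N) : (h (val w) : res_mod (S3_to_D k) U) \in N'.
    by rewrite N'P hK (valP w).
  exists (fun w => sub_intro (fromN w)) => w; apply/val_inj => /=; [exact: gK|exact: hK].
- move=> t u; rewrite N'P => /(Ny t) gu; apply: (can_inj gK).
  by rewrite linearZ raddf0.
move=> u; apply/SubmodP=> P NP.
have hL : {linear W -> U} := HB.pack h (GRing.isLinear.Build _ _ _ _ h hlin).
have im0 : is_submod (fun w => h w \in P).
  split=> [|a w w' Pw Pw']; last by rewrite hlin rpredD ?rpredZ.
  by rewrite -(raddf0 g) gK rpred0.
have /SubmodP/(_ (Submod im0)) := gen (g u).
rewrite -[u in X in _ -> X]gK => H; apply/(SubmodP im0)/H => w Nw.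
by apply/SubmodP/NP; rewrite N'P hK.
Qed.

(** * VQN inside the Verma module and its quotient by the socle *)

Section Main.
Variable k : fieldType.
Hypothesis char0 : [pchar k] =i pred0.
Variable zeta : k.
Hypothesis zetaP : 3.-primitive_root zeta.
Local Notation V := (Verma (M_sigma_m k)).
Local Notation V' := (res_mod (S3_to_D k) V).
Local Notation X := (tmod vtab_out vtab_ok k).
Local Notation E := (tb vtab_out vtab_ok k).
Local Notation ksX := (@kscale k Dgen (@Drel k) X).
Local Notation ksV := (@kscale k Dgen (@Drel k) V).
Local Notation G g := (pgen (@Drel k) (D_ge0 (ge0_S3 (S3_g g)))).

Lemma zeta_neq0 : zeta != 0.
Proof.
apply/eqP=> z0; have := prim_expr_order zetaP; rewrite z0 expr0n /= => /eqP.
by rewrite eq_sym oner_eq0.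
Qed.

Lemma zeta_neq1 : zeta - 1 != 0.
Proof. by rewrite subr_eq0; have := prim_order_dvd zetaP 1; rewrite expr1 => <-. Qed.

Definition fV := take 2 fL.
Definition fQ := take 3 (drop 2 fL).
Definition fN := drop 5 fL.

Lemma socle_V u : (u \in socle_mod V) <-> fspan fS (vX u).
Proof.
pose S := preim_submod (@vX k) (Submod (fspan_S_submod char0)).
have SP v : v \in S <-> fspan fS (vX v).
  by split=> [/SubmodP/SubmodP //|Sv]; do 2!apply/SubmodP.
suff -> : socle_mod V =i S by exact: SP.
apply: socle_unique.
  exists (vrecon (ev E (nth [::] fS 9))).
    by apply/SP; rewrite vreconK; apply: fspan_mem; rewrite mem_nth.
  apply/eqP=> /(congr1 (@vX k)); rewrite vreconK raddf0 => /(congr1 (tcoord 35)).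
  by rewrite co_ev // raddf0; apply/eqP; exact: oner_neq0.
move=> N [n Nn n0] {}u /SP.
have Nf := @socle_generated k (im_submod (@vX k) N).
suff H v : fspan fS v -> v \in im_submod (@vX k) N.
  by move/H/SubmodP=> [n' Nn' /vX_inj ->].
move: v; apply: fspan_ind => [|v v' Pv Pv'|c v Pv|f /(nthP [::])[j j10 <-]].
- exact: rpred0.
- exact: rpredD.
- by rewrite /kscale rpredZ.
apply: Nf => //; exists (vX n); first by apply/SubmodP; exists n.
by apply: contra n0 => /eqP vn; apply/eqP/vX_inj; rewrite vn raddf0.
Qed.

Lemma gen_V (N : submodClosed V') u i : (u : V') \in N ->
  (pgen (@Drel k) (D_ge0 (ge0_S3 i)) *: (u : V) : V') \in N.
Proof. by move=> Nu; rewrite -S3_to_D_gen; exact: (rpredZ (pgen (@S3rel k) i)). Qed.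

Lemma ks_V (N : submodClosed V') u c : (u : V') \in N -> (ksV c u : V') \in N.
Proof. by move=> Nu; rewrite /kscale -S3_to_D_scalar; exact: (rpredZ (c *: (1 : DS3 k))). Qed.

(** Stability makes [fspan fs] a module over the double of the group algebra that contains [w]; the
    last hypothesis says that [w] generates every vector of [fs]. *)
Lemma S3_spanP ds fs (w : V) :
  gens_S3 (stable_under ds fs) -> fspan fs (vX w) ->
  (forall N : submodClosed V', (w : V') \in N ->
     forall f, f \in fs -> (vrecon (ev E f) : V') \in N) ->
  forall u : V, ((u : V') \in S3_span w) <-> fspan fs (vX u).
Proof.
move=> st fw gen u; split.
  move=> /SubmodP Nu.
  have sub : is_submod (fun u : V' => fspan fs (vX u)).
    apply: (@is_submod_gen k S3gen (@S3rel k) V') => [|v v' H H'|c v H|i v H].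
    - by rewrite raddf0; exact: fspan0.
    - by rewrite raddfD; exact: fspanD.
    - by rewrite [kscale _ _]/(S3_to_D k _ *: _) S3_to_D_scalar linearZ; exact: fspan_ks.
    - rewrite [pgen _ _ *: _]/(S3_to_D k _ *: (v : V)) S3_to_D_gen linearZ.
      exact: (fspan_stable char0 (gens_S3P i st) H).
  by have /SubmodP := Nu (Submod sub) (fun v vw => introT (SubmodP sub v) (eq_ind_r (fun v => fspan fs (vX v)) fw vw)).
move=> fu; apply/SubmodP=> N Nw; rewrite -(vXK u).
move: (vX u) fu; apply: fspan_ind => [|v v' H H'|c v H|f ffs].
- by rewrite raddf0 rpred0.
- by rewrite raddfD; exact: rpredD.
- by rewrite vrecon_ks; exact: ks_V.
- by apply: gen ffs; exact: Nw.
Qed.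

Lemma vX_x t u v : (t < 3)%N -> vX u = ev E v -> vX (xD k (tcode t) *: u) = ev E (fapp (vtab (tX t)) v).
Proof.
move=> t3 uv; have -> : vX (xD k (tcode t) *: u) = xD k (tcode t) *: vX u by exact: linearZ.
by rewrite uv tmod_gen_ev /= tfix_tcode.
Qed.

Lemma vX_ket t : (t < 3)%N -> vX (vket k true (tcode t)) = ev E [:: (1, t)].
Proof. by move=> t3; rewrite vX_vket tfix_tcode ?ev1. Qed.

Local Notation x t := (xD k (tcode t)).
Local Notation v t := (vket k true (tcode t)).

Lemma vX_word (ts : seq nat) t : (t < 3)%N -> all (fun t => t < 3)%N ts ->
  vX (foldr (fun s u => x s *: u) (v t) ts)
  = ev E (foldr (fun s => fapp (vtab (tX s))) [:: (1, t)] ts).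
Proof.
move=> t3; elim: ts => [|s ts IH] /=; first by rewrite vX_ket.
by case/andP=> s3 /IH; exact: vX_x.
Qed.

Lemma evN (U : zmodType) (F : nat -> U) w : - ev F w = ev F (fscale (-1) w).
Proof. by rewrite ev_scale mulrN1z. Qed.

Lemma vXB u w : @vX k (u - w) = vX u - vX w. Proof. exact: raddfB. Qed.
Lemma vXD u w : @vX k (u + w) = vX u + vX w. Proof. exact: raddfD. Qed.

(** The vectors of [fQ] are listed by the code of their degree, and q has degree (12), of code 2. *)
Lemma vX_q : vX (vec_q k) = ev E (nth [::] fQ 2).
Proof.
have split (R : pzRingType) (U : lmodType R) (a b c d : R) (u w : U) :
    (a * b) *: u - (c * d) *: w = a *: (b *: u) - c *: (d *: w) by rewrite !scalerA.
transitivity (vX (foldr (fun s u => x s *: u) (v 0) [:: 2; 0]%N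
    - foldr (fun s u => x s *: u) (v 1) [:: 2; 1]%N)).
  by congr vX; exact: split.
apply: etrans (vXB _ _) (etrans (congr2 (fun a b => a - b)
  (@vX_word [:: 2; 0]%N 0 isT isT) (@vX_word [:: 2; 1]%N 1 isT isT)) _).
rewrite evN -ev_cat; apply: tmod_feq.
by vm_compute.
Qed.

Lemma vX_n0 : vX (vec_n0 k) = ev E (nth [::] fN 0).
Proof.
have split (R : pzRingType) (U : lmodType R) (a b c d e f g h i : R) (u w z : U) :
    (a * b * c) *: u + (d * e * f) *: w - (g * h * i) *: z =
    a *: (b *: (c *: u)) + d *: (e *: (f *: w)) - g *: (h *: (i *: z)).
  by rewrite !scalerA.
transitivity (vX (foldr (fun s u => x s *: u) (v 0) [:: 1; 2; 0]%N
    + foldr (fun s u => x s *: u) (v 2) [:: 2; 1; 0]%N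
    - foldr (fun s u => x s *: u) (v 1) [:: 2; 1; 2]%N)).
  by congr vX; exact: split.
apply: etrans (vXB _ _) (etrans (congr2 (fun a b => a - b) (etrans (vXD _ _)
  (congr2 (fun a b => a + b) (@vX_word [:: 1; 2; 0]%N 0 isT isT)
    (@vX_word [:: 2; 1; 0]%N 2 isT isT))) (@vX_word [:: 2; 1; 2]%N 1 isT isT)) _).
rewrite evN -!ev_cat; apply: tmod_feq.
by vm_compute.
Qed.

Lemma vX_v : vX (vec_v zeta) =
  ksX zeta^-1 (ev E (nth [::] fV 0)) + ksX zeta (ev E (nth [::] fV 1)).
Proof.
have xv t i : (t < 3)%N -> feq 36 (fapp (vtab (tX t)) [:: (1, t)]) [:: (1, i)] ->
    vX (x t *: v t) = E i.
  move=> t3 ok; rewrite -ev1 -(tmod_feq vtab_out vtab_ok k ok).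
  by apply: (vX_x t3); exact: vX_ket.
transitivity (vX (ksV zeta^-1 (x 0 *: v 0) + ksV zeta (x 1 *: v 1) + x 2 *: v 2)).
  by congr vX; congr (_ + _ + _); exact: pscale_scale.
apply: etrans (vXD _ _) (etrans (congr2 (fun a b => a + b) (etrans (vXD _ _)
  (congr2 (fun a b => a + b) (etrans (vX_ks _ _) (congr1 (ksX zeta^-1) (xv 0%N 3%N isT isT)))
    (etrans (vX_ks _ _) (congr1 (ksX zeta) (xv 1%N 7%N isT isT))))) (xv 2%N 11%N isT isT)) _).
(* This places v among the sums of a_t x_t|t> with coefficients of total 0. *)
have z2 : zeta^-1 + zeta + 1 = 0.
  apply: (mulfI zeta_neq0); apply: (mulfI zeta_neq1); rewrite !mulrDr mulfV ?zeta_neq0 // !mulr0.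
  by have := prim_expr_order zetaP => z3; rewrite -[RHS](subrr 1) -{1}z3; ring.
have f0E : ev E (nth [::] fV 0) = E 3 - E 11.
  by rewrite -(ev1 E 3) -(ev1 E 11) evN -ev_cat.
have f1E : ev E (nth [::] fV 1) = E 7 - E 11.
  by rewrite -(ev1 E 7) -(ev1 E 11) evN -ev_cat.
rewrite f0E f1E; move: (E 3) (E 7) (E 11) => e3 e7 e11; apply: co_inj => i _.
rewrite ?raddfD /= !co_ks ?raddfD /= ?raddfN /= -[tcoord i e11 in LHS]mul1r.
have -> : 1 = - (zeta^-1 + zeta) by apply/eqP; rewrite -addr_eq0 addrC z2.
by ring.
Qed.

Definition dV := take 2 dL.
Definition dQ := take 3 (drop 2 dL).
Definition dN := drop 5 dL.

Lemma gen_G (N : submodClosed V') u w f c : c \in S3c -> (u : V') \in N -> vX u = ev E w ->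
  feq 36 (fapp (vtab (tG c)) w) f -> (vrecon (ev E f) : V') \in N.
Proof.
move=> /code_surj[g <-] Nu uw /(tmod_feq vtab_out vtab_ok k) <-.
have -> : vrecon (ev E (fapp (vtab (tG (code g))) w)) = G g *: u; last exact: gen_V.
apply: (@vX_inj k); rewrite vreconK.
have -> : vX (G g *: u) = G g *: vX u by exact: linearZ.
by rewrite uw tmod_gen_ev.
Qed.

Lemma span_V u : ((u : V') \in S3_span (vec_v zeta)) <-> fspan fV (vX u).
Proof.
apply: (@S3_spanP dV) u; first by vm_compute.
  by rewrite vX_v; apply: fspanD; apply/fspan_ks/fspan_mem.
move=> N Nv.
have [g gE] : exists g, code g = [:: 1; 0; 2]%N by apply: code_surj.
have Nw := gen_V (S3_g g) Nv; set w := G g *: _ in Nw.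
pose f0 := ev E (nth [::] fV 0); pose f1 := ev E (nth [::] fV 1).
have Gf : G g *: f0 = f1 /\ G g *: f1 = f0.
  by split; rewrite /f0 /f1 tmod_gen_ev /dcode gE; apply: tmod_feq; vm_compute.
have vXw : vX w = ksX zeta^-1 f1 + ksX zeta f0.
  have -> : vX w = G g *: vX (vec_v zeta) by exact: linearZ.
  by rewrite vX_v scalerDr !ks_scale Gf.1 Gf.2.
(* The determinant of v and (12) v in the basis [f0], [f1], which (12) exchanges. Since zeta^3 = 1,
   it equals zeta - zeta^2 and is invertible. *)
pose d := zeta^-1 * zeta^-1 - zeta * zeta.
have d0 : d != 0.
  have -> : d = zeta * (1 - zeta).
    do 2!apply: (mulfI zeta_neq0).
    have -> : zeta * (zeta * d) = 1 - zeta ^+ 3 * zeta by rewrite /d; field; exact: zeta_neq0.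
    have -> : zeta * (zeta * (zeta * (1 - zeta))) = zeta ^+ 3 * (1 - zeta) by ring.
    by rewrite (prim_expr_order zetaP) !mul1r.
  by rewrite mulf_neq0 ?zeta_neq0 // -opprB oppr_eq0 zeta_neq1.
have comb a b (f : X) : ksX a (vX (vec_v zeta)) + ksX b (vX w) = ksX d f ->
    (vrecon f : V') \in N.
  move=> H; have -> : vrecon f = ksV d^-1 (ksV a (vec_v zeta) + ksV b w).
    apply: (@vX_inj k); rewrite vreconK.
    apply: esym; apply: etrans (vX_ks _ _) (etrans (congr1 (ksX d^-1) (etrans (vXD _ _)
      (etrans (congr2 (fun a b => a + b) (vX_ks _ _) (vX_ks _ _)) H))) _).
    by rewrite ksA mulVf // ks1.
  by apply/ks_V/rpredD; exact: ks_V.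
move=> f; rewrite !inE => /orP[/eqP->|/eqP->].
(* The coefficients are those of Cramer's rule. *)
- apply: (comb zeta^-1 (- zeta)); rewrite vX_v vXw -/f0 -/f1; apply: co_inj => i _.
  by move: (f0) (f1) => y0 y1; rewrite !raddfD /= !co_ks ?raddfD /= ?co_ks /d; ring.
- apply: (comb (- zeta) zeta^-1); rewrite vX_v vXw -/f0 -/f1; apply: co_inj => i _.
  by move: (f0) (f1) => y0 y1; rewrite !raddfD /= !co_ks ?raddfD /= ?co_ks /d; ring.
Qed.

Lemma span_Q u : ((u : V') \in S3_span (vec_q k)) <-> fspan fQ (vX u).
Proof.
apply: (@S3_spanP dQ) u; first by vm_compute.
  by rewrite vX_q; apply: fspan_mem.
move=> N Nq f; rewrite !inE => /or3P[]/eqP->.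
- by apply: (gen_G (c := [:: 1; 2; 0]%N) _ Nq vX_q) => //; vm_compute.
- by apply: (gen_G (c := [:: 2; 0; 1]%N) _ Nq vX_q) => //; vm_compute.
- by apply: (gen_G (c := [:: 0; 1; 2]%N) _ Nq vX_q) => //; vm_compute.
Qed.

Lemma span_N u : ((u : V') \in S3_span (vec_n0 k)) <-> fspan fN (vX u).
Proof.
apply: (@S3_spanP dN) u; first by vm_compute.
  by rewrite vX_n0; apply: fspan_mem.
move=> N Nn f; rewrite !inE => /orP[]/eqP->.
- by apply: (gen_G (c := [:: 0; 1; 2]%N) _ Nn vX_n0) => //; vm_compute.
- by apply: (gen_G (c := [:: 1; 0; 2]%N) _ Nn vX_n0) => //; vm_compute.
Qed.

Lemma span_S u : ((u : V') \in res_submod (S3_to_D k) (socle_mod V)) <-> fspan fS (vX u).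
Proof. by split=> [/SubmodP/socle_V|/socle_V Su] //; exact/SubmodP. Qed.

Lemma fW_split : fW = ((fS ++ fV) ++ fQ) ++ fN.
Proof. by []. Qed.

Lemma VQNP u : ((u : V') \in VQN zeta) <-> fspan fW (vX u).
Proof.
rewrite fW_split; split.
  move/SubmodP=> [_ [u4 [/SubmodP[_ [u3 [/SubmodP[u1 [u2 [/span_S H1 /span_V H2 ->]]]
    /span_Q H3 ->]]] /span_N H4 ->]]].
  have -> : vX (u1 + u2 + u3 + u4 : V) = vX (u1 : V) + vX (u2 : V) + vX (u3 : V) + vX (u4 : V).
    by rewrite !vXD.
  by do 3!apply: fspan_catI => //.
move=> /fspan_cat[_ [u4 [/fspan_cat[_ [u3 [/fspan_cat[u1 [u2 [H1 H2 ->]]] H3 ->]]] H4 E4]]].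
have -> : u = vrecon u1 + vrecon u2 + vrecon u3 + vrecon u4.
  by apply: (@vX_inj k); rewrite E4 !vXD !vreconK.
apply/SubmodP; exists (vrecon u1 + vrecon u2 + vrecon u3), (vrecon u4); split=> //.
- apply/SubmodP; exists (vrecon u1 + vrecon u2), (vrecon u3); split=> //.
  + apply/SubmodP; exists (vrecon u1), (vrecon u2); split=> //.
    * by apply/span_S; rewrite vreconK.
    * by apply/span_V; rewrite vreconK.
  + by apply/span_Q; rewrite vreconK.
- by apply/span_N; rewrite vreconK.
Qed.

Lemma direct_part ds fs gs (u r : V) : dual_families ds fs -> orthogonal ds gs ->
  fspan fs (vX u) -> fspan gs (vX r) -> u + r = 0 -> u = 0.
Proof.
move=> dd oo fu gr ur; apply: (@vX_inj k); rewrite raddf0.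
by apply: (fspan_direct char0 dd oo fu gr); rewrite -vXD ur raddf0.
Qed.

Lemma VQN_is_direct : VQN_direct zeta.
Proof.
move=> u1 u2 u3 u4 /span_S H1 /span_V H2 /span_Q H3 /span_N H4 sum0.
have cat3 gs1 gs2 gs3 (w1 w2 w3 : V) : fspan gs1 (vX w1) -> fspan gs2 (vX w2) ->
    fspan gs3 (vX w3) -> fspan (gs1 ++ gs2 ++ gs3) (vX (w1 + (w2 + w3))).
  by move=> ? ? ?; rewrite !vXD; do 2!apply: fspan_catI => //.
split.
- have dd : dual_families dS fS by vm_compute.
  have oo : orthogonal dS (fV ++ fQ ++ fN) by vm_compute.
  apply: (direct_part dd oo H1 (cat3 _ _ _ _ _ _ H2 H3 H4)).
  by rewrite !addrA.
- have dd : dual_families dV fV by vm_compute.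
  have oo : orthogonal dV (fS ++ fQ ++ fN) by vm_compute.
  apply: (direct_part dd oo H2 (cat3 _ _ _ _ _ _ H1 H3 H4)).
  by rewrite !addrA [u2 + u1]addrC.
- have dd : dual_families dQ fQ by vm_compute.
  have oo : orthogonal dQ (fS ++ fV ++ fN) by vm_compute.
  apply: (direct_part dd oo H3 (cat3 _ _ _ _ _ _ H1 H2 H4)).
  by rewrite addrC !addrA [_ + u4 + u3]addrAC.
- have dd : dual_families dN fN by vm_compute.
  have oo : orthogonal dN (fS ++ fV ++ fQ) by vm_compute.
  apply: (direct_part dd oo H4 (cat3 _ _ _ _ _ _ H1 H2 H3)).
  by rewrite addrC !addrA.
Qed.

(** [VQN] is built as a submodule over the double of the group algebra only; this is the D-submodule
    with the same elements. *)
Definition VQN_mod := preim_submod (@vX k) (Submod (fspan_W_submod char0)).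

Lemma VQN_modP u : u \in VQN_mod <-> fspan fW (vX u).
Proof. by split=> [/SubmodP/SubmodP //|Wu]; do 2!apply/SubmodP. Qed.

Definition proj_VQN (w : sub_mod VQN_mod) : L7 k := projX (vX (val w)).

Fact proj_VQN_additive : zmod_morphism proj_VQN.
Proof. by move=> w w'; rewrite /proj_VQN [val _]raddfB vXB raddfB. Qed.
HB.instance Definition _ := GRing.isZmodMorphism.Build (sub_mod VQN_mod) (L7 k) proj_VQN proj_VQN_additive.

Fact proj_VQN_scalable : scalable proj_VQN.
Proof.
apply: (@scalable_gen k Dgen (@Drel k) (sub_mod VQN_mod) (L7 k) proj_VQN) => [c w|i w].
- have cw : val (@kscale k Dgen (@Drel k) (sub_mod VQN_mod) c w) = ksV c (val w) by exact: linearZ.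
  apply: etrans (congr1 (fun u => projX (vX u)) cw) _.
  by apply: etrans (congr1 (@projX k) (vX_ks c (val w))) _; exact: projX_ks.
- have iw : val (pgen (@Drel k) i *: w) = pgen (@Drel k) i *: val w by exact: linearZ.
  apply: etrans (congr1 (fun u => projX (vX u)) iw) _.
  have viw : vX (pgen (@Drel k) i *: val w) = pgen (@Drel k) i *: vX (val w) by exact: linearZ.
  by apply: etrans (congr1 (@projX k) viw) _; apply: projX_gen; apply/VQN_modP; exact: valP.
Qed.
HB.instance Definition _ := GRing.isScalable.Build (DD k) (sub_mod VQN_mod) (L7 k) *:%R proj_VQN proj_VQN_scalable.

Lemma subquot_L7 : exists g : {linear subquot_mod VQN_mod (socle_mod V) -> L7 k}, bijective g.
Proof.
have surj l : exists w : sub_mod VQN_mod, proj_VQN w = l.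
  have [u Wu ul] := projX_surj char0 l.
  have Wv : vrecon u \in VQN_mod by apply/VQN_modP; rewrite vreconK.
  by exists (sub_intro Wv); rewrite /proj_VQN /= vreconK.
have [|g [gbij _]] := quot_iso (N := restr_submod (socle_mod V) VQN_mod) surj; last by exists g.
move=> w; split.
  by move=> /SubmodP/socle_V; exact: projX_S.
move=> w0; apply/SubmodP/socle_V; apply: (projX_ker char0) w0.
by apply/VQN_modP; exact: valP.
Qed.

End Main.

Theorem corollary22 (k : closedFieldType) (char0 : [pchar k] =i pred0)
    (zeta : k) (zetaP : 3.-primitive_root zeta) :
  [/\ VQN_direct zeta,
      exists W : submodClosed (Verma (M_sigma_m k)),
        [/\ forall u : Verma (M_sigma_m k), (u \in W) = (u \in VQN zeta),
            simple_mod (subquot_mod W (socle_mod (Verma (M_sigma_m k))))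
          & highest_weight (subquot_mod W (socle_mod (Verma (M_sigma_m k))))
              (M_e_rho k)]
    & iso_mod (res_mod (S3_to_D k) (L_simple (M_e_rho k)))
        (M_e_rho k * M_sigma_p k * M_tau_0 k)%type].
Proof.
split; first exact: VQN_is_direct.
  exists (VQN_mod char0).
  have [g [h gK hK]] := subquot_L7 char0.
  split; last first.
  - exact: highest_weight_iso gK hK (L7_highest_weight char0).
  - exact: simple_mod_iso gK hK (L7_simple char0).
  - by move=> u; apply/idP/idP => [/VQN_modP/(VQNP char0 zetaP)|/(VQNP char0 zetaP)/VQN_modP].
have [g gbij] := L_simple_L7 char0.
pose g' : res_mod (S3_to_D k) (L_simple (M_e_rho k)) -> res_mod (S3_to_D k) (L7 k) := g.
have g'lin : linear g' by move=> a u v; rewrite /g' linearP.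
have ilin : linear (@sum_inv k) := linear_bij_inv (@sum_mapK k) (@sum_invK k).
have fbij : bijective (@sum_inv k \o g').
  by apply: bij_comp gbij; exists (@sum_map k); [exact: sum_invK|exact: sum_mapK].
have flin : linear (@sum_inv k \o g') by move=> a u v; rewrite /= g'lin ilin.
pose f : {linear res_mod (S3_to_D k) (L_simple (M_e_rho k)) ->
    (M_e_rho k * M_sigma_p k * M_tau_0 k)%type} :=
  HB.pack (@sum_inv k \o g') (GRing.isLinear.Build _ _ _ _ (@sum_inv k \o g') flin).
by exists f.
Qed.
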